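(* Let $\gamma\in(0,1)$. Then $$\bigcup_{q\in(1,\infty]}RH_q^+=\bigcup_{r\in[1,\infty)}A_r^+(\gamma).$$ More precisely, if $w\in A_r^+(\gamma)$ for some $r\in[1,\infty)$, then there exists $q\in(1,\infty]$, depending only on $n,p,r,\gamma$, and $[w]_{A_r^+(\gamma)}$, such that $w\in RH_q^+$. Conversely, if $w\in RH_q^+$ for some $q\in(1,\infty]$, then there exists $r\in[1,\infty)$, depending only on $n,p,q,\gamma$, and $[w]_{RH_q^+}$, such that $w\in A_r^+(\gamma)$.
   Context: Work in $\mathbb{R}^{n+1}$, with points $(x,t)$, $x\in\mathbb{R}^n$, $t\in\mathbb{R}$; $p\in(1,\infty)$ is fixed throughout. $Q(x,L)=\{y\in\mathbb{R}^n: x_i-\frac L2\le y_i<x_i+\frac L2 \text{ for all } i\in\{1,\dots,n\}\}$. A parabolic rectangle centered at $(x,t)$ with edge length $l(R):=L\in(0,\infty)$ is $R=R(x,t,L)=Q(x,L)\times[t-L^p,t+L^p)$; $\mathcal{R}$ is the set of all parabolic rectangles. For $\gamma\in[0,1)$ (the time lag), $R^-(\gamma)=Q(x,L)\times[t-L^p,t-\gamma L^p)$ and $R^+(\gamma)=Q(x,L)\times[t+\gamma L^p,t+L^p)$. $\fint_A f=\frac1{|A|}\int_A f$ (Lebesgue measure $dx\,dt$). A weight is a nonnegative locally integrable function on $\mathbb{R}^{n+1}$ that is positive almost everywhere. For $\gamma\in[0,1)$ and $r\in[1,\infty)$, $A_r^+(\gamma)$ is the set of all weights $w$ with $[w]_{A_r^+(\gamma)}<\infty$,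 where $[w]_{A_1^+(\gamma)}=\sup_{R\in\mathcal{R}}\fint_{R^-(\gamma)}w\,[\operatorname{ess\,inf}_{R^+(\gamma)}w]^{-1}$ and, for $r\in(1,\infty)$, $[w]_{A_r^+(\gamma)}=\sup_{R\in\mathcal{R}}\fint_{R^-(\gamma)}w\,\big[\fint_{R^+(\gamma)}w^{\frac1{1-r}}\big]^{r-1}$. For $\gamma\in[0,1)$ and $q\in(1,\infty]$, $RH_q^+(\gamma)$ is the set of all weights $w$ with $[w]_{RH_q^+(\gamma)}<\infty$, where $[w]_{RH_q^+(\gamma)}=\sup_{R\in\mathcal{R}}\big[\fint_{R^-(\gamma)}w^q\big]^{\frac1q}\big[\fint_{R^+(\gamma)}w\big]^{-1}$ for $q\in(1,\infty)$ and $[w]_{RH_\infty^+(\gamma)}=\sup_{R\in\mathcal{R}}[\operatorname{ess\,sup}_{R^-(\gamma)}w]\big[\fint_{R^+(\gamma)}w\big]^{-1}$. Abbreviate $RH_q^+:=RH_q^+(0)$. *)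

(* Defs.v *)
From HB Require Import structures.
From mathcomp Require Import all_boot all_order all_algebra.
From mathcomp Require Import all_classical all_reals all_analysis.
From mathcomp Require Import ess_sup_inf.

Set Implicit Arguments.
Unset Strict Implicit.
Unset Printing Implicit Defensive.

Import Order.TTheory GRing.Theory Num.Theory.
Import numFieldNormedType.Exports.

Local Open Scope classical_set_scope.
Local Open Scope ring_scope.

Notation Rn R n := (n.-tuple (measurableTypeR R)).

Section borel_lebesgue_measure.
Variable R : realType.

Definition cons_pt n (z : measurableTypeR R * Rn R n) : Rn R n.+1 :=
  [tuple of z.1 :: z.2].

Lemma measurable_cons_pt n : measurable_fun setT (@cons_pt n).
Proof. exact: measurable_cons. Qed.

Definition uncons_pt n (y : Rn R n.+1) : measurableTypeR R * Rn R n :=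
  (thead y, [tuple of behead y]).

Lemma cons_ptK n : cancel (@cons_pt n) (@uncons_pt n).
Proof.
by case=> a y; rewrite /uncons_pt /cons_pt/= theadE; congr (_, _); exact: val_inj.
Qed.

Lemma uncons_ptK n : cancel (@uncons_pt n) (@cons_pt n).
Proof. by move=> y; rewrite /uncons_pt /cons_pt/= [RHS]tuple_eta. Qed.

Lemma measurable_uncons_pt n : measurable_fun setT (@uncons_pt n).
Proof.
apply/measurable_fun_pairP; split; first exact: measurable_tnth.
exact: measurable_behead.
Qed.

Section cons_measure.
Variables (n : nat) (m : {sigma_finite_measure set (Rn R n) -> \bar R}).

Definition cons_measure : set (Rn R n.+1) -> \bar R :=
  pushforward (@lebesgue_measure R \x m)%E (@cons_pt n).

Let cons_measure0 : cons_measure set0 = 0%E.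
Proof. by rewrite /cons_measure /pushforward preimage_set0 measure0. Qed.

Let cons_measure_ge0 A : (0 <= cons_measure A)%E.
Proof. exact: (measure_ge0 (@lebesgue_measure R \x m)%E). Qed.

Let cons_measure_sigma_additive : semi_sigma_additive cons_measure.
Proof.
apply: (@measure_semi_sigma_additive _ _ _
  (pushforward (@lebesgue_measure R \x m)%E (@cons_pt n))).
exact: measurable_cons_pt.
Qed.

HB.instance Definition _ := isMeasure.Build _ _ _ cons_measure
  cons_measure0 cons_measure_ge0 cons_measure_sigma_additive.

Let cons_measure_sigma_finite : sigma_finite setT cons_measure.
Proof.
have /sigma_finiteP[F [TF ndF Foo]] := sigma_finiteT (@lebesgue_measure R).
have /sigma_finiteP[G [TG ndG Goo]] := sigma_finiteT m.
exists (fun k => @uncons_pt n @^-1` (F k `*` G k)).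
  apply/esym; rewrite -subTset => y _.
  have [i _ Fi] : (\bigcup_k F k) (uncons_pt y).1 by rewrite -TF.
  have [j _ Gj] : (\bigcup_k G k) (uncons_pt y).2 by rewrite -TG.
  exists (maxn i j) => //; split.
  - by move: Fi; exact/subsetPset/ndF/leq_maxl.
  - by move: Gj; exact/subsetPset/ndG/leq_maxr.
move=> k; have [? ?] := Foo k; have [? ?] := Goo k; split.
  rewrite -[X in measurable X]setTI; apply: measurable_uncons_pt => //.
  exact: measurableX.
rewrite /cons_measure /pushforward -comp_preimage.
rewrite (_ : _ \o _ = id); last by rewrite funeqE => z /=; rewrite cons_ptK.
by rewrite preimage_id product_measure1E// lte_mul_pinfty// ge0_fin_numE.
Qed.

HB.instance Definition _ := Measure_isSigmaFinite.Build _ _ _ cons_measure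
  cons_measure_sigma_finite.

End cons_measure.

(* n-dimensional Lebesgue measure on Borel sets, as an iterated product *)
Fixpoint volume n : {sigma_finite_measure set (Rn R n) -> \bar R} :=
  match n with
  | 0 => \d_([tuple] : Rn R 0)
  | n'.+1 => cons_measure (volume n')
  end.

End borel_lebesgue_measure.

Section spacetime.
Variables (R : realType) (n : nat).

Definition borel_volume :
    {measure set (Rn R n * measurableTypeR R) -> \bar R} :=
  (volume R n \x @lebesgue_measure R)%E.

(* Rn R n * R with the sigma-algebra of Lebesgue measurable sets, i.e. the
   completion of the Borel sigma-algebra *)
Definition spacetime : measurableType _ :=
  caratheodory_type (borel_volume^*)%mu.

Definition lebesgue : {measure set spacetime -> \bar R} :=
  @completed_measure_extension _ _ _ borel_volume.

(* tuples carry no topology in the library: compactness in R^{n+1} is that of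
   row vectors *)
Definition compact_pts (K : set spacetime) :=
  compact ((fun z : spacetime => (\row_i tnth z.1 i, z.2) : 'rV[R]_n * R) @` K).

Definition weight (w : spacetime -> R) : Prop :=
  [/\ measurable_fun setT w, forall z, 0 <= w z,
      forall K, compact_pts K -> lebesgue.-integrable K (EFin \o w)
    & {ae lebesgue, forall z, 0 < w z}].

Local Open Scope ereal_scope.

Definition avg (A : set spacetime) (f : spacetime -> \bar R) : \bar R :=
  (lebesgue A)^-1 * \int[lebesgue]_(z in A) f z.

Definition ess_inf_on (A : set spacetime) (f : spacetime -> \bar R) : \bar R :=
  ess_inf lebesgue (patch (cst +oo) A f).

Definition ess_sup_on (A : set spacetime) (f : spacetime -> \bar R) : \bar R :=
  ess_sup lebesgue (patch (cst -oo) A f).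

End spacetime.
Arguments lebesgue {R n}.

Section parabolic_classes.
Variables (R : realType) (n : nat) (p : R).
Local Notation X := (spacetime R n).

Definition cube (x : n.-tuple R) (L : R) : set (n.-tuple R) :=
  [set y | forall i, tnth x i - L / 2 <= tnth y i < tnth x i + L / 2].

(* R^-(gamma) and R^+(gamma) for the parabolic rectangle R(z.1, z.2, L) *)
Definition rect_minus (gamma : R) (z : X) (L : R) : set X :=
  cube z.1 L `*` `[z.2 - L `^ p, z.2 - gamma * L `^ p[.

Definition rect_plus (gamma : R) (z : X) (L : R) : set X :=
  cube z.1 L `*` `[z.2 + gamma * L `^ p, z.2 + L `^ p[.

Local Open Scope ereal_scope.

Definition sup_rect (F : X -> R -> \bar R) : \bar R :=
  ereal_sup [set F z L | z in setT & L in [set L | (0 < L)%R]].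

(* [w]_{A_r^+(gamma)}, meant for 1 <= r; powR sends 0 to 0 for the negative
   exponent 1/(1-r), which is harmless since a weight is positive a.e. *)
Definition A_const (gamma r : R) (w : X -> R) : \bar R :=
  sup_rect (fun z L =>
    avg (rect_minus gamma z L) (EFin \o w) *
    (if r == 1%R then (ess_inf_on (rect_plus gamma z L) (EFin \o w))^-1
     else avg (rect_plus gamma z L) (fun y => (w y `^ (1 - r)^-1)%:E) `^ (r - 1))).

(* [w]_{RH_q^+(gamma)}, meant for 1 < q <= +oo *)
Definition RH_const (gamma : R) (q : \bar R) (w : X -> R) : \bar R :=
  sup_rect (fun z L =>
    (match q with
     | s%:E => avg (rect_minus gamma z L) (fun y => (w y `^ s)%:E) `^ s^-1
     | _ => ess_sup_on (rect_minus gamma z L) (EFin \o w)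
     end) * (avg (rect_plus gamma z L) (EFin \o w))^-1).

Definition A_class (gamma r : R) : set (X -> R) :=
  [set w | weight w /\ A_const gamma r w < +oo].

Definition RH_class (gamma : R) (q : \bar R) : set (X -> R) :=
  [set w | weight w /\ RH_const gamma q w < +oo].

End parabolic_classes.

(* Main.v *)
Require Import Defs.
From HB Require Import structures.
From mathcomp Require Import all_boot all_order all_algebra.
From mathcomp Require Import all_classical all_reals all_analysis.
From mathcomp Require Import measurable_realfun ess_sup_inf.
From mathcomp Require Import ring lra.


(* Both classes control a weight at one time by its values at a later time; the difficulty is that
   no estimate is available on a box itself.

   From A to RH with lag g: by Chebyshev, the A condition bounds the mass of a past box by the mass
   of any large part of a future box. Fix a box D0 and let a(D) be the mass of a box D shifted by
   (1 + g) l^p, divided by |D|. Stop at the maximal grid cells with a(D) > 2^(k+1) a(D0). The box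
   shifted twice then meets the set {w > beta 2^(k+1) a(D0)} in at least half of its measure, and a
   covering argument bounds the total measure of the cells by that of this set in an enlargement of
   D0. Summing over k, for some k the cells carry at most half of a(D0)|D0|. Off the cells
   w <= C 2^k a(D0). Iterating inside the cells, the mass of {w > A^j a(D0)} in D0 is at most
   2^-j C a(D0)|D0|, hence a power q > 1 of w is integrable; small boxes in R^- are then moved up
   into R^+.

   From RH to A: the dual scheme, with averages over a box just before D, stopping when
   a(D) < 2^-(k+1) a(D0), and Lebesgue measure in place of w; it makes a negative power of w
   integrable. It needs that mass spreads to all boxes of comparable size at later times. RH gives
   this: a failure to move sideways means that the mass has grown by a large factor, and since p > 1
   such growth can be repeated at all dyadic scales within bounded time, which local finiteness
   forbids. *)

Set Implicit Arguments.
Unset Strict Implicit.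
Unset Printing Implicit Defensive.

Import Order.TTheory GRing.Theory Num.Theory.
Import numFieldNormedType.Exports.

Local Open Scope classical_set_scope.
Local Open Scope ring_scope.

(** * Boxes and their Lebesgue measure *)

(** Two features shape the argument. The average a(D) lives on a shifted box, and the shifted boxes
    of disjoint cells overlap, so stopping at one level bounds the stopped total only by a constant
    multiple of the quantity for D0. The halving needed for the iteration comes from choosing among
    many levels: the constants of the covering and of the enlargement of D0 do not depend on the
    number of levels, so enough levels beat them. Moreover, an exponent may depend on the constant
    of a weight but not on the weight. Both classes are therefore first turned into conditions on
    measures with explicit constants, [backward_A] and [forward_RH], and every exponent is chosen
    before the weight is introduced. The lag acts differently in the two directions. From A it is a
    jump proportional to l^p, negligible for small boxes, which is how lag 0 is reached. From RH the
    positive lag is the time in which mass can move sideways. *)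

Lemma lebesgue_itvco {R : realType} (a l : R) : 0 <= l ->
  lebesgue_measure `[a, a + l[%classic = l%:E.
Proof.
move=> l0; rewrite lebesgue_measure_itv/= lte_fin ltrDl.
case: ltP => [|l0']; first by rewrite -EFinD addrAC subrr add0r.
by apply/eqP; rewrite eqe; apply/eqP/le_anti; rewrite l0 l0'.
Qed.

Section boxes.
Context {R : realType} {n : nat}.
Local Notation X := (spacetime R n).
Local Notation leb := (@lebesgue R n).
Implicit Types (x y : n.-tuple R) (l t h : R).

Definition box x l t h : set X :=
  [set z | (forall i, tnth x i <= tnth z.1 i < tnth x i + l) /\
           t <= z.2 < t + h].

Definition scube x l : set (n.-tuple R) :=
  [set y | forall i, tnth x i <= tnth y i < tnth x i + l].

Lemma scubeE x l :
  scube x l = \bigcap_(i in [set: 'I_n])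
    ((fun y : Rn R n => tnth y i) @^-1` `[tnth x i, tnth x i + l[).
Proof.
apply/seteqP; split => y /=.
  by move=> H i _; rewrite /= in_itv/=; exact: H.
by move=> H i; have := H i I; rewrite /= in_itv.
Qed.

Lemma measurable_scube x l : measurable (scube x l : set (Rn R n)).
Proof.
rewrite scubeE; apply: fin_bigcap_measurable => // i _.
rewrite -[X in measurable X]setTI; apply: measurable_tnth => //.
Qed.

Lemma boxE x l t h : box x l t h = (scube x l : set (Rn R n)) `*` `[t, t + h[%classic.
Proof. by apply/seteqP; split => z /=; rewrite in_itv. Qed.

Lemma borel_box x l t h :
  measurable (box x l t h : set (Rn R n * measurableTypeR R)).
Proof. by rewrite boxE; apply: measurableX => //; exact: measurable_scube. Qed.

Lemma borel_lebesgue_measurable (A : set (Rn R n * measurableTypeR R)) :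
  measurable A -> measurable (A : set X).
Proof. by move=> mA; exact: caratheodory_measurable_mu_ext. Qed.

Lemma lebesgue_borelE (A : set (Rn R n * measurableTypeR R)) :
  measurable A -> leb A = borel_volume R n A.
Proof. by move=> mA; rewrite /lebesgue /= /completed_measure_extension measurable_mu_extE. Qed.

Lemma measurable_box x l t h : measurable (box x l t h).
Proof. by apply: borel_lebesgue_measurable; exact: borel_box. Qed.

End boxes.

Lemma volume_scube {R : realType} n (x : n.-tuple R) (l : R) : 0 <= l ->
  volume R n (scube x l) = (l ^+ n)%:E.
Proof.
move=> l0; elim: n x => [|n IH] x.
  rewrite /= expr0 diracE; case: (boolP (_ \in _)) => //.
  by rewrite notin_setE => -[]; case.
rewrite /= /cons_measure /pushforward.
rewrite (_ : _ @^-1` _ = `[thead x, thead x + l[%classic `*` scube [tuple of behead x] l); last first.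
  apply/seteqP; split => -[a y] /=.
    move=> H; split; first by have := H ord0; rewrite in_itv/= /thead (tnth_nth 0)/=.
    move=> i; have := H (lift ord0 i).
    by rewrite !tnthS /= !(tnth_nth 0)/= !nth_behead.
  move=> [+ H] i; rewrite in_itv/=; case: (unliftP ord0 i) => [j|] ->.
    move=> _; have := H j.
    by rewrite !(tnth_nth 0)/= !nth_behead.
  by rewrite /thead (tnth_nth 0)/=.
rewrite product_measure1E//; last exact: measurable_scube.
rewrite IH exprS EFinM; congr (_ * _)%E; exact: lebesgue_itvco.
Qed.

Section boxes_measure.
Context {R : realType} {n : nat}.
Local Notation X := (spacetime R n).
Local Notation leb := (@lebesgue R n).
Implicit Types (x y : n.-tuple R) (l t h : R).

Lemma lebesgue_box x l t h : 0 <= l -> 0 <= h ->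
  leb (box x l t h) = (l ^+ n * h)%:E.
Proof.
move=> l0 h0; rewrite lebesgue_borelE; last exact: borel_box.
rewrite boxE /borel_volume [LHS]product_measure1E//; last exact: measurable_scube.
rewrite EFinM; congr (_ * _)%E; [exact: volume_scube | exact: lebesgue_itvco].
Qed.

(** Local integrability of a weight is given on compact sets; half-open boxes reach it through their
    closures. *)
Definition cbox x l t h : set X :=
  [set z | (forall i, tnth x i <= tnth z.1 i <= tnth x i + l) /\
           t <= z.2 <= t + h].

Lemma compact_cbox x l t h : compact_pts (cbox x l t h).
Proof.
rewrite /compact_pts.
rewrite (_ : _ @` _ = [set v : 'rV[R]_n | forall i, `[tnth x i, tnth x i + l]%classic (v 0 i)]
   `*` `[t, t + h]%classic).
  apply: compact_setX; last exact: segment_compact.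
  apply: (@rV_compact R n (fun i => `[tnth x i, tnth x i + l]%classic)) => i.
  exact: segment_compact.
apply/seteqP; split => [_ [z [H1 H2] <-]|[v s] /= [H1 H2]].
  by split => [i|] /=; rewrite ?mxE in_itv/=.
exists ([tuple v 0 i | i < n], s).
  split => /= [i|]; last by move: H2; rewrite in_itv.
  by rewrite tnth_mktuple; have := H1 i; rewrite /= in_itv.
by congr (_, _); apply/rowP => i; rewrite !mxE /= tnth_mktuple.
Qed.

Lemma box_cbox x l t h : box x l t h `<=` cbox x l t h.
Proof.
move=> z [H1 /andP[? /ltW ?]]; split; last by apply/andP.
by move=> i; have /andP[-> /ltW ->] := H1 i.
Qed.

End boxes_measure.

Section density_measure.
Context d (T : measurableType d) (R : realType) (m : {measure set T -> \bar R}).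
Variable f : T -> R.
Hypotheses (mf : measurable_fun setT f) (f0 : forall z, 0 <= f z).
Local Open Scope ereal_scope.

(** The two proofs are arguments because the measure structure attached to this head symbol depends
    on them. *)
Definition mass_of (_ : measurable_fun setT f) (_ : forall z, (0 <= f z)%R)
    (E : set T) : \bar R := \int[m]_(z in E) (f z)%:E.

Local Notation ms := (mass_of mf f0).

Let mass0 : ms set0 = 0.
Proof. by rewrite /mass_of integral_set0. Qed.

Let mass_ge0 A : 0 <= ms A.
Proof. by apply: integral_ge0 => z _; rewrite lee_fin. Qed.

Let mass_sigma : semi_sigma_additive ms.
Proof.
move=> /= F mF tF mUF; rewrite /mass_of; apply: cvg_toP.
  apply: ereal_nondecreasing_is_cvgn => i j ij.
  apply: lee_sum_nneg_natr => // k _ _.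
  by apply: integral_ge0 => /= x Fkx; rewrite lee_fin.
rewrite ge0_integral_bigcup//=.
- by apply: measurable_funTS; exact/measurable_EFinP.
- by move=> x _; rewrite lee_fin.
Qed.

HB.instance Definition _ := isMeasure.Build _ _ _ ms mass0 mass_ge0 mass_sigma.

End density_measure.

(** * Bounded measurable sets and real-valued masses *)

Section bounded_sets.
Context {R : realType} {n : nat}.
Local Notation X := (spacetime R n).
Implicit Types (x y : n.-tuple R) (l t h : R) (A B : set X).

Definition bm A := measurable A /\
  exists r : R, forall z, A z -> (forall i, `|tnth z.1 i| <= r) /\ `|z.2| <= r.

Lemma bm_box x l t h : bm (box x l t h).
Proof.
split; first exact: measurable_box.
exists (\sum_(i < n) `|tnth x i| + `|l| + `|t| + `|h|) => z [H1 H2].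
have S : 0 <= \sum_(i < n) `|tnth x i| by apply: sumr_ge0.
have ? := ler_norm l; have ? := ler_norm h; have ? := ler_norm t.
have ? := normr_ge0 l; have ? := normr_ge0 h; have ? := normr_ge0 t.
have := ler_norm (- t); rewrite normrN => ?.
split => [i|]; rewrite ler_norml; last by move: H2; lra.
have Si : `|tnth x i| <= \sum_(i < n) `|tnth x i|.
  by rewrite [leRHS](bigD1 i)//= lerDl sumr_ge0.
have ? := ler_norm (tnth x i); have := ler_norm (- tnth x i); rewrite normrN => ?.
by have := H1 i; lra.
Qed.

Lemma bmS A B : measurable A -> bm B -> A `<=` B -> bm A.
Proof.
by move=> mA [_ [r H]] AB; split=> //; exists r => z /AB; exact: H.
Qed.

Lemma bmI A B : bm A -> measurable B -> bm (A `&` B).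
Proof.
move=> bA mB; apply: (@bmS _ A) => //; by apply: measurableI => //; case: bA.
Qed.

Lemma bmD A B : bm A -> measurable B -> bm (A `\` B).
Proof. by move=> bA mB; rewrite setDE; apply: bmI => //; exact: measurableC. Qed.

Lemma bm0 : bm set0.
Proof. by apply: (@bmS _ (box [tuple 0 | i < n] 0 0 0)) => //; exact: bm_box. Qed.

Lemma bmU A B : bm A -> bm B -> bm (A `|` B).
Proof.
move=> [mA [r Hr]] [mB [s Hs]]; split; first exact: measurableU.
exists (Num.max r s) => z [/Hr|/Hs] [H1 H2]; split => [i|].
- by rewrite le_max H1.
- by rewrite le_max H2.
- by rewrite le_max H1 orbT.
- by rewrite le_max H2 orbT.
Qed.

Lemma bm_bigU (I : Type) (s : seq I) (P : pred I) (F : I -> set X) :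
  (forall i, P i -> bm (F i)) -> bm (\big[setU/set0]_(i <- s | P i) F i).
Proof.
move=> bF; elim/big_ind: _ => //; [exact: bm0|exact: bmU].
Qed.

Definition locfin (m : {measure set X -> \bar R}) :=
  forall x l t h, (m (box x l t h) < +oo)%E.

(* The junk value is 0 when m A is infinite; this does not happen for [bm] sets and [locfin] measures. *)
Definition rm (m : {measure set X -> \bar R}) A : R := fine (m A).

Section rm.
Variables (m : {measure set X -> \bar R}) (lf : locfin m).

Lemma bm_fin A : bm A -> m A \is a fin_num.
Proof.
move=> [mA [r H]]; rewrite ge0_fin_numE//.
apply: le_lt_trans (lf [tuple - r | i < n] (2 * r + 1) (- r) (2 * r + 1)).
apply: le_measure; rewrite ?inE//; first exact: measurable_box.
move=> z /H[H1 H2]; split => [i|]; last by move: H2; rewrite ler_norml; lra.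
by rewrite tnth_mktuple; have := H1 i; rewrite ler_norml; lra.
Qed.

Lemma rmE A : bm A -> m A = (rm m A)%:E.
Proof. by move=> bA; rewrite fineK//; exact: bm_fin. Qed.

Lemma rm_ge0 A : 0 <= rm m A. Proof. exact: fine_ge0. Qed.

Lemma rm0 : rm m set0 = 0. Proof. by rewrite /rm measure0. Qed.

Lemma rm_le A B : measurable A -> bm B -> A `<=` B -> rm m A <= rm m B.
Proof.
move=> mA bB AB; have bA := bmS mA bB AB.
rewrite -lee_fin -!rmE//; apply: le_measure => //; rewrite ?inE//; by case: bB.
Qed.

Lemma rmU A B : bm A -> bm B -> A `&` B = set0 -> rm m (A `|` B) = rm m A + rm m B.
Proof.
move=> bA bB AB0; apply/EFin_inj; rewrite EFinD -!rmE//; last exact: bmU.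
by rewrite measureU//; [case: bA|case: bB].
Qed.

Lemma rmU_le A B : bm A -> bm B -> rm m (A `|` B) <= rm m A + rm m B.
Proof.
move=> bA bB; have [mA _] := bA; have [mB _] := bB.
have -> : A `|` B = A `|` (B `\` A) by rewrite setDE setUIr setUv setIT.
rewrite rmU//; last 2 first.
- exact: bmD.
- by rewrite setDE setICA setICr setI0.
by rewrite lerD2l; apply: rm_le => //; exact: measurableD.
Qed.

Lemma rmD A B : bm A -> measurable B -> rm m (A `\` B) = rm m A - rm m (A `&` B).
Proof.
move=> bA mB; rewrite -[in rm m A](setDUK (@subIsetl _ A B)) rmU//.
- by rewrite setDIr setDv set0U [X in X - _]addrC addrK.
- exact: bmI.
- by rewrite setDIr setDv set0U; exact: bmD.
- by rewrite setDIr setDv set0U setDE setIACA setICr setI0.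
Qed.

Lemma rm_bigU_le (I : Type) (s : seq I) (P : pred I) (F : I -> set X) :
  (forall i, P i -> bm (F i)) ->
  rm m (\big[setU/set0]_(i <- s | P i) F i) <= \sum_(i <- s | P i) rm m (F i).
Proof.
move=> bF; elim: s => [|i s IH]; first by rewrite !big_nil rm0.
rewrite !big_cons; case: ifPn => // Pi.
apply: le_trans (lerD (lexx _) IH); apply: rmU_le; [exact: bF|exact: bm_bigU].
Qed.

Lemma rm_bigU (I : choiceType) (s : seq I) (P : pred I) (F : I -> set X) :
  uniq s -> (forall i, P i -> bm (F i)) ->
  (forall i j z, P i -> P j -> F i z -> F j z -> i = j) ->
  rm m (\big[setU/set0]_(i <- s | P i) F i) = \sum_(i <- s | P i) rm m (F i).
Proof.
move=> + bF dF; elim: s => [|i s IH]; first by rewrite !big_nil rm0.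
rewrite cons_uniq => /andP[nis us]; rewrite !big_cons; case: ifPn => Pi; last exact: IH.
rewrite rmU ?IH//; [exact: bF|exact: bm_bigU|].
rewrite -bigcup_seq_cond -subset0 => z [Fi] [j /= /andP[js Pj] Fj].
by move: nis; rewrite (dF _ _ _ Pi Pj Fi Fj) js.
Qed.

Lemma rm_bigcup_le (F : nat -> set X) c : (forall i, measurable (F i)) ->
  bm (\bigcup_i F i) -> nondecreasing_seq F ->
  (forall i, rm m (F i) <= c) -> rm m (\bigcup_i F i) <= c.
Proof.
move=> mF bU ndF Fc.
have H := nondecreasing_cvg_mu (mu := m) mF (bigcup_measurable (fun k _ => mF k)) ndF.
rewrite -lee_fin -rmE// -(cvg_lim _ H)//; apply: lime_le; first exact: (cvgP _ H).
apply: nearW => i /=; rewrite rmE ?lee_fin//.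
by apply: (bmS (mF i) bU) => z Fz; exists i.
Qed.

Lemma rm_bigcap0 (F : nat -> set X) : (forall i, bm (F i)) -> nonincreasing_seq F ->
  \bigcap_i F i = set0 -> forall e, 0 < e -> exists i, rm m (F i) < e.
Proof.
move=> bF niF F0 e e0.
have H : m (F i) @[i --> \oo] --> m (\bigcap_i F i).
  apply: nonincreasing_cvg_mu => //.
  - by rewrite -ge0_fin_numE// bm_fin.
  - by move=> i; case: (bF i).
  - by rewrite F0.
rewrite F0 measure0 in H.
have [i _ /(_ i)] : \forall i \near \oo, (m (F i) < e%:E)%E.
  by apply: (H [set y | (y < e%:E)%E]); exact: lt_nbhsl.
move=> /(_ (leqnn i)) He; exists i.
by rewrite -lte_fin -rmE.
Qed.

End rm.

End bounded_sets.

(** * Subdivision of intervals and boxes *)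

Section subdivision.
Context {R : realType}.

Lemma itv1_cover (x l y : R) (N : nat) : 0 < l -> (0 < N)%N -> x <= y < x + l ->
  exists i : 'I_N, x + l / N%:R * i%:R <= y < x + l / N%:R * i%:R + l / N%:R.
Proof.
move=> l0 N0 /andP[xy yl]; have NR : 0 < N%:R :> R by rewrite ltr0n.
have d0 : 0 < l / N%:R by rewrite divr_gt0.
pose k := Num.truncn ((y - x) / (l / N%:R)).
have /andP[k1 k2] : k%:R <= (y - x) / (l / N%:R) < k.+1%:R.
  by apply: Num.Theory.truncn_itv; rewrite divr_ge0 ?subr_ge0// ltW.
have kN : (k < N)%N.
  rewrite -(ltr_nat R); apply: le_lt_trans k1 _.
  by rewrite ltr_pdivrMr// mulrC divfK ?gt_eqF// ltrBlDl.
exists (Ordinal kN) => /=; rewrite ler_pdivlMr// in k1; rewrite ltr_pdivrMr// -natr1 in k2.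
by rewrite mulrDl mul1r in k2; rewrite [l / _ * _]mulrC; apply/andP; split; lra.
Qed.

(** In units of the fine mesh, the common point [y] forces [i * c <= j < i.+1 * c] between integers,
    and this is the containment. *)
Lemma itv1_nest (x l y : R) (N c i j : nat) : 0 < l -> (0 < N)%N -> (0 < c)%N ->
  x + l / N%:R * i%:R <= y < x + l / N%:R * i%:R + l / N%:R ->
  x + l / (N * c)%:R * j%:R <= y < x + l / (N * c)%:R * j%:R + l / (N * c)%:R ->
  x + l / N%:R * i%:R <= x + l / (N * c)%:R * j%:R /\
  x + l / (N * c)%:R * j%:R + l / (N * c)%:R <= x + l / N%:R * i%:R + l / N%:R.
Proof.
move=> l0 N0 c0.
have NR : 0 < N%:R :> R by rewrite ltr0n.
have cR : 0 < c%:R :> R by rewrite ltr0n.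
have d0 : 0 < l / (N * c)%:R by rewrite divr_gt0// natrM mulr_gt0.
have -> : l / N%:R = l / (N * c)%:R * c%:R.
  by rewrite natrM; field; rewrite !gt_eqF.
set d := l / _ in d0 *.
move=> /andP[a1 a2] /andP[b1 b2].
have A : (i * c < j.+1)%N.
  rewrite -(ltr_nat R) -(ltr_pM2l d0) -natr1 natrM.
  have -> : d * (i%:R * c%:R) = d * c%:R * i%:R by ring.
  lra.
have B : (j < (i.+1) * c)%N.
  rewrite -(ltr_nat R) -(ltr_pM2l d0) natrM -natr1.
  have -> : d * ((i%:R + 1) * c%:R) = d * c%:R * i%:R + d * c%:R by ring.
  lra.
split.
  by rewrite lerD2l -mulrA ler_pM2l// mulrC -natrM ler_nat.
rewrite -[leLHS]addrA -[leRHS]addrA lerD2l.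
have -> : d * j%:R + d = d * j.+1%:R by rewrite -natr1; ring.
have -> : d * c%:R * i%:R + d * c%:R = d * (i.+1 * c)%:R by rewrite natrM -natr1; ring.
by rewrite ler_pM2l// ler_nat.
Qed.

Lemma itv1_uniq (x d y : R) (i j : nat) : 0 < d ->
  x + d * i%:R <= y < x + d * i%:R + d -> x + d * j%:R <= y < x + d * j%:R + d -> i = j.
Proof.
move=> d0 /andP[a1 a2] /andP[b1 b2].
have A : (i < j.+1)%N.
  by rewrite -(ltr_nat R) -(ltr_pM2l d0) -natr1 mulrDr mulr1; lra.
have B : (j < i.+1)%N.
  by rewrite -(ltr_nat R) -(ltr_pM2l d0) -natr1 mulrDr mulr1; lra.
by apply/eqP; rewrite eqn_leq -ltnS A -ltnS B.
Qed.

End subdivision.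

Section subboxes.
Context {R : realType} {n : nat}.
Local Notation X := (spacetime R n).
Implicit Types (x y : n.-tuple R) (l t h : R).

Definition subx x l (N : nat) (i : {ffun 'I_n -> 'I_N}) : n.-tuple R :=
  [tuple tnth x k + l / N%:R * (i k)%:R | k < n].

Definition subt t h (K : nat) (k : 'I_K) : R := t + h / K%:R * k%:R.

Definition idx (N K : nat) := ({ffun 'I_n -> 'I_N} * 'I_K)%type.

Definition sub x l t h N K (i : idx N K) : set X :=
  box (subx x l i.1) (l / N%:R) (subt t h i.2) (h / K%:R).
Arguments sub : clear implicits.

Lemma scube_cover x l N y : 0 < l -> (0 < N)%N -> scube x l y ->
  exists i : {ffun 'I_n -> 'I_N}, scube (subx x l i) (l / N%:R) y.
Proof.
move=> l0 N0 H.
have /choice[f Hf] : forall k, exists i : 'I_N,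
  tnth x k + l / N%:R * i%:R <= tnth y k < tnth x k + l / N%:R * i%:R + l / N%:R.
  by move=> k; apply: itv1_cover => //; exact: H.
by exists (finfun f) => k; rewrite tnth_mktuple ffunE; exact: Hf.
Qed.

Lemma scube_nest x l (N c : nat) (i : {ffun 'I_n -> 'I_N}) (j : {ffun 'I_n -> 'I_(N * c)}) y :
  0 < l -> (0 < N)%N -> (0 < c)%N ->
  scube (subx x l i) (l / N%:R) y -> scube (subx x l j) (l / (N * c)%:R) y ->
  scube (subx x l j) (l / (N * c)%:R) `<=` scube (subx x l i) (l / N%:R).
Proof.
move=> l0 N0 c0 H1 H2 y' H3 k.
have := H1 k; have := H2 k; have := H3 k; rewrite !tnth_mktuple => h3 h2 h1.
by have [] := itv1_nest l0 N0 c0 h1 h2; lra.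
Qed.

Lemma scube_uniq x l (N : nat) (i j : {ffun 'I_n -> 'I_N}) y : 0 < l -> (0 < N)%N ->
  scube (subx x l i) (l / N%:R) y -> scube (subx x l j) (l / N%:R) y -> i = j.
Proof.
move=> l0 N0 H1 H2; apply/ffunP => k; apply/val_inj.
have := H1 k; have := H2 k; rewrite !tnth_mktuple => h2 h1.
by apply: itv1_uniq h1 h2; rewrite divr_gt0// ltr0n.
Qed.

Lemma sub_cover x l t h N K z : 0 < l -> 0 < h -> (0 < N)%N -> (0 < K)%N ->
  box x l t h z -> exists i, sub x l t h N K i z.
Proof.
move=> l0 h0 N0 K0 [H1 H2].
have [i Hi] := scube_cover l0 N0 H1.
have [k Hk] := itv1_cover h0 K0 H2.
by exists (i, k); split.
Qed.

Lemma sub_uniq x l t h N K (i j : idx N K) z : 0 < l -> 0 < h -> (0 < N)%N -> (0 < K)%N ->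
  sub x l t h N K i z -> sub x l t h N K j z -> i = j.
Proof.
move: i j => [i k] [i' k'] l0 h0 N0 K0 [H1 H2] [H1' H2'].
congr (_, _); first exact: scube_uniq H1 H1'.
by apply/val_inj; apply: itv1_uniq H2 H2'; rewrite divr_gt0// ltr0n.
Qed.

Lemma subx_scube x l N (i : {ffun 'I_n -> 'I_N}) : 0 < l ->
  scube (subx x l i) (l / N%:R) `<=` scube x l.
Proof.
move=> l0 y H k; have := H k; rewrite tnth_mktuple.
have N0 : (0 < N)%N by rewrite (leq_ltn_trans _ (ltn_ord (i k))).
have NR : 0 < N%:R :> R by rewrite ltr0n.
have : l / N%:R * (i k)%:R + l / N%:R <= l.
  rewrite -{2}[l / N%:R]mulr1 -mulrDr natr1 mulrAC -mulrA ler_piMr ?(ltW l0)//.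
  by rewrite ler_pdivrMr// mul1r ler_nat.
have : 0 <= l / N%:R * (i k)%:R by rewrite mulr_ge0// divr_ge0// ltW.
lra.
Qed.

Lemma subt_bounds t h K (k : 'I_K) : 0 < h ->
  t <= subt t h k /\ subt t h k + h / K%:R <= t + h.
Proof.
move=> l0.
have N0 : (0 < K)%N by rewrite (leq_ltn_trans _ (ltn_ord k)).
have NR : 0 < K%:R :> R by rewrite ltr0n.
have : h / K%:R * k%:R + h / K%:R <= h.
  rewrite -{2}[h / K%:R]mulr1 -mulrDr natr1 mulrAC -mulrA ler_piMr ?(ltW l0)//.
  by rewrite ler_pdivrMr// mul1r ler_nat.
have : 0 <= h / K%:R * k%:R by rewrite mulr_ge0// divr_ge0// ltW.
rewrite /subt; lra.
Qed.

Lemma sub_box x l t h N K (i : idx N K) : 0 < l -> 0 < h ->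
  sub x l t h N K i `<=` box x l t h.
Proof.
move=> l0 h0 z [H1 H2]; split; first exact: subx_scube H1.
by have := subt_bounds t i.2 h0; move: H2; lra.
Qed.

Lemma box_bigU x l t h N K : 0 < l -> 0 < h -> (0 < N)%N -> (0 < K)%N ->
  box x l t h = \big[setU/set0]_(i : idx N K) sub x l t h N K i.
Proof.
move=> l0 h0 N0 K0; rewrite -bigcup_seq; apply/seteqP; split => [z|z [i _]].
  by move=> /(sub_cover l0 h0 N0 K0)[i Hi]; exists i => //=; rewrite mem_index_enum.
exact: sub_box.
Qed.

Lemma rm_sub (m : {measure set X -> \bar R}) x l t h N K : locfin m -> 0 < l -> 0 < h ->
  (0 < N)%N -> (0 < K)%N ->
  rm m (box x l t h) = \sum_(i : idx N K) rm m (sub x l t h N K i).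
Proof.
move=> lf l0 h0 N0 K0; rewrite (box_bigU x t l0 h0 N0 K0) rm_bigU//.
- exact: index_enum_uniq.
- by move=> i _; exact: bm_box.
- by move=> i j z _ _; exact: sub_uniq.
Qed.

End subboxes.
Arguments sub {R n} x l t h N K i.

(** * Stopping boxes in a parabolic grid *)

(** The identity from the space carrying [C] to the product is measurable, because each of its
    coordinates is; hence [C] contains every Borel set. *)
Lemma borel_induction {R : realType} n (C : set (set (Rn R n * measurableTypeR R))) :
  sigma_algebra setT C ->
  (forall k b, C [set z | tnth z.1 k < b]) -> (forall b, C [set z | z.2 < b]) ->
  forall A, measurable A -> C A.
Proof.
move=> sC C1 C2.
have coord (f : Rn R n * measurableTypeR R -> measurableTypeR R) :
    (forall b, C [set z | f z < b]) ->
    measurable_fun [set: g_sigma_algebraType C] (f : g_sigma_algebraType C -> measurableTypeR R).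
  move=> Cf; apply: (measurability _ (RGenInftyO.measurableE R)) => _ [_ [b ->] <-].
  rewrite setTI; apply: sub_sigma_algebra.
  by rewrite (_ : f @^-1` _ = [set z | f z < b])//; apply/seteqP; split => z /=; rewrite in_itv.
have mid : measurable_fun [set: g_sigma_algebraType C]
    (fun z : g_sigma_algebraType C => (z : Rn R n * measurableTypeR R)).
  apply/measurable_fun_pairP; split; last exact: (coord snd).
  by apply/measurable_fun_tnthP => k; apply: (coord (fun z => tnth z.1 k)).
move=> A mA; have := mid measurableT _ mA; rewrite setTI preimage_id => H.
by rewrite -(sigma_algebra_id sC).
Qed.

Section heights.
Context {R : realType}.
Implicit Types (sg p l h : R).

(* Subdividing a box cannot keep h = sg * l^p exactly (N^p need not be an integer), hence the
   factor 2. *)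
Definition adm sg p l h := [/\ 0 < l, 0 < h, h <= sg * l `^ p & sg * l `^ p <= 2 * h].

(** With u = sg (l/N)^p, the bounds N >= 2 and p >= 1 give x = h / u >= 1, so the first integer k
    above x satisfies k <= 2x. The factor 2 of [adm] is thus reproduced, and not squared, at each
    generation. *)
Lemma adm_split sg p l h (N : nat) : 0 < sg -> 1 <= p -> (1 < N)%N -> adm sg p l h ->
  exists k, (1 < k)%N /\ adm sg p (l / N%:R) (h / k%:R).
Proof.
move=> s0 p1 N1 [l0 h0 hl lh].
have NR : 0 < N%:R :> R by rewrite ltr0n; case: N N1.
have N2 : 2 <= N%:R :> R by rewrite ler_nat.
have Np : 2 <= N%:R `^ p by apply: (le_trans N2); apply: le1r_powR => //; lra.
set u := sg * (l / N%:R) `^ p.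
have lN0 : 0 < l / N%:R by rewrite divr_gt0.
have u0 : 0 < u by rewrite mulr_gt0// powR_gt0.
have uE : u * N%:R `^ p = sg * l `^ p.
  by rewrite /u -mulrA -powRM ?ltW// divfK// gt_eqF.
have x1 : 1 <= h / u.
  by rewrite ler_pdivlMr// mul1r; nra.
have /andP[k1 k2] : (Num.truncn (h / u))%:R <= h / u < (Num.truncn (h / u)).+1%:R.
  by apply: Num.Theory.truncn_itv; lra.
exists (Num.truncn (h / u)).+1; split; first by rewrite ltnS Num.Theory.truncn_gt0.
have kR : 0 < (Num.truncn (h / u)).+1%:R :> R by rewrite ltr0n.
rewrite -/u; split => //; first by rewrite divr_gt0.
  by rewrite -/u ler_pdivrMr// -ler_pdivrMl// mulrC ltW.
rewrite -/u mulrA ler_pdivlMr// -natr1.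
have : u * (h / u) = h by rewrite mulrC divfK// gt_eqF.
nra.
Qed.

(** The number [M j] of time slices depends on the generation alone, so all cells of one generation
    are translates of each other. *)
Lemma grid_heights sg p l h (N : nat) : 0 < sg -> 1 <= p -> (1 < N)%N -> adm sg p l h ->
  exists M : nat -> nat, [/\ M 0 = 1,
    forall j, exists2 c, (1 < c)%N & M j.+1 = (M j * c)%N
    & forall j, adm sg p (l / (N ^ j)%:R) (h / (M j)%:R)].
Proof.
move=> s0 p1 N1 a0.
have /choice[k Hk] : forall lh : R * R, exists k, adm sg p lh.1 lh.2 ->
    (1 < k)%N /\ adm sg p (lh.1 / N%:R) (lh.2 / k%:R).
  move=> lh; have [a|na] := pselect (adm sg p lh.1 lh.2).
    by have [k Hk] := adm_split s0 p1 N1 a; exists k.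
  by exists 0%N.
pose M := fix M (j : nat) : nat := if j is j'.+1 then
   (M j' * k (l / (N ^ j')%:R, h / (M j')%:R))%N else 1.
have aM j : adm sg p (l / (N ^ j)%:R) (h / (M j)%:R).
  elim: j => [|j IH]; first by rewrite /= !divr1.
  have [_] := Hk (l / (N ^ j)%:R, h / (M j)%:R) IH.
  by rewrite /= expnSr !natrM !invfM !mulrA.
exists M; split => // j; exists (k (l / (N ^ j)%:R, h / (M j)%:R)) => //.
by have [] := Hk (l / (N ^ j)%:R, h / (M j)%:R) (aM j).
Qed.

End heights.

Section pboxes.
Context {R : realType} {n : nat}.
Local Notation X := (spacetime R n).

Definition pbox := (n.-tuple R * R * R * R)%type.
Definition bx (D : pbox) := D.1.1.1.
Definition bl (D : pbox) := D.1.1.2.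
Definition bt (D : pbox) := D.1.2.
Definition bh (D : pbox) := D.2.
Definition bset (D : pbox) : set X := box (bx D) (bl D) (bt D) (bh D).

(** Space and time are kept apart because a time shift preserves the first inclusion and changes
    only the other two bounds. *)
Definition inbox (D D' : pbox) :=
  [/\ scube (bx D) (bl D) `<=` scube (bx D') (bl D'), bt D' <= bt D
    & bt D + bh D <= bt D' + bh D'].

Lemma bm_bset D : bm (bset D). Proof. exact: bm_box. Qed.

Definition padm (sg p : R) D := adm sg p (bl D) (bh D).

Definition tshift (p c : R) (D : pbox) : pbox :=
  (bx D, bl D, bt D + c * bl D `^ p, bh D).

(** Room for every finer cell whose shifted box meets that of D. Nested grids need no enlargement in
    space. In time, with r = l^p, the two shifts by at most 4 radii differ by at most 4r and each
    height is at most r, well within 10r on either side. *)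
Definition star (p : R) (D : pbox) : pbox :=
  (bx D, bl D, bt D - 10 * bl D `^ p, 20 * bl D `^ p).

Definition ac (m : {measure set X -> \bar R}) :=
  forall A, measurable A -> lebesgue A = 0 -> m A = 0.

End pboxes.
Arguments pbox : clear implicits.

Section completion.
Context {R : realType} {n : nat}.
Local Notation X := (spacetime R n).
Local Notation leb := (@lebesgue R n).

Lemma locfin_lebesgue : locfin leb.
Proof.
move=> x l t h; have : box x l t h `<=` box x (Num.max l 0) t (Num.max h 0).
  have ll : l <= Num.max l 0 by rewrite le_max lexx.
  have hh : h <= Num.max h 0 by rewrite le_max lexx.
  by move=> z [H1 H2]; split => [i|]; [have := H1 i|move: H2]; lra.
move=> H; apply: (@le_lt_trans _ _ (leb (box x (Num.max l 0) t (Num.max h 0)))).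
  by apply: le_measure => //; rewrite inE; exact: measurable_box.
by rewrite lebesgue_box ?ltry// le_max lexx orbT.
Qed.

(** Grid cells approximate Borel sets, whereas the measurable sets here are those of the completion.
    Countable Borel covers with excess 1/(k+1), as provided by the outer measure, are
    intersected. *)
Lemma borel_hull (A : set X) : bm A -> exists B : set X,
  [/\ @measurable _ (Rn R n * measurableTypeR R)%type B, A `<=` B & leb (B `\` A) = 0].
Proof.
move=> bA; have fA := bm_fin locfin_lebesgue bA; have [mA _] := bA.
have /choice[F HF] : forall k : nat, exists F : nat -> set (Rn R n * measurableTypeR R),
    [/\ forall i, measurable (F i), A `<=` \bigcup_i F i &
      (leb (\bigcup_i F i) <= leb A + (k.+1%:R^-1)%:E)%E].
  move=> k; have k0 : 0 < k.+1%:R^-1 :> R by rewrite invr_gt0.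
  have [_ [F [mF AF] <-] H] := lb_ereal_inf_adherent k0 fA.
  exists F; split => //; apply: le_trans (ltW H).
  apply: (@le_trans _ _ (\sum_(i <oo) leb (F i))%E).
    apply: measure_sigma_subadditive => //.
      by move=> i; exact: borel_lebesgue_measurable.
    by apply: bigcup_measurable => i _; exact: borel_lebesgue_measurable.
  by rewrite (eq_eseriesr (fun i _ => lebesgue_borelE (mF i))).
pose B := \bigcap_k \bigcup_i F k i.
have mB : @measurable _ (Rn R n * measurableTypeR R)%type B.
  apply: bigcapT_measurable => k; apply: bigcup_measurable => i _.
  by have [H _ _] := HF k; exact: H.
have AB : A `<=` B by move=> z Az k _; have [_ H _] := HF k; exact: H.
have mB' : measurable (B : set X) by exact: borel_lebesgue_measurable.
have lB : (leb B <= leb A)%E.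
  apply/lee_addgt0Pr => e e0.
  have [k Hk] : exists k : nat, k.+1%:R^-1 <= e.
    exists (Num.truncn e^-1); rewrite invf_ple ?posrE// ltW//; exact: truncnS_gt.
  apply: (@le_trans _ _ (leb (\bigcup_i F k i))).
    apply: le_measure; rewrite ?inE//.
      apply: bigcup_measurable => i _; have [H _ _] := HF k.
      by apply: borel_lebesgue_measurable; exact: H.
    by move=> z /(_ k I).
  by have [_ _ /le_trans] := HF k; apply; rewrite leeD2l// lee_fin.
exists B; split => //.
rewrite measureD//; last by rewrite (le_lt_trans lB)// ltey_eq fA.
have -> : B `&` A = A by apply/seteqP; split => [z []//|z Az]; split => //; exact: AB.
have E : leb B = leb A by apply/le_anti; rewrite lB le_measure ?inE.
transitivity (leb A - leb A)%E; last exact: subee.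
by congr (_ - _)%E.
Qed.

End completion.

Section grid.
Context {R : realType} {n : nat}.
Local Notation X := (spacetime R n).
Local Notation leb := (@lebesgue R n).
Variables (sg p : R) (N : nat) (M : nat -> nat).
Variables (x0 : n.-tuple R) (l0 t0 h0 : R).
Hypotheses (N1 : (1 < N)%N) (M0 : M 0 = 1).
Hypothesis (MS : forall j, exists2 c, (1 < c)%N & M j.+1 = (M j * c)%N).
Hypothesis (sg0 : 0 < sg) (sg1 : sg <= 1) (p1 : 1 <= p).
Hypothesis (aM : forall j, adm sg p (l0 / (N ^ j)%:R) (h0 / (M j)%:R)).

Let l0_gt0 : 0 < l0. Proof. by have [] := aM 0; rewrite M0 !divr1. Qed.
Let h0_gt0 : 0 < h0. Proof. by have [] := aM 0; rewrite M0 !divr1. Qed.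
Let M_gt0 j : (0 < M j)%N.
Proof. by elim: j => [|j IH]; [rewrite M0|have [c c1 ->] := MS j; rewrite muln_gt0 IH ltnW]. Qed.
Let N_gt0 j : (0 < N ^ j)%N.
Proof. by rewrite expn_gt0 ltnW. Qed.

Definition cl j : R := l0 / (N ^ j)%:R.
Definition ch j : R := h0 / (M j)%:R.
Definition cidx j := @idx n (N ^ j) (M j).
Definition cx j (i : cidx j) := subx x0 l0 i.1.
Definition ct j (i : cidx j) := subt t0 h0 i.2.
Definition cell j (i : cidx j) : set X := box (cx i) (cl j) (ct i) (ch j).

Lemma cl_gt0 j : 0 < cl j. Proof. by have [] := aM j. Qed.
Lemma ch_gt0 j : 0 < ch j. Proof. by have [] := aM j. Qed.

Lemma cell_box j (i : cidx j) : cell i `<=` box x0 l0 t0 h0.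
Proof. exact: sub_box. Qed.

Lemma cell_ct j (i : cidx j) : t0 <= ct i /\ ct i + ch j <= t0 + h0.
Proof. exact: subt_bounds. Qed.

Lemma cell_cx j (i : cidx j) : scube (cx i) (cl j) `<=` scube x0 l0.
Proof. exact: subx_scube. Qed.

Lemma cell_cover j z : box x0 l0 t0 h0 z -> exists i : cidx j, cell i z.
Proof. exact: sub_cover. Qed.

Lemma cell_uniq j (i i' : cidx j) z : cell i z -> cell i' z -> i = i'.
Proof. exact: sub_uniq. Qed.

Lemma M_dvd j j' : (j <= j')%N -> exists2 c, (0 < c)%N & M j' = (M j * c)%N.
Proof.
move=> /subnKC <-; elim: (j' - j)%N => [|k [c c0 IH]].
  by exists 1 => //; rewrite addn0 muln1.
rewrite addnS; have [d d1 ->] := MS (j + k); exists (c * d)%N.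
  by rewrite muln_gt0 c0 ltnW.
by rewrite IH mulnA.
Qed.

Lemma N_dvd j j' : (j <= j')%N -> exists2 c, (0 < c)%N & (N ^ j' = N ^ j * c)%N.
Proof. by move=> jj'; exists (N ^ (j' - j))%N => //; rewrite -expnD subnKC. Qed.

Lemma cx_nest j j' (i : cidx j) (i' : cidx j') y : (j <= j')%N ->
  scube (cx i) (cl j) y -> scube (cx i') (cl j') y ->
  scube (cx i') (cl j') `<=` scube (cx i) (cl j).
Proof.
move=> /N_dvd[c c0 E]; move: i' => [i' k']; rewrite /cx/= /cl.
move: i'; rewrite E => i'; exact: scube_nest.
Qed.

Lemma ct_nest j j' (i : cidx j) (i' : cidx j') s : (j <= j')%N ->
  ct i <= s < ct i + ch j -> ct i' <= s < ct i' + ch j' ->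
  ct i <= ct i' /\ ct i' + ch j' <= ct i + ch j.
Proof.
move=> /M_dvd[c c0 E]; move: i' => [i' k']; rewrite /ct/= /ch /subt.
move: k'; rewrite E => k'; exact: itv1_nest.
Qed.

Definition below j j' (i : cidx j) (i' : cidx j') :=
  [/\ scube (cx i') (cl j') `<=` scube (cx i) (cl j), ct i <= ct i'
    & ct i' + ch j' <= ct i + ch j].

Lemma below_sub j j' (i : cidx j) (i' : cidx j') : below i i' -> cell i' `<=` cell i.
Proof. by move=> [H1 H2 H3] z [/H1 ? ?]; split => //; lra. Qed.

Lemma below_trans j j' j'' (i : cidx j) (i' : cidx j') (i'' : cidx j'') :
  below i i' -> below i' i'' -> below i i''.
Proof.
move=> [a1 a2 a3] [b1 b2 b3]; split; [exact: subset_trans a1|lra|lra].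
Qed.

Lemma cell_nest j j' (i : cidx j) (i' : cidx j') z : (j <= j')%N ->
  cell i z -> cell i' z -> below i i'.
Proof.
move=> jj' [a1 a2] [b1 b2]; split; first exact: cx_nest jj' a1 b1.
  by have [] := ct_nest jj' a2 b2.
by have [] := ct_nest jj' a2 b2.
Qed.

Lemma cl_le j j' : (j <= j')%N -> cl j' <= cl j.
Proof.
move=> jj'; rewrite /cl ler_pM2l// lef_pV2 ?posrE ?ltr0n// ler_nat leq_exp2l//.
Qed.

Lemma bm_cell j (i : cidx j) : bm (cell i).
Proof. exact: bm_box. Qed.

(** * Approximation of Borel sets by unions of grid cells *)

Section saturated.

(** Unions of cells of generation [j], described by saturation so that Boolean operations and
    refinement need no reindexing. *)
Definition sat j (S : set X) := S `<=` box x0 l0 t0 h0 /\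
  forall (i : cidx j) z z', cell i z -> cell i z' -> S z -> S z'.

Lemma sat_le j j' S : (j <= j')%N -> sat j S -> sat j' S.
Proof.
move=> jj' [S0 H]; split=> // i' z z' cz cz' Sz.
have [i ciz] := cell_cover j (S0 _ Sz).
apply: (H i z z') => //; exact: (below_sub (cell_nest jj' ciz cz)).
Qed.

Lemma sat_bigU j S : sat j S ->
  S = \big[setU/set0]_(i : cidx j | `[< cell i `<=` S >]) cell i.
Proof.
move=> [S0 H]; rewrite -bigcup_seq_cond; apply/seteqP; split => [z Sz|z [i /= /andP[_ /asboolP]]].
  have [i ciz] := cell_cover j (S0 _ Sz); exists i => //=.
  by rewrite mem_index_enum; apply/asboolP => z' ciz'; exact: (H i z z').
exact.
Qed.

Lemma sat_bm j S : sat j S -> bm S.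
Proof. by move=> /sat_bigU ->; apply: bm_bigU => i _; exact: bm_cell. Qed.

Variable rho : {measure set X -> \bar R}.
Hypothesis lfr : locfin rho.
Let D0 : set X := box x0 l0 t0 h0.

(** The symmetric difference of [A] within the box and [S], for [S] inside the box. *)
Definition err (A S : set X) := ((A `&` D0) `\` S) `|` (S `\` A).

(** The sets with this property form a sigma-algebra containing the coordinate half-spaces, hence
    all Borel sets. This lets a comparison of measures on cells pass to arbitrary measurable
    sets. *)
Definition cell_approx (A : set X) := measurable A /\ forall e, 0 < e ->
  exists j S, sat j S /\ rm rho (err A S) < e.

Lemma bm_err A j S : measurable A -> sat j S -> bm (err A S).
Proof.
move=> mA sS; have bS := sat_bm sS; apply: bmU; last exact: bmD.
apply: bmD; last by case: bS.
by rewrite setIC; apply: bmI => //; exact: bm_box.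
Qed.

Lemma approxC A : cell_approx A -> cell_approx (~` A).
Proof.
move=> [mA H]; split; first exact: measurableC.
move=> e /H[j [S [[S0 sS] Se]]]; exists j, (D0 `\` S); split.
  split; first by move=> z [].
  move=> i z z' cz cz' [Dz nSz]; split; first exact: cell_box cz'.
  by move=> Sz'; apply: nSz; exact: (sS i z' z).
suff -> : err (~` A) (D0 `\` S) = err A S by [].
apply/seteqP; split => z; rewrite /err /=.
  move=> [[[nA Dz] nDS]|[[Dz nSz] nnA]].
    by right; split => //; apply: contrapT => nS; apply: nDS.
  by left; split => //; split => //; apply: contrapT.
move=> [[[Az Dz] nSz]|[Sz nAz]].
  by right; split => // nA; exact: nA.
by left; split; [split => //; exact: S0|move=> []].
Qed.

Lemma approx0 : cell_approx set0.
Proof.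
split => // e e0; exists 0, set0; split; first by split => // z.
by rewrite /err set0I !set0D setU0 rm0.
Qed.

Lemma approxU A B : cell_approx A -> cell_approx B -> cell_approx (A `|` B).
Proof.
move=> [mA HA] [mB HB]; split; first exact: measurableU.
move=> e e0; have e2 : 0 < e / 2 by rewrite divr_gt0.
have [j [S [sS Se]]] := HA _ e2; have [j' [S' [sS' Se']]] := HB _ e2.
have s1 := sat_le (leq_maxl j j') sS; have s2 := sat_le (leq_maxr j j') sS'.
exists (maxn j j'), (S `|` S').
have s3 : sat (maxn j j') (S `|` S').
  split; first by move=> z []; [have [H _] := s1|have [H _] := s2]; exact: H.
  by move=> i z z' cz cz' [Sz|Sz]; [left; have [_ H] := s1|right; have [_ H] := s2];
    exact: (H i z z').
split => //.
have b1 := bm_err mA s1; have b2 := bm_err mB s2.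
have b3 := bm_err (measurableU _ _ mA mB) s3.
apply: (@le_lt_trans _ _ (rm rho (err A S `|` err B S'))).
  apply: rm_le => //; [by case: b3|exact: bmU|].
  rewrite /err /= => z [[[[Az|Bz] Dz] nS]|[[Sz|Sz] nA]].
  - by left; left; split => // Sz; apply: nS; left.
  - by right; left; split => // Sz; apply: nS; right.
  - by left; right; split => // Az; apply: nA; left.
  - by right; right; split => // Az; apply: nA; right.
by apply: le_lt_trans (rmU_le lfr b1 b2) _; lra.
Qed.

Lemma approx_bigcup (F : nat -> set X) : (forall k, cell_approx (F k)) -> cell_approx (\bigcup_k F k).
Proof.
move=> aF; have mF k : measurable (F k) by case: (aF k).
have mU : measurable (\bigcup_k F k) by apply: bigcup_measurable.
split => // e e0; have e2 : 0 < e / 2 by rewrite divr_gt0.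
pose B K := \big[setU/set0]_(k < K) F k.
have aB K : cell_approx (B K) by rewrite /B; elim/big_ind: _ => //; [exact: approx0|exact: approxU].
have [K HK] : exists K, rm rho (D0 `&` (\bigcup_k F k `\` B K)) < e / 2.
  apply: rm_bigcap0 => //.
  - by move=> K; apply: bmI; [exact: bm_box|apply: measurableD => //; case: (aB K)].
  - move=> K K' KK'; apply/subsetPset => z [Dz [Fz nB]]; split => //; split => // BK; apply: nB.
    exact: (subset_bigsetU KK').
  - rewrite -subset0 => z H; have [_ [[k _ Fz] _]] := H 0 I.
    have [_ [_]] := H k.+1 I; apply; rewrite /B big_ord_recr /=; right; exact: Fz.
have [j [S [sS Se]]] := (aB K).2 _ e2; exists j, S; split => //.
have mB : measurable (B K) by case: (aB K).
have bE := bm_err mU sS; have b1 := bm_err mB sS.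
have b2 : bm (D0 `&` (\bigcup_k F k `\` B K)).
  by apply: bmI; [exact: bm_box|exact: measurableD].
have BU : B K `<=` \bigcup_k F k.
  by rewrite /B -bigcup_mkord => z [k _ Fz]; exists k.
apply: (@le_lt_trans _ _ (rm rho (err (B K) S `|` (D0 `&` (\bigcup_k F k `\` B K))))).
  apply: rm_le => //; [by case: bE|exact: bmU|].
  rewrite /err => z [[[Fz Dz] nS]|[Sz nF]].
    have [BKz|nB] := pselect (B K z); first by left; left.
    by right.
  by left; right; split => // /BU.
by apply: le_lt_trans (rmU_le lfr b1 b2) _; lra.
Qed.

(** The approximating set is the union of the cells on which f < b. A cell on which f oscillates by
    less than [d j] and which is left out meets {f < b} only in the strip b - d j <= f < b, and
    these strips decrease to the empty set. *)
Lemma approx_ray (f : X -> R) (d : nat -> R) b :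
  measurable [set z | f z < b] -> (forall z, D0 z -> measurable [set z | f z < b]) ->
  (forall a, measurable (D0 `&` [set z | a <= f z < b])) ->
  (forall j (i : cidx j), exists c, forall z, cell i z -> c <= f z < c + d j) ->
  (forall j j', (j <= j')%N -> d j' <= d j) -> (forall e, 0 < e -> exists j, d j < e) ->
  cell_approx [set z | f z < b].
Proof.
move=> mf _ mf2 Hf dd d0; split => // e e0.
have bF j : bm (D0 `&` [set z | b - d j <= f z < b]).
  by apply: (@bmS _ _ _ D0) => //; exact: bm_box.
have [j Hj] : exists j, rm rho (D0 `&` [set z | b - d j <= f z < b]) < e.
  apply: rm_bigcap0 => //.
  - move=> j j' jj'; apply/subsetPset => z [Dz /= H]; split => //=.
    by have := dd _ _ jj'; lra.
  - rewrite -subset0 => z H; have [_ /= /andP[_ fb]] := H 0 I.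
    have [j dj] := d0 (b - f z) (ltac:(lra)).
    by have [_ /=] := H j I; lra.
pose S := [set z | exists2 i : cidx j, (forall z', cell i z' -> f z' < b) & cell i z].
have sS : sat j S.
  split; first by move=> z [i _ /cell_box].
  by move=> i z z' cz cz' [i' H cz'']; rewrite (cell_uniq cz cz'') in cz'; exists i'.
exists j, S; split => //; apply: le_lt_trans Hj; apply: rm_le => //.
  by case: (bm_err mf sS).
move=> z [[[/= fz Dz] nS]|[[i H cz] /= nf]]; last by have := nf (H z cz).
split => //=; rewrite fz andbT; have [i cz] := cell_cover j Dz.
have [c Hc] := Hf j i; case: (lerP (b - d j) (f z)) => // ?; exfalso; apply: nS.
by exists i => // z' /Hc; have := Hc z cz; lra.
Qed.

Lemma cl_small e : 0 < e -> exists j, cl j < e.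
Proof.
move=> e0; exists (Num.truncn (l0 / e)).+1; rewrite /cl ltr_pdivrMr ?ltr0n// -ltr_pdivrMl// mulrC.
apply: (@lt_le_trans _ _ (Num.truncn (l0 / e)).+1%:R); first exact: truncnS_gt.
by rewrite ler_nat ltnW// ltn_expl.
Qed.

Lemma M_ge j : (2 ^ j <= M j)%N.
Proof.
elim: j => [|j IH]; first by rewrite M0.
by have [c c1 ->] := MS j; rewrite expnSr leq_mul.
Qed.

Lemma ch_small e : 0 < e -> exists j, ch j < e.
Proof.
move=> e0; exists (Num.truncn (h0 / e)).+1; rewrite /ch ltr_pdivrMr ?ltr0n// -ltr_pdivrMl// mulrC.
apply: (@lt_le_trans _ _ (Num.truncn (h0 / e)).+1%:R); first exact: truncnS_gt.
by rewrite ler_nat; apply: leq_trans (M_ge _); rewrite ltnW// ltn_expl.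
Qed.

Lemma ch_le j j' : (j <= j')%N -> ch j' <= ch j.
Proof.
move=> /M_dvd[c c0 E]; rewrite /ch ler_pM2l// lef_pV2 ?posrE ?ltr0n// ler_nat E.
by rewrite leq_pmulr.
Qed.

Lemma approx_coord (f : Rn R n * measurableTypeR R -> R) (d : nat -> R) b :
  measurable_fun setT f ->
  (forall j (i : cidx j), exists c, forall z, cell i z -> c <= f z < c + d j) ->
  (forall j j', (j <= j')%N -> d j' <= d j) -> (forall e, 0 < e -> exists j, d j < e) ->
  cell_approx [set z | f z < b].
Proof.
move=> mf Hf dd d0.
have m1 : measurable ([set z | f z < b] : set X).
  apply: borel_lebesgue_measurable; rewrite (_ : [set _ | _] = setT `&` f @^-1` `]-oo, b[).
    exact: mf.
  by apply/seteqP; split => z /=; rewrite in_itv/=; [split|case].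
apply: (@approx_ray _ d) => // a; apply: measurableI; first exact: measurable_box.
apply: borel_lebesgue_measurable; rewrite (_ : [set _ | _] = setT `&` f @^-1` `[a, b[).
  exact: mf.
by apply/seteqP; split => z /=; rewrite in_itv/=; [split|case].
Qed.

Lemma approx_borel (A : set (Rn R n * measurableTypeR R)) : measurable A -> cell_approx A.
Proof.
move=> mA; apply: (@borel_induction R n cell_approx) => //.
- split; first exact: approx0.
  + by move=> B HB; rewrite setTD; exact: approxC.
  + exact: approx_bigcup.
- move=> k b; apply: (@approx_coord (fun z => tnth z.1 k) cl).
  + apply: (measurableT_comp (measurable_tnth k)); exact: measurable_fst.
  + by move=> j i; exists (tnth (cx i) k) => z [H _]; exact: H.
  + exact: cl_le.
  + exact: cl_small.
- move=> b; apply: (@approx_coord snd ch).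
  + exact: measurable_snd.
  + by move=> j i; exists (ct i) => z [_ H].
  + exact: ch_le.
  + exact: ch_small.
Qed.

End saturated.

Section cell_measures.
Variables m1 m2 : {measure set X -> \bar R}.
Hypotheses (lf1 : locfin m1) (lf2 : locfin m2) (ac2 : ac m2).
Variable G : set X.
Hypothesis mG : measurable G.
Hypothesis m12 : forall j (i : cidx j), rm m1 (cell i `&` G) <= rm m2 (cell i).

Lemma cell_measure_le A : measurable A -> A `<=` box x0 l0 t0 h0 -> A `<=` G ->
  rm m1 A <= rm m2 A.
Proof.
move=> mA AD AG; have bA : bm A by apply: bmS AD => //; exact: bm_box.
(* One saturated set has to approximate for both measures at once, hence their sum. *)
pose rho := measure_add m1 m2.
have lfr : locfin rho.
  by move=> x l t h; rewrite [ltLHS]measure_addE lte_add_pinfty// ?lf1 ?lf2.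
have rhoE B : bm B -> rm rho B = rm m1 B + rm m2 B.
  by move=> bB; rewrite /rm [X in fine X]measure_addE fineD// ?(bm_fin lf1) ?(bm_fin lf2).
have [B [mB AB BA0]] := borel_hull bA.
have mB' : measurable (B : set X) by exact: borel_lebesgue_measurable.
apply/ler_addgt0Pr => e e0.
have [_ /(_ _ e0)[j [S [sS Se]]]] := approx_borel lfr mB.
have bS := sat_bm sS; have [mS _] := bS.
have bE := bm_err mB' sS; rewrite rhoE// in Se; have [mE _] := bE.
have e1 := rm_ge0 m1 (err B S); have e2 := rm_ge0 m2 (err B S).
have H1 : rm m1 A <= rm m1 (S `&` G) + rm m1 (err B S).
  apply: le_trans (rmU_le lf1 (bmI bS mG) bE); apply: rm_le => //.
    by apply: bmU => //; exact: bmI.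
  move=> z Az; have [Sz|nSz] := pselect (S z); [left|right].
    by split => //; exact: AG.
  by left; split => //; split; [exact: AB|exact: AD].
have H2 : rm m1 (S `&` G) <= rm m2 S.
  rewrite (sat_bigU sS) setIC big_distrr/= (rm_bigU lf2); last 3 first.
  - exact: index_enum_uniq.
  - by move=> i _; exact: bm_cell.
  - by move=> i i' z _ _; exact: cell_uniq.
  apply: le_trans (rm_bigU_le lf1 _ _) _.
    by move=> i _; rewrite setIC; apply: bmI => //; exact: bm_cell.
  by apply: ler_sum => i _; rewrite setIC; exact: m12.
(* The approximation is made for the Borel hull [B]; the null set separating it from [A] must be
   invisible to [m2], which is bounded from above by its value on [A]. *)
have BS0 : rm m2 (S `&` (B `\` A)) = 0.
  rewrite /rm (_ : m2 _ = 0)//; apply: ac2.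
    by apply: measurableI => //; exact: measurableD.
  apply: subset_measure0 BA0 => //; first by apply: measurableI => //; exact: measurableD.
  exact: measurableD.
have H3 : rm m2 S <= rm m2 A + rm m2 (err B S).
  rewrite -[leRHS]addr0 -BS0.
  have b3 : bm (S `&` (B `\` A)) by apply: bmI => //; exact: measurableD.
  apply: le_trans (lerD (rmU_le lf2 bA bE) (lexx _)).
  apply: le_trans (rmU_le lf2 (bmU bA bE) b3); apply: rm_le => //.
    by apply: bmU => //; exact: bmU.
  move=> z Sz; have [Az|nAz] := pselect (A z); first by left; left.
  have [Bz|nBz] := pselect (B z); first by right.
  by left; right; right.
lra.
Qed.

End cell_measures.

(** * Stopping cells and the one-sided covering estimate *)

Section stopping.
Variable S : pbox R n -> Prop.
Hypothesis nS0 : ~ S (x0, l0, t0, h0).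

Definition cD j (i : cidx j) : pbox R n := (cx i, cl j, ct i, ch j).
Let D0 : pbox R n := (x0, l0, t0, h0).

Definition fs j (i : cidx j) := S (cD i) /\
  forall j1 (i1 : cidx j1), (j1 < j)%N -> below i1 i -> ~ S (cD i1).

Lemma cD_inbox j (i : cidx j) : inbox (cD i) D0.
Proof. by split; [exact: cell_cx|have [] := cell_ct i|have [] := cell_ct i]. Qed.

Lemma cD_adm j (i : cidx j) : padm sg p (cD i).
Proof. exact: aM. Qed.

Lemma cell_corner j (i : cidx j) : cell i (cx i, ct i).
Proof.
have := cl_gt0 j; have := ch_gt0 j; move=> a b.
by split => [k|] /=; rewrite lexx ltrDl.
Qed.

Lemma cD0 (i : cidx 0) : cD i = D0.
Proof.
move: i => [i k]; rewrite /cD /cx /cl /ct /ch /= /subx /subt.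
have k0 : (k : nat) = 0 by case: k => k /=; rewrite M0; case: k.
have i0 m : (i m : nat) = 0 by case: (i m) => v /=; rewrite expn0; case: v.
have -> : [tuple tnth x0 m + l0 / (N ^ 0)%:R * (i m)%:R | m < n] = x0.
  by apply: eq_from_tnth => m; rewrite tnth_mktuple i0 mulr0 addr0.
by rewrite k0 mulr0 addr0 M0 expn0 !divr1.
Qed.

Lemma fs_ancestor j (i : cidx j) : S (cD i) ->
  exists j1 (i1 : cidx j1), fs i1 /\ below i1 i.
Proof.
have [m] := ubnP j; elim: m j i => // m IH j i jm Si.
have [[j1 [i1 [jj b1 S1]]]|H] := pselect (exists j1 (i1 : cidx j1),
    [/\ (j1 < j)%N, below i1 i & S (cD i1)]).
  have [j2 [i2 [f2 b2]]] := IH j1 i1 (leq_trans jj jm) S1.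
  by exists j2, i2; split => //; exact: below_trans b2 b1.
exists j, i; split; last by split.
by split => // j1 i1 jj b1 S1; apply: H; exists j1, i1.
Qed.

(** The parent [D'], where [S] fails, supplies the bound opposite to [S]: the average of a stopped
    box is comparable with the threshold. *)
Definition stopped (D : pbox R n) := [/\ padm sg p D, S D, inbox D D0 &
  exists D', [/\ padm sg p D', bl D' = N%:R * bl D, ~ S D', inbox D D' & inbox D' D0]].

Lemma fs_stopped j (i : cidx j) : fs i -> stopped (cD i).
Proof.
move=> [Si Hi]; split => //; [exact: cD_adm|exact: cD_inbox|].
(* Generation 0 consists of the initial box alone, where [S] fails, so a stopped cell has a
   parent. *)
case: j => [|j] in i Si Hi *; first by move: Si; rewrite cD0.
have [i' ci'] := cell_cover j (cell_box (cell_corner i)).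
have b := cell_nest (leqnSn j) ci' (cell_corner i).
exists (cD i'); split => //; [exact: cD_adm| |exact: Hi|exact: cD_inbox].
rewrite /bl/= /cl expnS natrM; field.
by rewrite !pnatr_eq0 -!lt0n N_gt0 ltnW.
Qed.

Definition fsb j (i : cidx j) : bool := `[< fs i >].

(** Finite stages of the family of stopped cells, so that sums and coverings involve finite unions
    only. *)
Definition F (J : nat) : seq (pbox R n) :=
  flatten [seq [seq cD i | i <- index_enum (cidx j) & fsb i] | j <- iota 0 J].

Lemma mem_F J D : D \in F J <-> exists j (i : cidx j), [/\ (j < J)%N, fs i & D = cD i].
Proof.
split.
  move=> /flatten_mapP[j]; rewrite mem_iota/= add0n => jJ /mapP[i].
  by rewrite mem_filter => /andP[/asboolP fi _] ->; exists j, i.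
move=> [j [i [jJ fi ->]]]; apply/flatten_mapP; exists j; first by rewrite mem_iota add0n.
apply/mapP; exists i => //; rewrite mem_filter mem_index_enum andbT; exact/asboolP.
Qed.

Lemma fs_disjoint j j' (i : cidx j) (i' : cidx j') z : (j < j')%N -> fs i -> fs i' ->
  cell i z -> cell i' z -> False.
Proof.
move=> jj [Si _] [_ H] ciz ciz'; apply: (H j i jj) => //.
exact: cell_nest (ltnW jj) ciz ciz'.
Qed.

Definition EJ J := [set z | exists2 D, D \in F J & bset D z].

Lemma F_S J : F J.+1 = F J ++ [seq cD i | i <- index_enum (cidx J) & fsb i].
Proof. by rewrite /F -[J.+1]addn1 iotaD map_cat flatten_cat/= cats0 add0n. Qed.

Lemma EJ_S J : EJ J.+1 = EJ J `|` \big[setU/set0]_(i : cidx J | fsb i) cell i.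
Proof.
rewrite -bigcup_seq_cond; apply/seteqP; split => z.
  move=> [D]; rewrite F_S mem_cat => /orP[DF Dz|]; first by left; exists D.
  move=> /mapP[i]; rewrite mem_filter => /andP[fi ii] -> ciz.
  by right; exists i => //=; rewrite mem_index_enum.
move=> [[D DF Dz]|[i /= /andP[_ fi] ciz]]; first by exists D => //; rewrite F_S mem_cat DF.
exists (cD i) => //; rewrite F_S mem_cat; apply/orP; right; apply/mapP; exists i => //.
by rewrite mem_filter fi mem_index_enum.
Qed.

Lemma EJ0 : EJ 0 = set0.
Proof. by apply/seteqP; split => z // [D]; rewrite in_nil. Qed.

Lemma bm_EJ J : bm (EJ J).
Proof.
elim: J => [|J IH]; first by rewrite EJ0; exact: bm0.
by rewrite EJ_S; apply: bmU => //; apply: bm_bigU => i _; exact: bm_cell.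
Qed.

Lemma sum_F (nu : {measure set X -> \bar R}) J : locfin nu ->
  \sum_(D <- F J) rm nu (bset D) = rm nu (EJ J).
Proof.
move=> lf; elim: J => [|J IH]; first by rewrite big_nil EJ0 rm0.
rewrite F_S big_cat/= IH EJ_S rmU//.
- congr (_ + _); rewrite big_map big_filter rm_bigU//.
  + exact: index_enum_uniq.
  + by move=> i _; exact: bm_cell.
  + by move=> i i' z _ _; exact: cell_uniq.
- exact: bm_EJ.
- by apply: bm_bigU => i _; exact: bm_cell.
- rewrite -subset0 -bigcup_seq_cond => z [[D /mem_F[j [i [jJ fi ->]]] Dz] [i' /= /andP[_ /asboolP fi'] cz]].
  exact: (fs_disjoint jJ fi fi' Dz cz).
Qed.

Section covering.
Variables (kap c : R) (nu : {measure set X -> \bar R}) (Om : set X).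
Hypotheses (lf : locfin nu) (kap0 : 0 <= kap) (c4 : `|c| <= 4) (bO : bm Om).
Hypothesis HD : forall D, stopped D ->
  rm leb (bset (star p D)) <= kap * rm nu (bset (tshift p c D)) /\
  bset (tshift p c D) `<=` Om.

Lemma shift_uniq j (i i' : cidx j) z : bset (tshift p c (cD i)) z ->
  bset (tshift p c (cD i')) z -> i = i'.
Proof.
move=> [H1 H2] [H1' H2'].
rewrite /tshift/cD/bt/bh/bl/= in H2 H2'.
apply: (@cell_uniq j i i' (z.1, z.2 - c * cl j `^ p)).
  by split => /=; [exact: H1|lra].
by split => /=; [exact: H1'|lra].
Qed.

Lemma shift_star j j' (i : cidx j) (i' : cidx j') z : (j <= j')%N ->
  bset (tshift p c (cD i)) z -> bset (tshift p c (cD i')) z ->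
  cell i' `<=` bset (star p (cD i)).
Proof.
move=> jj' [H1 H2] [H1' H2'] y [y1 y2].
have H := cx_nest jj' H1 H1'; split; first exact: H.
have r' : 0 < cl j' `^ p by rewrite powR_gt0// cl_gt0.
have rr' : cl j' `^ p <= cl j `^ p.
  apply: (ge0_ler_powR (le_trans ler01 p1)); rewrite ?nnegrE; [exact/ltW/cl_gt0|exact/ltW/cl_gt0|exact: cl_le].
have [_ h0j hj _] := aM j; have [_ h0j' hj' _] := aM j'.
rewrite -/(ch j) -/(cl j) in hj h0j; rewrite -/(ch j') -/(cl j') in hj' h0j'.
have hj1 : ch j <= cl j `^ p by rewrite (le_trans hj)// ler_piMl// powR_ge0.
have hj1' : ch j' <= cl j' `^ p by rewrite (le_trans hj')// ler_piMl// powR_ge0.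
move: H2 H2'; rewrite /tshift/star/cD/bt/bh/bl/= => H2 H2'.
move: c4; rewrite ler_norml => c4'.
have [u1 u2] : 0 <= cl j `^ p - cl j' `^ p /\ cl j `^ p - cl j' `^ p <= cl j `^ p by split; lra.
have a1 : c * (cl j `^ p - cl j' `^ p) <= 4 * cl j `^ p by nra.
have a2 : - (4 * cl j `^ p) <= c * (cl j `^ p - cl j' `^ p) by nra.
lra.
Qed.

(* Cells are treated from coarse to fine. By [shift_star], a cell whose shifted box meets the shifted
   box of a coarser selected cell lies in the star of the latter, so only cells not yet contained in
   U have to be added, and their shifted boxes are disjoint from V. *)
Lemma covering_step J : exists U V : set X, [/\ [/\ bm U, bm V & V `<=` Om],
  rm leb U <= kap * rm nu V,
  forall j (i : cidx j), (j < J)%N -> fs i -> cell i `<=` U &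
  forall j (i : cidx j) z, (J <= j)%N -> bset (tshift p c (cD i)) z -> V z -> cell i `<=` U].
Proof.
elim: J => [|J [U [V [[bU bV VO] UV HU HV]]]].
  exists set0, set0; split => //; last by rewrite !rm0 mulr0.
  by split => //; exact: bm0.
pose P (i : cidx J) := `[< fs i /\ ~ (cell i `<=` U) >].
pose U' := \big[setU/set0]_(i : cidx J | P i) bset (star p (cD i)).
pose V' := \big[setU/set0]_(i : cidx J | P i) bset (tshift p c (cD i)).
have bU' : bm U' by apply: bm_bigU => i _; exact: bm_bset.
have bV' : bm V' by apply: bm_bigU => i _; exact: bm_bset.
exists (U `|` U'), (V `|` V'); split.
- split; [exact: bmU|exact: bmU|].
  move=> z [/VO//|]; rewrite /V' -bigcup_seq_cond => -[i /= /andP[_ /asboolP[fi _]]].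
  by have [_ H] := HD (fs_stopped fi); exact: H.
- rewrite (rmU lf)//; last first.
    rewrite -subset0 => z [Vz]; rewrite /V' -bigcup_seq_cond => -[i /= /andP[_ /asboolP[fi nU]] Pz].
    exact/nU/(HV J i z).
  apply: le_trans (rmU_le locfin_lebesgue bU bU') _.
  rewrite mulrDr lerD//.
  apply: le_trans (rm_bigU_le locfin_lebesgue _ _) _.
    by move=> i _; exact: bm_bset.
  rewrite rm_bigU//; last 3 first.
  + exact: index_enum_uniq.
  + by move=> i _; exact: bm_bset.
  + by move=> i i' z _ _; exact: shift_uniq.
  rewrite mulr_sumr; apply: ler_sum => i /asboolP[fi _].
  by have [] := HD (fs_stopped fi).
- move=> j i; rewrite ltnS leq_eqVlt => /orP[/eqP jJ|jJ] fi.
    have H (i' : cidx J) : fs i' -> cell i' `<=` U `|` U'.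
      move=> fi'; have [s|ns] := pselect (cell i' `<=` U); first by move=> z /s; left.
      move=> z Dz; right; rewrite /U' -bigcup_seq_cond; exists i' => //=.
        by rewrite mem_index_enum; exact/asboolP.
      have ? := cl_gt0 J.
      have Pz : bset (tshift p c (cD i')) (cx i', ct i' + c * cl J `^ p).
        have ? := ch_gt0 J.
        by split => [k|]; rewrite /bx/tshift/cD/bt/bh/bl/= lexx ltrDl.
      exact: (shift_star (leqnn J) Pz Pz).
    by subst j; exact: H.
  by move=> z ciz; left; exact: (HU j i).
- move=> j i z jJ Pz [Vz|].
    by move=> y ciy; left; exact: (HV j i z (ltnW jJ)).
  rewrite /V' -bigcup_seq_cond => -[i' /= /andP[_ Pi'] Pz'] y ciy; right.
  rewrite /U' -bigcup_seq_cond; exists i'; first by rewrite /= mem_index_enum.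
  exact: (shift_star (ltnW jJ) Pz' Pz).
Qed.

Lemma covering J : \sum_(D <- F J) rm leb (bset D) <= kap * rm nu Om.
Proof.
rewrite sum_F; last exact: locfin_lebesgue.
have [U [V [[bU bV VO] UV HU _]]] := covering_step J.
apply: (@le_trans _ _ (rm leb U)).
  apply: rm_le => //; [exact: locfin_lebesgue|by case: (bm_EJ J)|].
  by move=> z [D /mem_F[j [i [jJ fi ->]]] Dz]; exact: (HU j i).
apply: le_trans UV _; rewrite ler_wpM2l//; apply: rm_le => //; by case: bV.
Qed.

End covering.

(** A cell satisfying [S] lies below a stopped cell and so misses the complement of the stopped
    cells; on any other cell the hypothesis applies. Either way [m1] restricted to that complement
    is at most [m2] on cells. *)
Lemma stopping_measure_le (m1 m2 : {measure set X -> \bar R}) :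
  locfin m1 -> locfin m2 -> ac m2 ->
  (forall D, padm sg p D -> inbox D D0 -> ~ S D -> rm m1 (bset D) <= rm m2 (bset D)) ->
  forall A, measurable A -> A `<=` bset D0 ->
  (forall J D z, D \in F J -> A z -> ~ bset D z) -> rm m1 A <= rm m2 A.
Proof.
move=> lf1 lf2 ac2 H A mA AD AF.
have mG : measurable (~` \bigcup_J EJ J).
  by apply: measurableC; apply: bigcup_measurable => J _; case: (bm_EJ J).
apply: (cell_measure_le lf1 lf2 ac2 mG) => //; last first.
  by move=> z Az [J _ [D DF Dz]]; exact: (AF J D z).
move=> j i; have [Si|nSi] := pselect (S (cD i)).
  rewrite (_ : _ `&` _ = set0) ?rm0 ?rm_ge0// -subset0 => z [ciz]; apply.
  have [j1 [i1 [f1 b1]]] := fs_ancestor Si.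
  exists j1.+1 => //; exists (cD i1); first by apply/mem_F; exists j1, i1.
  exact: (below_sub b1).
apply: (@le_trans _ _ (rm m1 (cell i))).
  by apply: rm_le => //; [apply: measurableI => //; exact: measurable_box|exact: bm_cell].
by apply: (H (cD i)) => //; [exact: cD_adm|exact: cD_inbox].
Qed.

End stopping.

End grid.

Section stopping_theorem.
Context {R : realType} {n : nat}.
Local Notation X := (spacetime R n).
Local Notation leb := (@lebesgue R n).

(* The boxes of F are the maximal grid cells satisfying S. The third clause is a one-sided
   covering estimate: the shifted boxes may overlap, and the star absorbs the overlaps. The last
   clause plays the role of the Lebesgue differentiation theorem. *)
Theorem stopping_boxes (sg p : R) (N : nat) (D0 : pbox R n) (S : pbox R n -> Prop) :
  0 < sg -> sg <= 1 -> 1 <= p -> (1 < N)%N -> padm sg p D0 -> ~ S D0 ->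
  exists F : nat -> seq (pbox R n),
  [/\ forall J D, D \in F J -> [/\ padm sg p D, S D, inbox D D0 &
        exists D', [/\ padm sg p D', bl D' = N%:R * bl D, ~ S D', inbox D D' & inbox D' D0]],
      forall J D, D \in F J -> D \in F J.+1,
      forall (kap c : R) (nu : {measure set X -> \bar R}) (Om : set X),
        locfin nu -> 0 <= kap -> `|c| <= 4 -> bm Om ->
        (forall D, [/\ padm sg p D, S D, inbox D D0 &
          exists D', [/\ padm sg p D', bl D' = N%:R * bl D, ~ S D', inbox D D' & inbox D' D0]] ->
          rm leb (bset (star p D)) <= kap * rm nu (bset (tshift p c D)) /\
          bset (tshift p c D) `<=` Om) ->
        forall J, \sum_(D <- F J) rm leb (bset D) <= kap * rm nu Om
    & forall m1 m2 : {measure set X -> \bar R},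
        locfin m1 -> locfin m2 -> ac m2 ->
        (forall D, padm sg p D -> inbox D D0 -> ~ S D -> rm m1 (bset D) <= rm m2 (bset D)) ->
        forall A, measurable A -> A `<=` bset D0 ->
        (forall J D z, D \in F J -> A z -> ~ bset D z) -> rm m1 A <= rm m2 A].
Proof.
move: D0 => [[[x0 l0] t0] h0] s0 s1 p1 N1 aD nS.
have [M [M0 MS aM]] := grid_heights s0 p1 N1 aD.
exists (F N M x0 l0 t0 h0 S); split.
- by move=> J D /mem_F[j [i [_ fi ->]]]; exact: fs_stopped.
- by move=> J D; rewrite F_S mem_cat => ->.
- move=> kap c nu Om lf k0 c4 bO H J.
  by apply: covering H _ => //.
- move=> m1 m2 lf1 lf2 a2 H A mA AD AF.
  by apply: stopping_measure_le H A mA AD AF => //.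
Qed.

End stopping_theorem.

(** * Mass moves forward in time under a reverse Hoelder inequality *)

Section spread.
Context {R : realType} {n : nat}.
Local Notation X := (spacetime R n).
Local Notation leb := (@lebesgue R n).
Variables (p Cd : R) (del : R -> R).
Hypotheses (p1 : 1 < p) (Cd1 : 1 <= Cd) (del0 : forall eta, 0 < eta -> 0 < del eta).
Implicit Types (x y : n.-tuple R) (l t h : R).

(** Up to the choice of corner, the lag 0 halves of a parabolic rectangle. *)
Definition pb y l t : set X := box y l t (l `^ p).

(* All that is used of a reverse Hoelder inequality: doubling forward in time and quantitative
   absolute continuity. *)
Definition forward_RH (m : {measure set X -> \bar R}) :=
  [/\ locfin m,
      forall y l t, 0 < l -> rm m (pb y l t) <= Cd * rm m (pb y l (t + l `^ p))
    & forall eta y l t (E : set X), 0 < eta -> 0 < l -> measurable E -> E `<=` pb y l t ->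
        rm leb E <= del eta * rm leb (pb y l t) ->
        rm m E <= eta * rm m (pb y l (t + l `^ p))].

Lemma bernoulli (d : R) k : 0 <= d <= 1 -> 1 - k%:R * d <= (1 - d) ^+ k.
Proof.
move=> d01; elim: k => [|k IH]; first by rewrite mul0r subr0 expr0.
rewrite exprS -natr1; have : 0 <= k%:R :> R by [].
have : (1 - d) * (1 - k%:R * d) <= (1 - d) * (1 - d) ^+ k by rewrite ler_wpM2l//; lra.
nra.
Qed.

Lemma powR_half (l : R) : 0 < l -> (l / 2) `^ p * 2 `^ p = l `^ p.
Proof. by move=> l0; rewrite -powRM ?divr_ge0 ?ltW// divfK. Qed.

Section one_measure.
Variables (m : {measure set X -> \bar R}) (Hm : forward_RH m).

Let lfm : locfin m. Proof. by case: Hm. Qed.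

Lemma forward_iter y l t j : 0 < l ->
  rm m (pb y l t) <= Cd ^+ j * rm m (pb y l (t + j%:R * l `^ p)).
Proof.
move=> l0; elim: j => [|j IH]; first by rewrite mul0r addr0 expr0 mul1r.
apply: le_trans IH _; rewrite exprSr -mulrA ler_wpM2l ?exprn_ge0 ?(le_trans ler01)//.
have [_ H _] := Hm; apply: le_trans (H _ _ _ l0) _.
by rewrite -natr1 mulrDl mul1r addrA.
Qed.

Lemma lebpb y l t : 0 < l -> rm leb (pb y l t) = l ^+ n * l `^ p.
Proof. by move=> l0; rewrite /rm /pb lebesgue_box ?powR_ge0// ltW. Qed.

Section step.
Variables (M d : R).
Hypotheses (M1 : 1 <= M) (d01 : 0 < d <= 1) (dM : n%:R * d <= del (2 * M)^-1).

(** The cubes at [y] and [y'] share a cube of side (1 - d) l, so by Bernoulli the part of the box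
    outside the moved one has relative measure at most n d, hence mass at most 1/(2M) of that of the
    later box. If this part carries half of the mass, the later box has at least M times the
    mass. *)
Lemma move_step y y' l t : 0 < l -> (forall i, `|tnth y' i - tnth y i| <= d * l) ->
  2^-1 * rm m (pb y l t) <= rm m (pb y' l t) \/
  M * rm m (pb y l t) <= rm m (pb y l (t + l `^ p)).
Proof.
move=> l0 yy; have [lf HD HR] := Hm.
have M0 : 0 < M by exact: lt_le_trans M1.
have d01' : 0 <= d <= 1 by case/andP: d01 => /ltW -> ->.
have eta0 : 0 < (2 * M)^-1 by rewrite invr_gt0 mulr_gt0.
pose y2 := [tuple Num.max (tnth y i) (tnth y' i) | i < n].
have sub2 : box y2 ((1 - d) * l) t (l `^ p) `<=` pb y l t `&` pb y' l t.
  move=> z [H1 H2]; split; split => // i; have := H1 i; rewrite tnth_mktuple;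
    have := yy i; rewrite ler_norml; case: (lerP (tnth y i) (tnth y' i)) => ?; lra.
have b1 : bm (pb y l t) by exact: bm_box.
have mb' : measurable (pb y' l t) by exact: measurable_box.
have H : rm leb (pb y l t `\` pb y' l t) <= del (2 * M)^-1 * rm leb (pb y l t).
  rewrite (rmD locfin_lebesgue)//.
  have : rm leb (box y2 ((1 - d) * l) t (l `^ p)) <= rm leb (pb y l t `&` pb y' l t).
    by apply: rm_le => //; [exact: locfin_lebesgue|exact: measurable_box|exact: bmI].
  rewrite {1}/rm lebesgue_box ?powR_ge0//=; last by rewrite mulr_ge0 ?subr_ge0 ?(ltW l0)//; case/andP: d01.
  rewrite lebpb// exprMn => H.
  have := @bernoulli d n; have : 0 <= l ^+ n * l `^ p by rewrite mulr_ge0 ?powR_ge0// exprn_ge0// ltW.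
  set u : R := l ^+ n * l `^ p; set v : R := (1 - d) ^+ n in H *.
  rewrite -mulrA -/u in H; move=> u0 /(_ d01') B.
  have : (1 - v) * u <= del (2 * M)^-1 * u by rewrite ler_wpM2r//; apply: le_trans dM; lra.
  lra.
have E : rm m (pb y l t `\` pb y' l t) <= (2 * M)^-1 * rm m (pb y l (t + l `^ p)).
  by apply: HR => //; exact: measurableD (measurable_box _ _ _ _) mb'.
have F : rm m (pb y l t) <= rm m (pb y' l t) + rm m (pb y l t `\` pb y' l t).
  apply: le_trans (rmU_le lf _ _); last 2 first.
  - exact: bm_box.
  - exact: bmD.
  apply: rm_le => //; [exact: measurable_box|apply: bmU; [exact: bm_box|exact: bmD]|].
  by move=> z z1; have [|] := pselect (pb y' l t z); [left|right].
have [?|lt1] := lerP (2^-1 * rm m (pb y l t)) (rm m (pb y' l t)); first by left.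
right; have G : rm m (pb y l t) / 2 <= (2 * M)^-1 * rm m (pb y l (t + l `^ p)) by lra.
rewrite invfM -mulrA -[X in X <= _]mulrC ler_pM2l ?invr_gt0// in G.
by rewrite -ler_pdivlMl.
Qed.

(* Moving y towards ys in N steps while losing a factor 2 per step; a failed step gains a factor M
   and advances time by l^p. *)
Lemma one_scale l ys : 0 < l -> forall N K y t,
  (forall i, `|tnth ys i - tnth y i| <= N%:R * (d * l)) ->
  exists j y', [/\ (j <= K)%N, forall i, `|tnth ys i - tnth y' i| <= `|tnth ys i - tnth y i| &
   (y' = ys /\ rm m (pb y l t) <= 2 ^+ N * rm m (pb ys l (t + j%:R * l `^ p))) \/
   (j = K /\ M ^+ K * rm m (pb y l t) <= 2 ^+ N * rm m (pb y' l (t + K%:R * l `^ p)))].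
Proof.
move=> l0; elim=> [|N IHN] K y t yy.
  have E : y = ys.
    apply: eq_from_tnth => i; have := yy i; rewrite mul0r normr_le0 subr_eq0.
    by move=> /eqP.
  exists 0, ys; split => //; first by move=> i; rewrite subrr normr0.
  by left; split => //; rewrite E mul0r addr0 expr0 mul1r.
have dl0 : 0 < d * l by rewrite mulr_gt0//; case/andP: d01.
(* The inner induction is on the number of failures allowed: a successful step lowers [N] and leaves
   this number intact, a failed one lowers it and leaves [y] in place. *)
elim: K y t yy => [|K IHK] y t yy.
  exists 0, y; split => //; right; split => //.
  by rewrite mul0r addr0 expr0 mul1r ler_peMl ?rm_ge0// exprn_ege1// ler1n.
pose y' := [tuple tnth y i + (tnth ys i - tnth y i) / N.+1%:R | i < n].
have N0 : 0 < N.+1%:R :> R by rewrite ltr0n.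
have NS : N.+1%:R = N%:R + 1 :> R by rewrite natr1.
have Y1 i : `|tnth y' i - tnth y i| <= d * l.
  rewrite tnth_mktuple [X in `|X|]addrC addKr normrM [`|_^-1|]gtr0_norm ?invr_gt0//.
  by rewrite ler_pdivrMr// mulrC.
have Y3 i : `|tnth ys i - tnth y' i| = `|tnth ys i - tnth y i| * (N%:R / N.+1%:R).
  rewrite tnth_mktuple.
  have -> : tnth ys i - (tnth y i + (tnth ys i - tnth y i) / N.+1%:R) =
      (tnth ys i - tnth y i) * (N%:R / N.+1%:R).
    by rewrite NS; field; rewrite -NS gt_eqF.
  by rewrite normrM [`|_ / _|]ger0_norm ?divr_ge0.
have Y4 i : `|tnth ys i - tnth y' i| <= `|tnth ys i - tnth y i|.
  by rewrite Y3 ler_piMr// ler_pdivrMr// mul1r NS; lra.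
have Y2 i : `|tnth ys i - tnth y' i| <= N%:R * (d * l).
  rewrite Y3; apply: (le_trans (ler_wpM2r _ (yy i))); first by rewrite divr_ge0.
  rewrite le_eqVlt; apply/orP; left; apply/eqP; field.
  by rewrite addrC natr1 gt_eqF.
have [H|H] := move_step t l0 Y1.
  have [j [z [jK zz Hz]]] := IHN K.+1 y' t Y2; exists j, z; split => //.
    by move=> i; exact: le_trans (Y4 i).
  have F : rm m (pb y l t) <= 2 * rm m (pb y' l t) by lra.
  case: Hz => -[E G]; [left|right]; split => //; rewrite [2 ^+ N.+1]exprS -[leRHS]mulrA.
    by apply: le_trans F _; rewrite ler_wpM2l.
  apply: (@le_trans _ _ (M ^+ K.+1 * (2 * rm m (pb y' l t)))).
    by rewrite ler_wpM2l// exprn_ge0// (le_trans ler01).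
  by rewrite mulrCA ler_wpM2l.
have [j [z [jK zz Hz]]] := IHK y (t + l `^ p) yy; exists j.+1, z; split => //.
have ET k : t + l `^ p + k%:R * l `^ p = t + k.+1%:R * l `^ p by rewrite -natr1; ring.
rewrite !ET in Hz; case: Hz => -[E G]; [left|right]; split => //.
- apply: le_trans _ G; apply: le_trans H; rewrite ler_peMl ?rm_ge0//.
- by rewrite E.
- apply: le_trans _ G; by rewrite exprSr -mulrA ler_wpM2l// exprn_ge0// (le_trans ler01).
Qed.

End step.

(** One of the 2^n Kp subboxes carries at least the mean mass; since 2^p <= Kp its height is at most
    (l/2)^p, so a box [pb] of side l/2 contains it. *)
Lemma halve (Kp : nat) y l t : 0 < l -> (0 < Kp)%N -> 2 `^ p <= Kp%:R ->
  exists y' t', [/\ forall i, tnth y i <= tnth y' i <= tnth y i + l / 2,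
    t <= t' <= t + l `^ p &
    rm m (pb y l t) <= #|{: @idx n 2 Kp}|%:R * rm m (pb y' (l / 2) t')].
Proof.
move=> l0 Kp0 Hp; have r0 : 0 < l `^ p by rewrite powR_gt0.
have KR : 0 < Kp%:R :> R by rewrite ltr0n.
set c := #|_|%:R : R.
have c0 : 0 < c.
  rewrite ltr0n; apply/card_gt0P; exists ([ffun=> ord0], Ordinal Kp0) => //.
have [[i Hi]|H] := pselect (exists i : @idx n 2 Kp, rm m (pb y l t) <= c * rm m (sub y l t (l `^ p) 2 Kp i)).
  exists (subx y l i.1), (subt t (l `^ p) i.2); split.
  - move=> k; rewrite tnth_mktuple.
    have : ((i.1 k : nat) <= 1)%N by have := ltn_ord (i.1 k).
    rewrite -(ler_nat R) => i1; have : 0 <= (i.1 k)%:R :> R by [].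
    nra.
  - by have := subt_bounds t i.2 r0; have : 0 < l `^ p / Kp%:R by [rewrite divr_gt0|]; lra.
  - apply: (le_trans Hi); rewrite ler_pM2l//; apply: rm_le => //.
    + exact: measurable_box.
    + exact: bm_box.
    + move=> z [z1 z2]; split => //.
      have : l `^ p / Kp%:R <= (l / 2) `^ p.
        have l20 : 0 < (l / 2) `^ p by apply: powR_gt0; rewrite divr_gt0.
        by rewrite ler_pdivrMr// -(powR_half l0) ler_pM2l.
      lra.
exfalso; have := rm_sub (m := m) y t lfm l0 r0 (isT : 0 < 2)%N Kp0 => E.
have : \sum_(i : @idx n 2 Kp) rm m (sub y l t (l `^ p) 2 Kp i) <
    \sum_(i : @idx n 2 Kp) rm m (pb y l t) / c.
  apply: ltr_sum.
    by apply/hasP; exists ([ffun=> ord0], Ordinal Kp0) => //; rewrite mem_index_enum.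
  by move=> i _; rewrite ltr_pdivlMr// mulrC ltNge; apply/negP => Hi; apply: H; exists i.
by rewrite -E sumr_const -mulr_natr -/c divfK ?gt_eqF// ltxx.
Qed.

(* If the bound fails, [one_scale] at side l / 2^k ends each time in the growth alternative, and
   [halve] then passes to side l / 2^(k+1) at the cost of a constant; the masses reached exceed
   2^(N0 * 2^k) times a positive number. The time spent is a multiple of the sum of
   2^k * (l / 2^k)^p, which converges as p > 1, so all boxes stay in the fixed box Rg, whose mass is
   finite. *)
Lemma spread_chain (Kp N0 : nat) (d La : R) y ys l t :
  (0 < Kp)%N -> 2 `^ p <= Kp%:R -> (0 < N0)%N -> 0 < d <= 1 ->
  n%:R * d <= del (2 * (4 * #|{: @idx n 2 Kp}|%:R))^-1 ->
  0 < l -> (forall i, `|tnth ys i - tnth y i| <= La) -> La + l <= N0%:R * (d * l) ->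
  rm m (pb y l t) <= 2 ^+ N0 * rm m (box ys l t (2 / (1 - 2 / 2 `^ p) * N0%:R * l `^ p)).
Proof.
move=> Kp0 HKp N00 d01 Hd l0 yy HN0.
set rho := 2 / 2 `^ p; set A := 2 / (1 - rho); set T := box _ _ _ _.
set c0 := #|_|%:R in Hd.
have N0R : 1 <= N0%:R :> R by rewrite ler1n.
have p0 : 0 <= p by rewrite ltW// (lt_trans ltr01).
have p2 : (2 : R) < 2 `^ p.
  have p10 : 0 < p - 1 by rewrite subr_gt0.
  have := gt0_ltr_powR p10 _ _ (ltr1n R 2); rewrite !nnegrE powR1 => /(_ ler01 (ler0n _ _)) H.
  by rewrite -mulr_powRB1 ?(lt_trans ltr01)// ltr_pMr.
have tp : 0 < 2 `^ p :> R by rewrite powR_gt0.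
have rho1 : rho < 1 by rewrite ltr_pdivrMr// mul1r.
have c01 : 1 <= c0.
  by rewrite ler1n; apply/card_gt0P; exists ([ffun=> ord0], Ordinal Kp0).
(* The gain per failed step. Over N failures, c0^N pays for [halve], a factor 2^N pays for the loss
   in [one_scale], and 2^N remains; as N = N0 2^k, this doubles the exponent from scale k to the
   next. *)
have M1 : 1 <= 4 * c0 by lra.
rewrite leNgt; apply/negP => bad.
have P00 : 0 < rm m (pb y l t) by apply: le_lt_trans bad; rewrite mulr_ge0 ?rm_ge0.
pose lk k := l / 2 ^+ k.
have lk0 k : 0 < lk k by rewrite divr_gt0// exprn_gt0.
have lkS k : lk k.+1 = lk k / 2 by rewrite /lk exprS invfM [2^-1 * _]mulrC mulrA.
have lkl k : lk k <= l by rewrite ler_pdivrMr ?exprn_gt0// ler_peMr ?(ltW l0)// exprn_ege1// ler1n.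
(* The time still to be spent from scale k on: the tail of the geometric series of ratio rho with
   terms 2 N0 2^k (lk k)^p. One half of a term covers the failed steps, the other the displacement
   in [halve]. *)
pose Bk k := A * N0%:R * 2 ^+ k * lk k `^ p.
have A0 : 0 < A by rewrite divr_gt0// subr_gt0.
have rk0 k : 0 < lk k `^ p by rewrite powR_gt0.
have rkS k : lk k.+1 `^ p = lk k `^ p / 2 `^ p.
  by rewrite lkS -(powR_half (lk0 k)) mulfK// gt_eqF.
have BkS k : Bk k - Bk k.+1 = 2 * N0%:R * 2 ^+ k * lk k `^ p.
  rewrite /Bk rkS exprS /A /rho; field.
  by rewrite !gt_eqF//; lra.
have N0p : 0 < N0%:R :> R by exact: lt_le_trans N0R.
have Bkp k : 0 < Bk k.
  by apply: mulr_gt0 => //; apply: mulr_gt0; [exact: mulr_gt0|exact: exprn_gt0].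
have BkK k j : (j <= N0 * 2 ^ k)%N -> j%:R * lk k `^ p + lk k `^ p <= Bk k - Bk k.+1.
  move=> jN; rewrite BkS -{2}[lk k `^ p]mul1r -mulrDl ler_pM2r//.
  have : j%:R <= N0%:R * 2 ^+ k :> R by rewrite -natrX -natrM ler_nat.
  have : 1 <= N0%:R * 2 ^+ k :> R by rewrite mulr_ege1// exprn_ege1// ler1n.
  lra.
(* The slack l - lk k in space records the drift of the corner, at most lk k.+1 in each halving. *)
have inv k : exists yk tk, [/\ forall i, `|tnth ys i - tnth yk i| <= La + l - lk k,
    t <= tk, tk + Bk k <= t + Bk 0 &
    2 ^+ (N0 * 2 ^ k) * rm m (pb y l t) <= 2 ^+ N0 * rm m (pb yk (lk k) tk)].
  elim: k => [|k [yk [tk [ya tb tc Hc]]]].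
    exists y, t; rewrite /lk expr0 divr1 muln1; split => // i.
    by apply: (le_trans (yy i)); lra.
  have Hyk i : `|tnth ys i - tnth yk i| <= (N0 * 2 ^ k)%:R * (d * lk k).
    apply: (le_trans (ya i)); rewrite natrM natrX /lk.
    have -> : N0%:R * 2 ^+ k * (d * (l / 2 ^+ k)) = N0%:R * (d * l).
      by field; rewrite gt_eqF ?exprn_gt0.
    by apply: le_trans HN0; rewrite lerBlDr lerDl; exact: ltW (lk0 k).
  have [j [y' [jK zz Hz]]] := one_scale M1 d01 Hd (lk0 k) (N0 * 2 ^ k) tk Hyk.
  have BJ := BkK k j jK.
  case: Hz => -[E G].
    exfalso; move: bad; rewrite ltNge => /negP; apply.
    have sT : rm m (pb ys (lk k) (tk + j%:R * lk k `^ p)) <= rm m T.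
      apply: rm_le => //; [exact: measurable_box|exact: bm_box|].
      move=> z [z1 z2]; split => [i|].
        by have := z1 i; have := lkl k; lra.
      have e : Bk 0 = A * N0%:R * l `^ p by rewrite /Bk /lk expr0 divr1 mulr1.
      rewrite -e; have := Bkp k.+1; have : 0 <= j%:R * lk k `^ p by rewrite mulr_ge0// ltW.
      lra.
    have := ler_wpM2l (exprn_ge0 N0 (ler0n R 2)) (le_trans G (ler_wpM2l (exprn_ge0 _ (ler0n R 2)) sT)).
    move=> /(le_trans Hc); rewrite mulrCA ler_pM2l// exprn_gt0//.
  have [y'' [t'' [ya' tb' Hc']]] := halve y' (tk + (N0 * 2 ^ k)%:R * lk k `^ p) (lk0 k) Kp0 HKp.
  exists y'', t''; rewrite -lkS in ya' Hc'; split.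
  - move=> i; have := zz i; have := ya i; have := ya' i.
    rewrite -[tnth ys i - tnth y'' i](subrKA (tnth y' i)).
    have := ler_normD (tnth ys i - tnth y' i) (tnth y' i - tnth y'' i).
    have : lk k = lk k.+1 + lk k.+1 by rewrite lkS; field.
    move=> ? ? ? ? ?.
    have : `|tnth y' i - tnth y'' i| <= lk k.+1 by rewrite ler_norml; lra.
    lra.
  - have : 0 <= (N0 * 2 ^ k)%:R * lk k `^ p by rewrite mulr_ge0// ltW.
    lra.
  - have := BkK k _ (leqnn _); lra.
  - set N := (N0 * 2 ^ k)%N in Hc G Hc' *.
    have N1 : (0 < N)%N by rewrite muln_gt0 N00 expn_gt0.
    have F : (4 * c0) ^+ N * rm m (pb yk (lk k) tk) <= 2 ^+ N * (c0 * rm m (pb y'' (lk k.+1) t'')).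
      by apply: (le_trans G); rewrite ler_wpM2l// exprn_ge0.
    have F2 : 2 ^+ N * rm m (pb yk (lk k) tk) <= rm m (pb y'' (lk k.+1) t'').
      have c0N : c0 <= c0 ^+ N by rewrite -{1}[c0]expr1 ler_weXn2l.
      have G1 : 2 ^+ N * (c0 * (2 ^+ N * rm m (pb yk (lk k) tk))) <= 2 ^+ N * (c0 * rm m (pb y'' (lk k.+1) t'')).
        apply: le_trans F; rewrite exprMn.
        have -> : 4 ^+ N = 2 ^+ N * 2 ^+ N :> R by rewrite -exprMn -natrM.
        rewrite !mulrA ler_wpM2r ?rm_ge0// -!mulrA ler_wpM2l ?exprn_ge0// mulrC ler_wpM2l ?exprn_ge0//.
      by rewrite ler_pM2l ?exprn_gt0// ler_pM2l ?(lt_le_trans ltr01) in G1.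
    have -> : (N0 * 2 ^ k.+1 = N + N)%N by rewrite expnS mulnCA -/N mul2n addnn.
    rewrite exprD -mulrA.
    apply: (@le_trans _ _ (2 ^+ N * (2 ^+ N0 * rm m (pb yk (lk k) tk)))).
      by rewrite ler_wpM2l// exprn_ge0.
    by rewrite mulrCA ler_wpM2l// exprn_ge0.
pose Rg := box [tuple tnth ys i - (La + l) | i < n] (2 * (La + l) + l) t (Bk 0 + l `^ p).
have HR k : 2 ^+ (N0 * 2 ^ k) * rm m (pb y l t) <= 2 ^+ N0 * rm m Rg.
  have [yk [tk [ya tb tc Hc]]] := inv k; apply: (le_trans Hc).
  rewrite ler_wpM2l ?exprn_ge0//; apply: rm_le => //; [exact: measurable_box|exact: bm_box|].
  move=> z [z1 z2]; split => [i|].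
    by rewrite tnth_mktuple; have := z1 i; have := ya i; rewrite ler_norml; have := lkl k; have := lk0 k; lra.
  have := Bkp k; have : lk k `^ p <= l `^ p.
    by apply: (ge0_ler_powR p0); rewrite ?nnegrE ?(ltW (lk0 k)) ?(ltW l0)// lkl.
  lra.
pose q := 2 ^+ N0 * rm m Rg / rm m (pb y l t).
have := HR (Num.truncn q).+1; rewrite -ler_pdivlMr// -/q leNgt => /negP; apply.
apply: (lt_le_trans (truncnS_gt q)).
rewrite -natrX ler_nat; apply: (@leq_trans (2 ^ (Num.truncn q).+1)).
  by rewrite ltnW// ltn_expl.
rewrite leq_exp2l//; apply: (@leq_trans (2 ^ (Num.truncn q).+1)); first by rewrite ltnW// ltn_expl.
by rewrite leq_pmull.
Qed.

End one_measure.

End spread.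

Section spread_theorem.
Context {R : realType} {n : nat}.
Local Notation X := (spacetime R n).
Local Notation leb := (@lebesgue R n).

Lemma natr_above (a : R) : exists k : nat, (0 < k)%N /\ a <= k%:R.
Proof. by exists (Num.truncn a).+1; split => //; exact/ltW/truncnS_gt. Qed.

Lemma natr_powR_above (a q : R) : 0 < q -> exists k : nat, (0 < k)%N /\ a <= k%:R `^ q.
Proof.
move=> q0; have [k [k0 Hk]] := natr_above (Num.max a 1 `^ q^-1).
have m1 : 1 <= Num.max a 1 by rewrite le_max lexx orbT.
exists k; split => //; apply: (@le_trans _ _ (Num.max a 1)); first by rewrite le_max lexx.
have -> : Num.max a 1 = (Num.max a 1 `^ q^-1) `^ q.
  by rewrite -powRrM mulVf ?gt_eqF// powRr1// (le_trans ler01).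
by apply: (ge0_ler_powR (ltW q0)); rewrite ?nnegrE ?powR_ge0.
Qed.

Lemma landing (r s t : R) : 0 < r -> s <= t ->
  exists j : nat, [/\ t <= s + j%:R * r, s + j%:R * r <= t + r & j%:R <= (t - s) / r + 1].
Proof.
move=> r0 st; exists (Num.truncn ((t - s) / r)).+1.
have H : (Num.truncn ((t - s) / r))%:R <= (t - s) / r.
  by rewrite Num.Theory.truncn_le divr_ge0 ?subr_ge0 ?(ltW r0).
have H2 : (t - s) / r < (Num.truncn ((t - s) / r)).+1%:R := truncnS_gt _.
set j := Num.truncn _ in H H2 *; rewrite -natr1 in H2 *.
move: (H) H2; rewrite ler_pdivlMr// ltr_pdivrMr// => H1 H2; split; last by rewrite lerD2r.
  by lra.
by rewrite mulrDl mul1r; lra.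
Qed.

(** At side L/M, sideways motion over a distance L takes about M/d moves and a time of order
    (M/d)(L/M)^p, that is M^(1-p) L^p up to a constant. As p > 1, a large M brings this below any
    fraction of L^p. The 12 is 3 from N <= 3M/d times 4 from the target th/4. *)
Lemma spread_constants (p A d th : R) : 1 < p -> 1 <= A -> 0 < d <= 1 -> 0 < th ->
  exists M N : nat, [/\ (0 < M)%N, (0 < N)%N, th^-1 <= M%:R, M.+1%:R <= N%:R * d
    & A * N%:R <= th * M%:R `^ p / 4].
Proof.
move=> p1 A1 /andP[d0 d1] th0.
have p10 : 0 < p - 1 by rewrite subr_gt0.
have [m0 [m00 Hm0]] := natr_powR_above (12 * A / (d * th)) p10.
have [m1 [m10 Hm1]] := natr_above th^-1.
exists (m0 * m1)%N, (Num.truncn ((m0 * m1).+1%:R / d)).+1.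
set M := (m0 * m1)%N; have M0 : (0 < M)%N by rewrite muln_gt0 m00.
have MR : 1 <= M%:R :> R by rewrite ler1n.
split => //.
- by apply: (le_trans Hm1); rewrite ler_nat leq_pmull.
- by rewrite -ler_pdivrMr//; exact/ltW/truncnS_gt.
have Mp : 12 * A / (d * th) <= M%:R `^ (p - 1).
  apply: (le_trans Hm0); apply: (ge0_ler_powR (ltW p10)); rewrite ?nnegrE//.
  by rewrite ler_nat leq_pmulr.
have N1b : (Num.truncn (M.+1%:R / d)).+1%:R <= 3 * M%:R / d.
  have H : (Num.truncn (M.+1%:R / d))%:R <= M.+1%:R / d.
    by rewrite Num.Theory.truncn_le divr_ge0// ltW.
  rewrite -[X in X <= _]natr1; apply: (@le_trans _ _ (M.+1%:R / d + 1)); first by rewrite lerD2r.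
  by rewrite ler_pdivlMr// mulrDl divfK ?gt_eqF// -natr1; lra.
apply: (@le_trans _ _ (A * (3 * M%:R / d))).
  by rewrite ler_wpM2l// (le_trans ler01).
have -> : A * (3 * M%:R / d) = th * (M%:R * (12 * A / (d * th))) / 4.
  by field; rewrite !gt_eqF.
have -> : M%:R `^ p = M%:R * M%:R `^ (p - 1) by rewrite mulr_powRB1// (lt_trans ltr01).
rewrite ler_pM2r// ler_pM2l// ler_pM2l//; exact: lt_le_trans MR.
Qed.

(** Stated in the extended reals because it is applied to integrals of powers of w, whose finiteness
    is what has to be shown. *)
Lemma box_split_le (nu : {measure set X -> \bar R}) (x : n.-tuple R) (l t h : R) N K (c : R) :
  0 < l -> 0 < h -> (0 < N)%N -> (0 < K)%N ->
  (forall (y : n.-tuple R) (s : R), (forall k, tnth x k <= tnth y k /\ tnth y k + l / N%:R <= tnth x k + l) ->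
     t <= s -> s + h / K%:R <= t + h -> (nu (box y (l / N%:R) s (h / K%:R)) <= c%:E)%E) ->
  (nu (box x l t h) <= (#|{: @idx n N K}|%:R * c)%:E)%E.
Proof.
move=> l0 h0 N0 K0 H.
have cells (i : idx N K) : (nu (@sub R n x l t h N K i) <= c%:E)%E.
  have [u1 u2] := subt_bounds t i.2 h0; apply: H => // k.
  rewrite tnth_mktuple; have NR : 0 < N%:R :> R by rewrite ltr0n.
  have : (i.1 k)%:R + 1 <= N%:R :> R by rewrite natr1 ler_nat.
  move=> /(ler_wpM2l (ltW (divr_gt0 l0 NR))); rewrite divfK ?gt_eqF// mulrDr mulr1.
  have : 0 <= l / N%:R * (i.1 k)%:R by rewrite mulr_ge0// divr_ge0// ltW.
  by clear; move=> ? ?; split; lra.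
rewrite (box_bigU x t l0 h0 N0 K0).
have H0 (s : seq (idx N K)) : (nu (\big[setU/set0]_(i <- s) @sub R n x l t h N K i) <= ((size s)%:R * c)%:E)%E.
  elim: s => [|i s IH]; first by rewrite big_nil measure0 mul0r.
  rewrite big_cons; apply: (@le_trans _ _ (nu (@sub R n x l t h N K i) + nu (\big[setU/set0]_(i <- s) @sub R n x l t h N K i))%E).
    apply: measureU2; first exact: measurable_box.
    by apply: bigsetU_measurable => k _; exact: measurable_box.
  by apply: (le_trans (leeD (cells i) IH)); rewrite -EFinD /= -natr1 mulrDl mul1r addrC.
by apply: (le_trans (H0 _)); rewrite cardE enumT.
Qed.

Lemma rm_split_le (m : {measure set X -> \bar R}) (x : n.-tuple R) l t h N K c : locfin m ->
  0 < l -> 0 < h -> (0 < N)%N -> (0 < K)%N ->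
  (forall (y : n.-tuple R) s, (forall k, tnth x k <= tnth y k /\ tnth y k + l / N%:R <= tnth x k + l) ->
     t <= s -> s + h / K%:R <= t + h -> rm m (box y (l / N%:R) s (h / K%:R)) <= c) ->
  rm m (box x l t h) <= #|{: @idx n N K}|%:R * c.
Proof.
move=> lf l0 h0 N0 K0 H; rewrite -lee_fin -(rmE lf (bm_box x l t h)).
apply: box_split_le => // y s Hy s1 s2; rewrite (rmE lf (bm_box _ _ _ _)) lee_fin; exact: H.
Qed.

(** Slices of height at most l^p are carried forward by whole multiples of l^p; the room 2 l^p in
    the target absorbs both the rounding and the height of a slice. *)
Lemma forward_into (p Cd : R) (del : R -> R) (m : {measure set X -> \bar R})
    (x : n.-tuple R) l l' s b t' h' (K J : nat) :
  1 <= Cd -> forward_RH p Cd del m -> 0 < l -> l <= l' -> 0 < b ->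
  (0 < K)%N -> b <= K%:R * l `^ p -> s + b <= t' -> (t' - s) / l `^ p + 1 <= J%:R ->
  2 * l `^ p <= h' ->
  rm m (box x l s b) <= #|{: @idx n 1 K}|%:R * (Cd ^+ J * rm m (box x l' t' h')).
Proof.
move=> Cd1 Hm l0 ll' b0 K0 bK st HJ Hh'; have [lf _ _] := Hm.
have r0 : 0 < l `^ p by rewrite powR_gt0.
have KR : 0 < K%:R :> R by rewrite ltr0n.
have Kb : b / K%:R <= l `^ p by rewrite ler_pdivrMr// mulrC.
apply: rm_split_le => // y u Hy su ub; rewrite divr1 in Hy *.
have yx k : tnth y k = tnth x k by have [? ?] := Hy k; apply/le_anti; lra.
have b'0 : 0 < b / K%:R by rewrite divr_gt0.
have ut : u <= t' by lra.
have [j [j1 j2 j3]] := landing r0 ut.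
have jJ : (j <= J)%N.
  rewrite -(ler_nat R); apply: (le_trans j3); apply: le_trans HJ; rewrite lerD2r.
  by rewrite ler_pM2r ?invr_gt0//; lra.
apply: (@le_trans _ _ (rm m (pb p y l u))).
  apply: rm_le => //; [exact: measurable_box|exact: bm_box|].
  by move=> z [z1 z2]; split => //; clear - z2 Kb; lra.
apply: (le_trans (forward_iter Cd1 Hm y u j l0)).
apply: ler_pM; rewrite ?rm_ge0 ?exprn_ge0 ?(le_trans ler01 Cd1)//.
  by rewrite ler_weXn2l.
apply: rm_le => //; [exact: measurable_box|exact: bm_box|].
move=> z [z1 z2]; split => [i|].
  by have := z1 i; rewrite yx; clear - ll'; lra.
clear - z2 j1 j2 Hh'; lra.
Qed.

(** The source is cut at a ratio M so fine that sideways motion fits in the time gap; each piece is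
    moved to the corner [x'] by [spread_chain] and then forward by [forward_into]. *)
Theorem spread (p Cd : R) (del : R -> R) (th : R) : 1 < p -> 1 <= Cd ->
  (forall eta, 0 < eta -> 0 < del eta) -> 0 < th <= 1 ->
  exists2 C : R, 0 < C & forall m : {measure set X -> \bar R}, forward_RH p Cd del m ->
    forall (x x' : n.-tuple R) (L l' t h t' h' : R), 0 < L ->
      (forall i, tnth x i <= tnth x' i <= tnth x i + L) ->
      th * L <= l' -> 0 < h -> t + h + th * L `^ p <= t' -> th * L `^ p <= h' ->
      t' + h' <= t + L `^ p / th ->
      rm m (box x L t h) <= C * rm m (box x' l' t' h').
Proof.
move=> p1 Cd1 del0 /andP[th0 th1].
have p0 : 0 < p by exact: lt_trans p1.
have [Kp [Kp0 HKp]] := natr_above (2 `^ p).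
pose eta : R := (2 * (4 * #|{: @idx n 2 Kp}|%:R))^-1.
have eta0 : 0 < eta.
  rewrite invr_gt0 !mulr_gt0// ltr0n; apply/card_gt0P.
  by exists ([ffun=> ord0], Ordinal Kp0).
have de0 := del0 _ eta0.
pose d : R := Num.min 1 (del eta / n.+1%:R).
have n1 : 0 < n.+1%:R :> R by rewrite ltr0n.
have d01 : 0 < d <= 1 by rewrite lt_min ltr01 divr_gt0// ge_min lexx.
have d0 : 0 < d by case/andP: d01.
have Hd : n%:R * d <= del eta.
  apply: (@le_trans _ _ (n.+1%:R * d)); first by rewrite ler_wpM2r ?ler_nat ?(ltW d0).
  by rewrite mulrC -ler_pdivlMr// ge_min lexx orbT.
pose A : R := 2 / (1 - 2 / 2 `^ p).
have A1 : 1 <= A.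
  have p2 : (2 : R) < 2 `^ p.
    have p10 : 0 < p - 1 by rewrite subr_gt0.
    have := gt0_ltr_powR p10 _ _ (ltr1n R 2); rewrite !nnegrE powR1 => /(_ ler01 (ler0n _ _)) H.
    by rewrite -mulr_powRB1// ltr_pMr.
  have rho1 : (2 : R) / 2 `^ p < 1 by rewrite ltr_pdivrMr ?powR_gt0// mul1r.
  have rho0 : 0 <= (2 : R) / 2 `^ p by rewrite divr_ge0 ?powR_ge0.
  rewrite ler_pdivlMr ?subr_gt0// mul1r; clear - rho0; lra.
have [M [N [M0 N0 HM HN HA]]] := spread_constants p1 A1 d01 th0.
have MR0 : 0 < M%:R :> R by rewrite ltr0n.
have B1 : 1 <= A * N%:R by rewrite mulr_ege1// ler1n.
have [K1 [K10 HK1]] := natr_above (M%:R `^ p / th).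
have [K2 [K20 HK2]] := natr_above (A * N%:R).
have [J [J0 HJ]] := natr_above (M%:R `^ p / th + 1).
exists (#|{: @idx n M K1}|%:R * (2 ^+ N * (#|{: @idx n 1 K2}|%:R * Cd ^+ J))).
  have c1 (a b : nat) : (0 < a)%N -> (0 < b)%N -> (0 : R) < #|{: @idx n a b}|%:R.
    by move=> a0 b0; rewrite ltr0n; apply/card_gt0P; exists ([ffun=> Ordinal a0], Ordinal b0).
  by rewrite !mulr_gt0 ?exprn_gt0 ?c1// (lt_le_trans ltr01).
move=> m Hm x x' L l' t h t' h' L0 xx Ll' h0 Ht Hh' Hend.
have [lfm _ _] := Hm.
pose l := L / M%:R; have l0 : 0 < l by rewrite divr_gt0.
have ll' : l <= l'.
  apply: le_trans Ll'; rewrite /l mulrC ler_wpM2r ?(ltW L0)//.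
  by rewrite -[th]invrK lef_pV2 ?posrE ?invr_gt0.
have r0 : 0 < l `^ p by rewrite powR_gt0.
have Lr : L `^ p = M%:R `^ p * l `^ p.
  by rewrite -powRM ?ltW// /l mulrC divfK// gt_eqF.
have thL : 0 < th * L `^ p by rewrite mulr_gt0// powR_gt0.
(* Sideways motion uses at most a quarter of the gap th L^p. As A N >= 1, this also gives 2 l^p <=
   h'. *)
have Br : A * N%:R * l `^ p <= th * L `^ p / 4.
  have := ler_wpM2r (ltW r0) HA; rewrite Lr; clear; lra.
have Br0 : 0 < A * N%:R * l `^ p by rewrite mulr_gt0// (lt_le_trans ltr01).
have rB : l `^ p <= A * N%:R * l `^ p by rewrite ler_peMl// ltW.
have E1 : M%:R `^ p / th * l `^ p = L `^ p / th by rewrite Lr mulrAC.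
rewrite -!mulrA; apply: rm_split_le => // y s Hy ts sh.
have h'0 : 0 < h / K1%:R by rewrite divr_gt0// ltr0n.
apply: (@le_trans _ _ (rm m (pb p y l s))).
  apply: rm_le => //; [exact: measurable_box|exact: bm_box|].
  have hK : h / K1%:R <= l `^ p.
    rewrite ler_pdivrMr ?ltr0n// mulrC; apply: (@le_trans _ _ (M%:R `^ p / th * l `^ p)).
      by rewrite E1; clear - Ht Hend thL Hh'; lra.
    by rewrite ler_pM2r.
  by move=> z [z1 z2]; split => //; clear - z2 hK; lra.
have yy i : `|tnth x' i - tnth y i| <= L.
  have [a1 a2] := Hy i; have := xx i; rewrite ler_norml -/l in a1 a2 *.
  by clear - a1 a2 l0; lra.
apply: (@le_trans _ _ (2 ^+ N * rm m (box x' l s (A * N%:R * l `^ p)))).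
  apply: (spread_chain p1 Hm s Kp0 HKp N0 d01 Hd l0 yy).
  have := ler_wpM2r (ltW l0) HN; rewrite -natr1 mulrDl mul1r mulrA.
  by rewrite [M%:R * l]mulrC divfK ?gt_eqF.
rewrite ler_wpM2l ?exprn_ge0//.
apply: (le_trans (@forward_into p Cd del m x' l l' s (A * N%:R * l `^ p) t' h' K2 J
  Cd1 Hm l0 ll' Br0 K20 _ _ _ _)) => //.
- by rewrite ler_pM2r.
- by clear - Br sh Ht thL h'0; lra.
- apply: le_trans HJ; rewrite lerD2r ler_pdivrMr// E1.
  by clear - ts Hend Hh' thL; lra.
- by clear - rB Br Hh' thL; lra.
Qed.

End spread_theorem.

(** * Weights, levels and iteration *)

Section weights.
Context {R : realType} {n : nat}.
Local Notation X := (spacetime R n).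
Local Notation leb := (@lebesgue R n).

Lemma measurable_cbox (x : n.-tuple R) (l t h : R) : measurable (cbox x l t h).
Proof.
apply: borel_lebesgue_measurable.
rewrite (_ : cbox x l t h = (\bigcap_(i in [set: 'I_n])
    ((fun y : Rn R n => tnth y i) @^-1` `[tnth x i, tnth x i + l]) : set (Rn R n)) `*`
    `[t, t + h]%classic).
  apply: measurableX => //; apply: fin_bigcap_measurable => // i _.
  by rewrite -[X in measurable X]setTI; exact: measurable_tnth.
apply/seteqP; split => z /=; rewrite in_itv/=.
  by move=> [H1 H2]; split => // i _; rewrite /= in_itv/=; exact: H1.
by move=> [H1 H2]; split => // i; have := H1 i I; rewrite /= in_itv.
Qed.

Section mass.
Variables (w : X -> R) (mw : measurable_fun setT w) (w0 : forall z, 0 <= w z).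

Definition wm : {measure set X -> \bar R} := mass_of lebesgue mw w0.

Lemma wmE E : wm E = (\int[lebesgue]_(z in E) (w z)%:E)%E. Proof. by []. Qed.

Let mwE E : measurable_fun E (fun z => (w z)%:E).
Proof. by apply: measurable_funTS; exact/measurable_EFinP. Qed.

Lemma ac_wm : ac wm.
Proof.
move=> A mA A0; rewrite wmE; apply/eqP; rewrite eq_le; apply/andP; split; last first.
  by apply: integral_ge0 => z _; rewrite lee_fin.
have := @integral_abs_eq0 _ _ _ leb A (fun z => (w z)%:E) mA (@mwE A) A0.
by under eq_integral do rewrite abse_EFin ger0_norm//; move=> ->.
Qed.

Lemma measurable_wlt c : measurable [set z | w z < c].
Proof.
rewrite (_ : [set _ | _] = setT `&` w @^-1` `]-oo, c[); first exact: mw.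
by apply/seteqP; split => z /=; rewrite in_itv/=; [split|case].
Qed.

Lemma measurable_wgt c : measurable [set z | c < w z].
Proof.
rewrite (_ : [set _ | _] = setT `&` w @^-1` `]c, +oo[); first exact: mw.
by apply/seteqP; split => z /=; rewrite in_itv/= andbT; [split|case].
Qed.

Hypothesis lf : locfin wm.

Lemma wm_ge c E : bm E -> (forall z, E z -> c <= w z) -> c * rm leb E <= rm wm E.
Proof.
move=> bE H; have [c0|c0] := ltP c 0.
  by apply: (@le_trans _ _ 0); rewrite ?rm_ge0// nmulr_rle0 ?rm_ge0.
have [mE _] := bE; rewrite -lee_fin EFinM -(rmE locfin_lebesgue bE) -(rmE lf bE) wmE.
rewrite -integral_cst//; apply: ge0_le_integral => //.
Qed.

Lemma wm_le c E : bm E -> (forall z, E z -> w z <= c) -> rm wm E <= c * rm leb E.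
Proof.
move=> bE H; have [mE _] := bE.
rewrite -lee_fin EFinM -(rmE locfin_lebesgue bE) -(rmE lf bE) wmE.
rewrite -integral_cst//; apply: ge0_le_integral => //.
by move=> z Ez; rewrite lee_fin (le_trans (w0 z))// H//.
Qed.

End mass.

Lemma locfin_wm (w : X -> R) (mw : measurable_fun setT w) (w0 : forall z, 0 <= w z) :
  weight w -> locfin (wm mw w0).
Proof.
move=> [_ _ iw _] x l t h.
have /integrableP[_] := iw _ (@compact_cbox R n x l t h).
apply: le_lt_trans; rewrite (_ : (\int[leb]_(z in _) _)%E = wm mw w0 (cbox x l t h)).
  by apply: le_measure; rewrite ?inE; [exact: measurable_box|exact: measurable_cbox|exact: box_cbox].
by rewrite wmE; apply: eq_integral => z _ /=; rewrite ger0_norm.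
Qed.

Lemma integral_box_gt0 (f : X -> R) (x : n.-tuple R) (l t h : R) : measurable_fun setT f ->
  (forall z, 0 <= f z) -> {ae leb, forall z, 0 < f z} -> 0 < l -> 0 < h ->
  (0 < \int[leb]_(z in box x l t h) (f z)%:E)%E.
Proof.
move=> mf f0 fpos l0 h0; have mB : measurable (box x l t h) by exact: measurable_box.
have mfB : measurable_fun (box x l t h) (fun z => (f z)%:E).
  by apply: measurable_funTS; exact/measurable_EFinP.
rewrite lt_neqAle eq_sym; apply/andP; split; last first.
  by apply: integral_ge0 => z _; rewrite lee_fin.
apply/negP => /eqP E0.
have : ae_eq leb (box x l t h) (fun z => (f z)%:E) (cst 0%E).
  apply/ae_eq_integral_abs => //; rewrite -[RHS]E0; apply: eq_integral => z _.
  by rewrite /= ger0_norm.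
move=> ae0; have : (leb (box x l t h) = 0)%E.
  apply/eqP; rewrite eq_le measure_ge0 andbT.
  have [N [mN N0 HN]] : leb.-negligible (box x l t h).
    apply: (negligibleS _ (negligibleU ae0 fpos)) => z Bz /=.
    have [w00|w00] := pselect (0 < f z); last by right.
    by left => /(_ Bz) /= [] E; rewrite E ltxx in w00.
  by rewrite -N0; apply: le_measure; rewrite ?inE.
rewrite lebesgue_box ?ltW// => -[] /eqP; apply/negP.
by rewrite mulf_neq0 ?gt_eqF ?exprn_gt0.
Qed.

Lemma wm_gt0 (w : X -> R) (mw : measurable_fun setT w) (w0 : forall z, 0 <= w z)
  (x : n.-tuple R) (l t h : R) : weight w -> 0 < l -> 0 < h -> 0 < rm (wm mw w0) (box x l t h).
Proof.
move=> Hw l0 h0; have lf := locfin_wm mw w0 Hw; have [_ _ _ wpos] := Hw.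
rewrite -lte_fin -(rmE lf (bm_box x l t h)) wmE; exact: integral_box_gt0.
Qed.

End weights.

Section levels.
Context {R : realType} {n : nat}.
Local Notation X := (spacetime R n).
Variables (mu nu : {measure set X -> \bar R}).
Hypotheses (lfm : locfin mu) (lfn : locfin nu).
Variables (H : nat -> set X) (c : R).
Hypotheses (mH : forall k, measurable (H k)).
Hypothesis (Hd : forall k, H k.+1 `<=` H k).

(* Pointwise, the sum of the 2^k over the k with z in H k is at most twice its largest term. *)
Lemma level_sum (m : nat) (Om : set X) : bm Om ->
  (forall k E, bm E -> E `<=` Om -> E `<=` H k -> 2 ^+ k * rm mu E <= c * rm nu E) ->
  0 <= c -> \sum_(k < m) 2 ^+ k * rm mu (Om `&` H k) <= 2 * c * rm nu Om.
Proof.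
have Hle k j : (k <= j)%N -> H j `<=` H k.
  move=> /subnKC <-; elim: (j - k)%N => [|i IH]; first by rewrite addn0.
  by rewrite addnS => z /Hd; exact: IH.
move=> + + c0; elim: m Om => [|m IH] Om bO HO.
  by rewrite big_ord0 mulr_ge0 ?rm_ge0// mulr_ge0.
(* On [H m] all the weights 2^k occur, with sum below 2^(m+1); the rest of [Om] is left to the
   induction. *)
have bD : bm (Om `\` H m) by exact: bmD.
have bI : bm (Om `&` H m) by exact: bmI.
have E k : (k <= m)%N -> rm mu (Om `&` H k) = rm mu ((Om `\` H m) `&` H k) + rm mu (Om `&` H m).
  move=> km; rewrite -rmU//; [|exact: bmI|].
    congr rm; apply/seteqP; split => [z [Oz Hz]|z [[[Oz _] Hz]|[Oz Hz]]].
    - by have [Hmz|nHmz] := pselect (H m z); [right|left].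
    - by split.
    - by split => //; exact: (Hle k m).
  by rewrite -subset0 => z [[[_ nH] _] [_ /nH]].
have S : \sum_(k < m.+1) 2 ^+ k <= 2 * 2 ^+ m :> R.
  have -> : \sum_(k < m.+1) 2 ^+ k = 2 ^+ m.+1 - 1 :> R.
    elim: m {IH HO bD bI E} => [|m IH]; first by rewrite big_ord1 expr0 expr1; ring.
    by rewrite big_ord_recr/= IH [in RHS]exprS; ring.
  by rewrite exprS lerBlDr lerDl.
have -> : \sum_(k < m.+1) 2 ^+ k * rm mu (Om `&` H k) =
    \sum_(k < m.+1) 2 ^+ k * rm mu ((Om `\` H m) `&` H k) +
    (\sum_(k < m.+1) 2 ^+ k) * rm mu (Om `&` H m).
  rewrite mulr_suml -big_split/=; apply: eq_bigr => k _.
  by rewrite (E k) ?mulrDr// -ltnS.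
rewrite big_ord_recr/= (_ : (Om `\` H m) `&` H m = set0); last first.
  by rewrite -subset0 => z [[_ nH]].
rewrite rm0 mulr0 addr0.
have I1 := IH _ bD (fun k E bE EO EH => HO k E bE (subset_trans EO (@subDsetl _ _ _)) EH).
have I2 := HO m _ bI (@subIsetl _ _ _) (@subIsetr _ _ _).
have I3 : (\sum_(k < m.+1) 2 ^+ k) * rm mu (Om `&` H m) <= 2 * (2 ^+ m * rm mu (Om `&` H m)).
  by rewrite mulrA ler_wpM2r ?rm_ge0.
have I4 := rmD lfn bO (mH m).
rewrite I4 in I1; clear - I1 I2 I3; lra.
Qed.

(* Pigeonhole: the bound in [level_sum] does not depend on m. *)
Lemma good_level (m : nat) (Om : set X) : (0 < m)%N -> bm Om -> 0 <= c ->
  (forall k E, bm E -> E `<=` Om -> E `<=` H k -> 2 ^+ k * rm mu E <= c * rm nu E) ->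
  exists2 k : nat, (k < m)%N & m%:R * (2 ^+ k * rm mu (Om `&` H k)) <= 2 * c * rm nu Om.
Proof.
move=> m0 bO c0 HO; have L := level_sum m bO HO c0.
have mR : 0 < m%:R :> R by rewrite ltr0n.
apply: contrapT => Hn.
suff : \sum_(k < m) (2 * c * rm nu Om) / m%:R < \sum_(k < m) 2 ^+ k * rm mu (Om `&` H k).
  rewrite sumr_const card_ord -[X in X < _]mulr_natr divfK ?gt_eqF// => /lt_le_trans/(_ L).
  by rewrite ltxx.
apply: ltr_sum.
  by apply/hasP; exists (Ordinal m0) => //; rewrite mem_index_enum.
move=> k _; rewrite ltr_pdivrMr// [X in _ < X]mulrC ltNge; apply/negP => Hk.
by apply: Hn; exists k.
Qed.

End levels.

(** * Iterated stopping and summation over layers *)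

Section iteration.
Context {R : realType} {n : nat}.
Local Notation X := (spacetime R n).
Local Notation leb := (@lebesgue R n).

(** Common to both directions. [G j D] is the j-th level set relative to D, and [Q] is the quantity
    halved by one stopping round. Outside the stopped boxes [G 1 D0] is null, and inside a stopped
    box level j+1 of D0 is contained in level j of that box. *)
Lemma stopping_iter (mu : {measure set X -> \bar R}) (good : pbox R n -> Prop)
    (Q : pbox R n -> R) (G : nat -> pbox R n -> set X) : locfin mu ->
  (forall j D, measurable (G j D)) ->
  (forall j D, good D -> G j.+1 D `<=` G 1%N D) ->
  (forall D, good D -> rm mu (bset D `&` G 0%N D) <= Q D) ->
  (forall D0, good D0 -> exists F : nat -> seq (pbox R n),
    [/\ forall J D, D \in F J -> good D /\ forall j, G j.+1 D0 `<=` G j D,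
        forall J D, D \in F J -> D \in F J.+1,
        forall J, \sum_(D <- F J) Q D <= 2^-1 * Q D0
      & forall A, measurable A -> A `<=` bset D0 -> A `<=` G 1%N D0 ->
          (forall J D z, D \in F J -> A z -> ~ bset D z) -> rm mu A = 0]) ->
  forall j D, good D -> rm mu (bset D `&` G j D) <= 2^-1 ^+ j * Q D.
Proof.
move=> lf mG G1 H0 Hstep; elim=> [|j IH] D0 gD; first by rewrite expr0 mul1r; exact: H0.
have [F [F1 F2 F3 F4]] := Hstep _ gD.
pose E J : set X := \big[setU/set0]_(D <- F J) bset D.
have mE J : measurable (E J) by have [] : bm (E J) by apply: bm_bigU => D _; exact: bm_bset.
have mEU : measurable (\bigcup_J E J) by exact: bigcup_measurable.
have EP J z : E J z <-> exists2 D, D \in F J & bset D z.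
  rewrite /E -bigcup_seq; split=> [[D /= DF Dz]|[D DF Dz]]; by exists D.
set A := bset D0 `&` G j.+1 D0.
have bA : bm A by apply: bmI; [exact: bm_bset|exact: mG].
have A0 : rm mu (A `\` \bigcup_J E J) = 0.
  apply: F4 => [|||J D z DF [_ nE] Dz].
  - by case: (bmD bA mEU).
  - by move=> z [[]].
  - by move=> z [[_ /(G1 _ _ gD)]].
  - by apply: nE; exists J => //; apply/EP; exists D.
have I : rm mu (\bigcup_J (A `&` E J)) <= 2^-1 ^+ j.+1 * Q D0.
  apply: rm_bigcup_le => // [J||J J' JJ'|J].
  - by apply: measurableI => //; case: bA.
  - by rewrite -setI_bigcupr; exact: bmI.
  - apply/subsetPset => z [Az /EP[D DF Dz]]; split => //; apply/EP; exists D => //.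
    by move: JJ' => /subnKC <-; elim: (J' - J)%N => [|k IHk]; rewrite ?addn0// addnS; exact: F2.
  - have AS : A `&` E J `<=` \big[setU/set0]_(D <- F J) (A `&` bset D).
      by move=> z [Az /EP[D DF Dz]]; rewrite -bigcup_seq; exists D.
    have bAD : bm (\big[setU/set0]_(D <- F J) (A `&` bset D)).
      by apply: bm_bigU => D _; apply: bmI => //; case: (bm_bset D).
    have mAE : measurable (A `&` E J) by apply: measurableI => //; case: bA.
    apply: (le_trans (rm_le lf mAE bAD AS)).
    apply: (@le_trans _ _ (\sum_(D <- F J) rm mu (A `&` bset D))).
      by apply: rm_bigU_le => // D _; apply: bmI => //; case: (bm_bset D).
    apply: (@le_trans _ _ (\sum_(D <- F J) 2^-1 ^+ j * Q D)).
      rewrite [leLHS]big_seq [leRHS]big_seq; apply: ler_sum => D DF.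
      have [gD' GD] := F1 _ _ DF; apply: le_trans (IH _ gD').
      have mAD : measurable (A `&` bset D) by case: (bmI bA (proj1 (bm_bset D))).
      apply: rm_le => //; first by apply: bmI; [exact: bm_bset|exact: mG].
      by move=> z [[_ /GD Gz] Dz].
    rewrite -mulr_sumr exprSr -mulrA ler_wpM2l ?exprn_ge0//; exact: F3.
have -> : A = (A `&` \bigcup_J E J) `|` (A `\` \bigcup_J E J) by rewrite setUIDK.
apply: (le_trans (rmU_le lf _ _)); [exact: bmI|exact: bmD|].
by rewrite A0 addr0 setI_bigcupr.
Qed.

(** The layer between G J and G J+1 has [mu] mass at most 2^-J Q and density at most K (3/2)^(J+1),
    a geometric series of ratio 3/4. With the part outside G 0 the total is K Q (1 + 6). *)
Lemma layer_bound (mu nu : {measure set X -> \bar R}) (B : set X) (G : nat -> set X) (K Q : R) :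
  locfin mu -> bm B -> 0 <= K -> 0 <= Q -> (forall j, measurable (G j)) ->
  (forall j, G j.+1 `<=` G j) ->
  (nu (B `&` \bigcap_j G j) = 0)%E ->
  (forall j E, bm E -> E `<=` B -> E `&` G j `<=` set0 ->
     (nu E <= (K * (3 / 2) ^+ j * rm mu E)%:E)%E) ->
  rm mu B <= Q ->
  (forall j, rm mu (B `&` G j) <= 2^-1 ^+ j * Q) ->
  (nu B <= (7 * K * Q)%:E)%E.
Proof.
move=> lf bB K0 Q0 mG dG n0 Hnu BQ HG.
have mB : measurable B by case: bB.
have fin J : (nu (B `\` G J) <= (K * Q * (7 - 6 * (3 / 4) ^+ J))%:E)%E.
  elim: J => [|J IH].
    apply: (le_trans (Hnu 0%N (B `\` G 0%N) _ _ _)).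
    - exact: bmD.
    - by move=> z [].
    - by move=> z [[_ h]].
    rewrite lee_fin !expr0 !mulr1.
    have : rm mu (B `\` G 0%N) <= Q.
      by apply: le_trans BQ; apply: rm_le => //; exact: measurableD.
    by move=> /(ler_wpM2l K0); clear; lra.
  have -> : B `\` G J.+1 = (B `\` G J) `|` ((B `&` G J) `\` G J.+1).
    apply/seteqP; split => z; last by move=> [[? h]|[[? ?] ?]]; split => // /dG.
    by move=> [Bz Gz]; have [?|?] := pselect (G J z); [right|left].
  have bL : bm ((B `&` G J) `\` G J.+1) by apply: bmD => //; exact: bmI.
  rewrite measureU//; last 3 first.
  - exact: measurableD.
  - by case: bL.
  - by rewrite -subset0 => z [[_ ?] [[_ ?] _]].
  have BL : (B `&` G J) `\` G J.+1 `<=` B by move=> z [[]].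
  have LG : ((B `&` G J) `\` G J.+1) `&` G J.+1 `<=` set0 by move=> z [[_ ?] ?].
  have H := Hnu J.+1 _ bL BL LG; apply: (le_trans (leeD IH H)); rewrite -EFinD lee_fin.
  have H1 : rm mu ((B `&` G J) `\` G J.+1) <= 2^-1 ^+ J * Q.
    by apply: le_trans (HG J); apply: rm_le => //; [case: bL|exact: bmI].
  have K1 : 0 <= K * (3 / 2) ^+ J.+1 by rewrite mulr_ge0// exprn_ge0// divr_ge0.
  have := ler_wpM2l K1 H1.
  have -> : K * (3 / 2) ^+ J.+1 * (2^-1 ^+ J * Q) = K * Q * (3 / 2 * (3 / 4) ^+ J).
    have -> : (3 / 4 : R) = 3 / 2 * 2^-1 by field.
    rewrite [(3 / 2 / 2) ^+ J]exprMn exprS.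
    by set a := (3 / 2) ^+ J; set b := 2^-1 ^+ J; ring.
  move=> H2; apply: (le_trans (lerD (lexx _) H2)).
  by rewrite exprS le_eqVlt; apply/orP; left; apply/eqP; field.
have E : B = (B `&` \bigcap_j G j) `|` \bigcup_j (B `\` G j).
  apply/seteqP; split => z; last by move=> [[]|[j _ []]].
  move=> Bz; have [?|nG] := pselect ((\bigcap_j G j) z); [by left|right].
  by apply: contrapT => nU; apply: nG => j _; apply: contrapT => nGj; apply: nU; exists j.
have mBG j : measurable (B `\` G j) by exact: measurableD.
have mI : measurable (B `&` \bigcap_j G j) by apply: measurableI => //; exact: bigcap_measurable.
have mU : measurable (\bigcup_j (B `\` G j)) by exact: bigcup_measurable.
rewrite E; have S : (nu ((B `&` \bigcap_j G j) `|` \bigcup_j (B `\` G j)) <=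
    nu (B `&` \bigcap_j G j) + nu (\bigcup_j (B `\` G j)))%E by exact: measureU2.
apply: (le_trans S); rewrite n0 add0e.
have nd : nondecreasing_seq (fun j => B `\` G j).
  apply/nondecreasing_seqP => j; apply/subsetPset => z [Bz nG]; split => // /dG //.
have cv := nondecreasing_cvg_mu (mu := nu) mBG mU nd.
rewrite -(cvg_lim (@ereal_hausdorff R) cv); apply: lime_le; first exact: (cvgP _ cv).
apply: nearW => J /=; apply: (le_trans (fin J)); rewrite lee_fin.
have : 0 <= K * Q * (3 / 4) ^+ J by rewrite !mulr_ge0// exprn_ge0// divr_ge0.
by clear; lra.
Qed.

(** Any bound below 2 would be beaten by the halving of the levels. Take d = 1/k with A <= 1 + k/2
    <= (3/2)^k. *)
Lemma powR_below (A : R) : 1 <= A -> exists2 d : R, 0 < d & A `^ d <= 3 / 2.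
Proof.
move=> A1; have [k [k0 Hk]] := natr_above (2 * A).
have kR : 0 < k%:R :> R by rewrite ltr0n.
exists k%:R^-1; first by rewrite invr_gt0.
have : A <= (3 / 2) ^+ k.
  apply: (@le_trans _ _ (1 + k%:R / 2)); first by lra.
  elim: k {k0 Hk kR} => [|k IH]; first by rewrite expr0; lra.
  have : 0 <= k%:R :> R by [].
  rewrite exprSr -natr1; move: IH; set u := _ ^+ k; clear; lra.
have A0 : 0 <= A by lra.
move=> H; apply: (@le_trans _ _ (((3 / 2) ^+ k) `^ k%:R^-1)).
  by apply: ge0_ler_powR; rewrite ?nnegrE ?invr_ge0 ?exprn_ge0//; lra.
by rewrite -powR_mulrn ?divr_ge0// -powRrM divff ?gt_eqF// powRr1// divr_ge0.
Qed.

End iteration.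

(** * From reverse Hoelder to Muckenhoupt *)

Section lower_levels.
Context {R : realType} {n : nat}.
Local Notation X := (spacetime R n).
Local Notation leb := (@lebesgue R n).

Section restriction.
Variables (m : {measure set X -> \bar R}) (H : set X) (mH : measurable H).

Lemma locfin_mrestr : locfin m -> locfin (mrestr m mH).
Proof.
move=> lf x l t h; apply: le_lt_trans (lf x l t h); rewrite /mrestr.
apply: le_measure; rewrite ?inE; [|exact: measurable_box|by move=> z []].
by apply: measurableI => //; exact: measurable_box.
Qed.

Lemma rm_mrestr E : rm (mrestr m mH) E = rm m (E `&` H).
Proof. by []. Qed.

End restriction.

Lemma inbox_corner (D D' : pbox R n) : 0 < bl D -> inbox D D' ->
  forall i, tnth (bx D') i <= tnth (bx D) i <= tnth (bx D') i + bl D'.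
Proof.
move=> l0 [H _ _] i; have : scube (bx D) (bl D) (bx D) by move=> j; rewrite lexx ltrDl.
by move=> /H/(_ i)/andP[-> /ltW ->].
Qed.

Lemma padm_gt0 (sg p : R) (D : pbox R n) : padm sg p D -> 0 < bl D ^+ n * bl D `^ p.
Proof. by move=> [l0 _ _ _]; rewrite mulr_gt0 ?exprn_gt0 ?powR_gt0. Qed.

Lemma rm_leb_box (x : n.-tuple R) l t h : 0 <= l -> 0 <= h -> rm leb (box x l t h) = l ^+ n * h.
Proof. by move=> l0 h0; rewrite /rm lebesgue_box. Qed.

(** It ends one radius l^p before D, which leaves the gap that [spread] requires. *)
Definition before (p : R) (D : pbox R n) : set X := pb p (bx D) (bl D) (bt D - 2 * bl D `^ p).

Definition av_before (p : R) (m : {measure set X -> \bar R}) (D : pbox R n) : R :=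
  rm m (before p D) / (bl D ^+ n * bl D `^ p).

Lemma four_powR (p : R) : 1 < p -> 4 <= 4 `^ p.
Proof. by move=> /ltW p1; rewrite -[leLHS]powRr1//; apply: ler_powR => //; lra. Qed.

(** With r the radius l^p of D, the box before a parent of side 4l ends 4^p r >= 4r before the
    parent, hence at least r before the child shifted back by 3r. That shifted child lies just ahead
    of [before p D], so one doubling step compares the two. *)
Lemma spread_before (p Cd : R) (del : R -> R) : 1 < p -> 1 <= Cd ->
  (forall eta, 0 < eta -> 0 < del eta) -> exists2 C : R, 1 <= C & forall m, forward_RH p Cd del m ->
  (forall D, padm 1 p D -> rm m (before p D) <= C * rm m (bset D)) /\
  (forall D D', padm 1 p D -> padm 1 p D' -> bl D' = 4 * bl D -> inbox D D' ->
     rm m (before p D') <= C * rm m (bset (tshift p (- 3) D))).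
Proof.
move=> p1 Cd1 del0; have q4 := four_powR p1; have q0 : 0 < 4 `^ p :> R by lra.
(* For a child of side l, th (4l)^p = l^p / 2, the smallest height that [padm 1 p] permits. *)
pose th : R := (2 * 4 `^ p)^-1.
have thE : th * 4 `^ p = 2^-1 by rewrite /th; field; rewrite gt_eqF.
have th0 : 0 < th by rewrite invr_gt0 mulr_gt0.
have th4 : th <= 4^-1 by rewrite lef_pV2 ?posrE//; lra.
have ith : th^-1 = 2 * 4 `^ p by rewrite invrK.
clearbody th.
have th01 : 0 < th <= 1 by apply/andP; split => //; lra.
have [C C0 HC] := spread (n := n) p1 Cd1 del0 th01.
exists (Num.max 1 C); first by rewrite le_max lexx.
move=> m Hm; have CC E : C * rm m E <= Num.max 1 C * rm m E.
  by rewrite ler_wpM2r ?rm_ge0// le_max lexx orbT.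
split=> [D|D D'] [l0 h0 hr rh].
  have r0 : 0 < bl D `^ p by rewrite powR_gt0.
  apply: le_trans (CC _); apply: HC => //.
  - by move=> i; rewrite lexx lerDl ltW.
  - by rewrite -[leRHS]mul1r ler_wpM2r ?ltW//; lra.
  - have : th * bl D `^ p <= 4^-1 * bl D `^ p by rewrite ler_wpM2r// ltW.
    by lra.
  - have : th * bl D `^ p <= 4^-1 * bl D `^ p by rewrite ler_wpM2r// ltW.
    by lra.
  - rewrite ith; have : 4 * bl D `^ p <= 4 `^ p * bl D `^ p by rewrite ler_wpM2r// ltW.
    by lra.
move=> [l0' h0' hr' rh'] ll' DD'.
have r0 : 0 < bl D `^ p by rewrite powR_gt0.
have rr' : bl D' `^ p = 4 `^ p * bl D `^ p by rewrite ll' powRM ?ltW.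
have [_ i1 i2] := DD'; have cor := inbox_corner l0 DD'.
have r4 : 4 * bl D `^ p <= 4 `^ p * bl D `^ p by rewrite ler_wpM2r// ltW.
have r4' : 4 `^ p * bl D `^ p <= 4 `^ p * (4 `^ p * bl D `^ p).
  by rewrite -[leLHS]mul1r ler_wpM2r ?mulr_ge0 ?ltW//; lra.
have tr : th * (4 `^ p * bl D `^ p) = 2^-1 * bl D `^ p by rewrite mulrA thE.
have bE : bt (tshift p (- 3) D) = bt D - 3 * bl D `^ p by rewrite /tshift /bt/= mulNr.
apply: le_trans (CC _); apply: HC => //=; rewrite ?rr' ?tr ?bE.
- by rewrite -[leRHS]/(bl D) ll' mulrA -[leRHS]mul1r ler_wpM2r ?(ltW l0)//; move: th4; clear; lra.
- by rewrite mulr_gt0.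
- by move: r4 i1 r0; clear; lra.
- by move: rh; clear; lra.
- rewrite ith -mulrA; rewrite rr' in hr'.
  have : 4 * (4 `^ p * bl D `^ p) <= 4 `^ p * (4 `^ p * bl D `^ p).
    by rewrite ler_wpM2r// mulr_ge0 ?ltW.
  move: r4 i1 i2 hr hr' r0 r4'; clear.
  set q : R := 4 `^ p; set r : R := bl D `^ p.
  by set t : R := bt D; set t' : R := bt D'; set h : R := bh D; set h' : R := bh D'; lra.
Qed.

End lower_levels.

Section lower_step.
Context {R : realType} {n : nat}.
Local Notation X := (spacetime R n).
Local Notation leb := (@lebesgue R n).

Lemma locfin_mscale (m : {measure set X -> \bar R}) (k : {nonneg R}) :
  locfin m -> locfin (mscale k m).
Proof.
move=> lf x l t h; rewrite /mscale; exact: lte_mul_pinfty.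
Qed.

Lemma rm_mscale (m : {measure set X -> \bar R}) (k : {nonneg R}) E : locfin m -> bm E ->
  rm (mscale k m) E = k%:num * rm m E.
Proof. by move=> lf bE; rewrite /rm /mscale fineM// bm_fin. Qed.

Lemma tshift_past_sub (p e : R) (D D0 : pbox R n) : 0 < bl D ->
  bl D `^ p <= 2 * bl D0 `^ p -> 0 <= e -> inbox D D0 ->
  bset (tshift p (- e) D) `<=`
    box (bx D0) (bl D0) (bt D0 - 2 * e * bl D0 `^ p) (bh D0 + 2 * e * bl D0 `^ p).
Proof.
move=> l0 rr e0 [I1 I2 I3] z [/I1 z1]; rewrite /tshift /bt/= -/(bt D) -/(bl D) -/(bt D0) => z2.
split => //; have r0 : 0 < bl D `^ p by rewrite powR_gt0.
have A : e * bl D `^ p <= e * (2 * bl D0 `^ p) by rewrite ler_wpM2l.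
have B : 0 <= e * bl D `^ p by rewrite mulr_ge0// ltW.
by move: A B z2 I2 I3; rewrite -/(bt D0) /bh/=; clear; lra.
Qed.

Lemma padm_inbox_powR (sg p : R) (D D0 : pbox R n) : 0 < sg -> padm sg p D -> padm sg p D0 ->
  inbox D D0 -> bl D `^ p <= 2 * bl D0 `^ p.
Proof.
move=> s0 [_ _ _ h1] [_ _ h2 _] [_ I2 I3].
have : sg * bl D `^ p <= sg * (2 * bl D0 `^ p) by move: h1 h2 I2 I3; clear; lra.
by rewrite ler_pM2l.
Qed.

Lemma lower_stopped (p Cd : R) (del : R -> R) (C : R) (m : {measure set X -> \bar R})
    (s : R) (D D' : pbox R n) : 1 < p -> forward_RH p Cd del m ->
  rm m (before p D') <= C * rm m (bset (tshift p (- 3) D)) ->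
  0 < s -> padm 1 p D -> padm 1 p D' -> bl D' = 4 * bl D -> ~ av_before p m D' < s ->
  s * (bl D ^+ n * bl D `^ p) <= C * rm m (bset (tshift p (- 3) D)) /\
  rm m (bset (tshift p (- 3) D)) <= Cd * rm m (before p D).
Proof.
move=> p1 [lf Hd _] HC s0 aD aD' ll' nS'; have [l0 h0 hr rh] := aD; split.
  apply: (le_trans _ HC).
  move: nS' => /negP; rewrite -leNgt /av_before ler_pdivlMr ?(padm_gt0 aD')//.
  apply: le_trans; rewrite ler_wpM2l ?(ltW s0)// ll'.
  have q4 := four_powR p1; have q1 : 1 <= 4 `^ p by move: q4; clear; lra.
  have k4 : 1 <= 4 ^+ n :> R by rewrite exprn_ege1//; clear; lra.
  rewrite exprMn powRM ?(ltW l0)//; apply: ler_pM; rewrite ?exprn_ge0 ?powR_ge0 ?(ltW l0)//.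
    by rewrite ler_peMl ?exprn_ge0 ?(ltW l0).
  by rewrite ler_peMl ?powR_ge0.
apply: (@le_trans _ _ (rm m (pb p (bx D) (bl D) (bt D - 3 * bl D `^ p)))).
  apply: rm_le => //; [by case: (bm_bset (tshift p (- 3) D))|exact: bm_box|].
  move=> z [z1]; rewrite /tshift /bt /bh/= => z2; split => //.
  by move: hr z2; rewrite /bt /bh; clear; lra.
apply: le_trans (Hd _ _ _ l0) _; rewrite (_ : _ + _ = bt D - 2 * bl D `^ p)//.
by ring.
Qed.

(** Where w >= s / beta, the shifted box has measure at most beta Cd |pb|, since its total mass is
    at most Cd times that of [before p D]. Absolute continuity bounds the mass there by eta m(before
    D), at most half of the mass of the shifted box. So half of that mass, and not of the volume,
    lies in the level set; 40 is this 2 times the height 20 of the star. *)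
Lemma lower_density (p Cd : R) (del : R -> R) (C s eta beta : R) (D : pbox R n)
    (w : X -> R) (mw : measurable_fun setT w) (w0 : forall z, 0 <= w z) :
  let m := wm mw w0 in forward_RH p Cd del m ->
  0 < eta -> 0 < C -> eta * C <= 2^-1 -> 0 < beta -> beta * Cd <= del eta -> 0 <= Cd ->
  0 < s -> padm 1 p D -> av_before p m D < s ->
  s * (bl D ^+ n * bl D `^ p) <= C * rm m (bset (tshift p (- 3) D)) ->
  rm leb (bset (star p D)) <=
    40 * C / s * rm m (bset (tshift p (- 3) D) `&` [set z | w z < s / beta]).
Proof.
move=> m [lf Hd HR] eta0 C0 etaC b0 bC Cd0 s0 aD aDs Hs; have [l0 h0 hr rh] := aD.
have u0 := padm_gt0 aD; set sh := bset (tshift p (- 3) D) in Hs *.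
set H := [set z | _]; have mH : measurable H by exact: measurable_wlt.
have bsh : bm sh by exact: bm_bset.
have m1 : rm m (before p D) <= s * (bl D ^+ n * bl D `^ p).
  by move: aDs; rewrite /av_before ltr_pdivrMr// => /ltW.
have tE : bt D - 3 * bl D `^ p + bl D `^ p = bt D - 2 * bl D `^ p by ring.
have shP : sh `\` H `<=` pb p (bx D) (bl D) (bt D - 3 * bl D `^ p).
  move=> z [[z1 +] _]; rewrite /tshift /bt /bh/= => z2; split => //.
  by move: hr z2; rewrite /bt /bh; clear; lra.
have bE : bm (sh `\` H) by exact: bmD.
have mE : measurable (sh `\` H) by case: bE.
have e1 : rm leb (sh `\` H) <= del eta * rm leb (pb p (bx D) (bl D) (bt D - 3 * bl D `^ p)).
  rewrite lebpb//; apply: (@le_trans _ _ (beta * Cd * (bl D ^+ n * bl D `^ p))); last first.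
    by rewrite ler_wpM2r// ltW.
  have : s / beta * rm leb (sh `\` H) <= rm m (sh `\` H).
    by apply: wm_ge => // z [_ /negP]; rewrite -leNgt.
  have : rm m (sh `\` H) <= rm m (pb p (bx D) (bl D) (bt D - 3 * bl D `^ p)).
    by apply: rm_le => //; exact: bm_box.
  have := Hd (bx D) (bl D) (bt D - 3 * bl D `^ p) l0; rewrite tE => h1 h2 h3.
  have h4 : Cd * rm m (before p D) <= Cd * (s * (bl D ^+ n * bl D `^ p)) by rewrite ler_wpM2l.
  have h5 := le_trans h3 (le_trans h2 (le_trans h1 h4)).
  have := ler_wpM2l (ltW (divr_gt0 b0 s0)) h5; set u := bl D ^+ n * _; set v := rm leb _.
  have -> : beta / s * (s / beta * v) = v by field; rewrite !gt_eqF.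
  by have -> : beta / s * (Cd * (s * u)) = beta * Cd * u by field; rewrite gt_eqF.
have e2 := HR eta _ _ _ _ eta0 l0 mE shP e1; rewrite tE in e2.
have e3 := rmD lf bsh mH; rewrite -/m in e3.
have e4 : eta * rm m (before p D) <= 2^-1 * rm m sh.
  apply: (@le_trans _ _ (eta * (C * rm m sh))).
    by rewrite ler_wpM2l ?(ltW eta0)//; exact: le_trans Hs.
  by rewrite mulrA ler_wpM2r ?rm_ge0.
have e5 : rm m sh <= 2 * rm m (sh `&` H).
  move: e2 e3 e4; rewrite -/(before p D).
  by set a := rm m sh; set b := rm m _; set c := rm m _; set d := rm m _; clear; lra.
rewrite rm_leb_box; [|exact: ltW|by rewrite mulr_ge0 ?powR_ge0].
rewrite -[bl (star p D)]/(bl D) -[bh _]/(20 * bl D `^ p).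
rewrite mulrAC ler_pdivlMr//.
have := ler_wpM2l (ltW C0) e5; move: Hs.
by set a := rm m sh; set b := rm m _; set u := bl D ^+ n; set r := bl D `^ p; clear; nra.
Qed.

(** 13 bounds |Om| / |D0|, as h0 + 6 l0^p <= 13 h0. The constant 4160 is 160 times 13, doubled to
    leave the factor 1/2. *)
Lemma lower_sum_bound (a0 s b C M X Y Z : R) k : 0 < a0 -> 0 < b -> 0 < C -> 0 < M ->
  4160 * C <= M * b -> s = a0 / 2 ^+ k.+1 -> M * (2 ^+ k * X) <= 2 * (a0 / b) * Y -> Y <= 13 * Z ->
  0 <= Z -> 40 * C / s * X <= 2^-1 * Z.
Proof.
move=> a00 b0 C0 M0 HM -> H YZ Z0; have k0 : 0 < 2 ^+ k :> R by rewrite exprn_gt0.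
rewrite -(ler_pM2l M0).
have -> : M * (40 * C / (a0 / 2 ^+ k.+1) * X) = 80 * C / a0 * (M * (2 ^+ k * X)).
  by rewrite exprS; field; rewrite !gt_eqF.
have c0 : 0 <= 80 * C / a0 by rewrite divr_ge0 ?mulr_ge0// ltW.
apply: (le_trans (ler_wpM2l c0 H)).
have -> : 80 * C / a0 * (2 * (a0 / b) * Y) = 160 * C / b * Y by field; rewrite !gt_eqF.
have c1 : 0 <= 160 * C / b by rewrite divr_ge0 ?mulr_ge0// ltW.
apply: (le_trans (ler_wpM2l c1 YZ)).
have -> : 160 * C / b * (13 * Z) = 2^-1 * Z * (4160 * C / b) by field; rewrite !gt_eqF.
have Z2 : 0 <= 2^-1 * Z by rewrite mulr_ge0.
by rewrite [leRHS]mulrC ler_wpM2l// ler_pdivrMr.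
Qed.

(* Boxes are stopped when the average of m just before them drops below 2^-(k+1) times that of D0.
   Any level k would give boxes of comparable averages; the good level makes them small in total. *)
Lemma lower_step (p Cd : R) (del : R -> R) : 1 < p -> 1 <= Cd ->
  (forall eta, 0 < eta -> 0 < del eta) ->
  exists2 A : R, 1 <= A &
    forall (w : X -> R) (mw : measurable_fun setT w) (w0 : forall z, 0 <= w z),
    let m := wm mw w0 in forward_RH p Cd del m ->
    forall D0, padm 1 p D0 -> 0 < av_before p m D0 ->
    exists F : nat -> seq (pbox R n),
    [/\ forall J D, D \in F J -> padm 1 p D /\ av_before p m D0 / A <= av_before p m D,
        forall J D, D \in F J -> D \in F J.+1,
        forall J, \sum_(D <- F J) rm leb (bset D) <= 2^-1 * rm leb (bset D0)
      & forall B, measurable B -> B `<=` bset D0 -> B `<=` [set z | w z < av_before p m D0 / A] ->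
          (forall J D z, D \in F J -> B z -> ~ bset D z) -> rm leb B = 0].
Proof.
move=> p1 Cd1 del0; have [C C1 HC] := spread_before (n := n) p1 Cd1 del0.
have C0 : 0 < C by exact: lt_le_trans C1.
have Cd0 : 0 < Cd by exact: lt_le_trans Cd1.
have [eta eta0 etaC] : exists2 eta : R, 0 < eta & eta * C <= 2^-1.
  exists (2 * C)^-1; first by rewrite invr_gt0 mulr_gt0.
  by rewrite le_eqVlt; apply/orP; left; apply/eqP; field; rewrite gt_eqF.
have [beta b0 betaE] : exists2 b : R, 0 < b & b * Cd <= del eta.
  by exists (del eta / Cd); rewrite ?divr_gt0 ?del0// divfK// gt_eqF.
have [M [M0 HM]] := natr_above (4160 * C / beta).
rewrite ler_pdivrMr// in HM.
have MR : 0 < M%:R :> R by rewrite ltr0n.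
have M2 : 1 <= 2 ^+ M :> R by rewrite exprn_ege1// ler1n.
have CC1 : 1 <= C * Cd by rewrite -[leLHS]mulr1 ler_pM.
have A1 : 1 <= 2 ^+ M * (2 * (C * Cd)).
  by rewrite -[leLHS]mulr1 ler_pM// -[leLHS]mulr1 ler_pM// ler1n.
(* 2^M covers every level k < M, C Cd is the loss between the threshold and the average of a stopped
   box, and 2 yields the contradiction in the last clause. *)
exists (2 ^+ M * (2 * (C * Cd))) => // w mw w0 m Hm D0 aD0 a0p.
have [HC1 HC2] := HC m Hm; have lf : locfin m by case: Hm.
set a0 := av_before p m D0 in a0p *.
pose H k := [set z : X | w z < a0 / 2 ^+ k.+1 / beta].
have mH k : measurable (H k) by exact: measurable_wlt.
have dH k : H k.+1 `<=` H k.
  move=> z; rewrite /H /= => /lt_le_trans; apply; rewrite ler_pM2r ?invr_gt0//.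
  by rewrite ler_pM2l// lef_pV2 ?posrE ?exprn_gt0// ler_eXn2l// ltr1n.
pose Om : set X := box (bx D0) (bl D0) (bt D0 - 2 * 3 * bl D0 `^ p) (bh D0 + 2 * 3 * bl D0 `^ p).
have bO : bm Om by exact: bm_box.
have [l00 h00 hr0 rh0] := aD0; have r00 : 0 < bl D0 `^ p by rewrite powR_gt0.
have c0 : 0 <= a0 / beta by rewrite divr_ge0// ltW.
have Hc k E : bm E -> E `<=` Om -> E `<=` H k -> 2 ^+ k * rm m E <= a0 / beta * rm leb E.
  move=> bE _ EH; have := @wm_le _ _ _ mw w0 lf (a0 / 2 ^+ k.+1 / beta) _ bE (fun z Ez => ltW (EH z Ez)).
  have k2 : 0 < 2 ^+ k :> R by rewrite exprn_gt0.
  move=> /(ler_wpM2l (ltW k2)) /le_trans; apply; rewrite mulrA ler_wpM2r ?rm_ge0//.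
  rewrite (_ : 2 ^+ k * (a0 / 2 ^+ k.+1 / beta) = 2^-1 * (a0 / beta)); last first.
    by rewrite exprS; field; rewrite !gt_eqF.
  by rewrite ler_piMl// invf_le1// ler1n.
have [k kM Hk] := @good_level R n m leb lf locfin_lebesgue H _ mH dH M Om M0 bO c0 Hc.
have kk : 2 ^+ k.+1 <= 2 ^+ M :> R by rewrite ler_eXn2l// ltr1n.
have k0 : 0 < 2 ^+ k.+1 :> R by rewrite exprn_gt0.
have [s sE] : exists s, s = a0 / 2 ^+ k.+1 by exists (a0 / 2 ^+ k.+1).
have s0 : 0 < s by rewrite sE divr_gt0.
pose S D := av_before p m D < s.
have nS0 : ~ S D0.
  rewrite /S -/a0 sE ltNge => /negP; apply; rewrite ler_pdivrMr// ler_peMr// ?ltW//.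
  by rewrite exprn_egt1// ltr1n.
have CC0 : 0 < C * Cd by rewrite mulr_gt0.
have aA : a0 / (2 ^+ M * (2 * (C * Cd))) <= s / (2 * (C * Cd)).
  rewrite ler_pdivrMr ?mulr_gt0 ?(lt_le_trans ltr01 M2)//.
  have -> : s / (2 * (C * Cd)) * (2 ^+ M * (2 * (C * Cd))) = s * 2 ^+ M.
    by field; rewrite !gt_eqF.
  by rewrite sE mulrAC ler_pdivlMr// ler_pM2l.
have [F [F1 F2 F3 F4]] := @stopping_boxes R n 1 p 4 D0 S ltr01 (lexx 1) (ltW p1) isT aD0 nS0.
exists F; split => //.
- move=> J D /F1[aD SD DD0 [D' [aD' ll' nS' DD' _]]]; split => //.
  have [K1 K2] := lower_stopped p1 Hm (HC2 _ _ aD aD' ll' DD') s0 aD aD' ll' nS'.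
  have u0 := padm_gt0 aD; apply: (le_trans aA).
  rewrite /av_before ler_pdivlMr// mulrAC ler_pdivrMr ?mulr_gt0//.
  apply: (le_trans K1); apply: (le_trans (ler_wpM2l (ltW C0) K2)).
  rewrite [leLHS]mulrA [leRHS]mulrC; apply: ler_wpM2r; first exact: rm_ge0.
  by rewrite ler_peMl ?(ltW CC0)// ler1n.
- move=> J.
  have kap0 : 0 <= 40 * C / s by rewrite divr_ge0 ?mulr_ge0 ?(ltW s0) ?(ltW C0).
  have c4 : `|- 3| <= 4 :> R by rewrite normrN ger0_norm// ler_nat.
  apply: (le_trans (F3 (40 * C / s) (- 3) (mrestr m (mH k)) Om (locfin_mrestr (mH k) lf) kap0 c4 bO _ J)).
    move=> D [aD SD DD0 [D' [aD' ll' nS' DD' _]]]; split; last first.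
      apply: tshift_past_sub => //; first by case: aD.
      exact: padm_inbox_powR ltr01 aD aD0 DD0.
    have [K1 K2] := lower_stopped p1 Hm (HC2 _ _ aD aD' ll' DD') s0 aD aD' ll' nS'.
    rewrite rm_mrestr /H -sE.
    exact: (lower_density Hm eta0 C0 etaC b0 betaE (ltW Cd0) s0 aD SD K1).
  rewrite rm_mrestr; apply: (lower_sum_bound a0p b0 C0 MR HM sE Hk); last exact: rm_ge0.
  rewrite !rm_leb_box ?(ltW l00) ?(ltW h00)//; last first.
    by rewrite addr_ge0 ?mulr_ge0 ?powR_ge0 ?(ltW h00).
  rewrite mulrCA ler_wpM2l ?exprn_ge0 ?(ltW l00)//.
  by move: rh0; clear; lra.
- move=> B mB BD BA BF.
  (* On [B] the unstopped cells give m >= (s / C) times Lebesgue measure, while w < s / (2 C) allows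
     only half of it; so [B] is null. *)
  have sC0 : 0 <= s / C by rewrite divr_ge0 ?ltW.
  have bB : bm B by exact: bmS (bm_bset D0) BD.
  have := F4 (mscale (NngNum sC0) leb) m (locfin_mscale _ locfin_lebesgue) lf (ac_wm mw w0) _ B mB BD BF.
  rewrite rm_mscale//=; last exact: locfin_lebesgue.
  have DD D : padm 1 p D -> inbox D D0 -> ~ S D ->
      rm (mscale (NngNum sC0) leb) (bset D) <= rm m (bset D).
    move=> aD DD0 /negP; rewrite /S -leNgt => sD.
    rewrite rm_mscale//=; [|exact: locfin_lebesgue|exact: bm_bset].
    have [l0 h0 hr rh] := aD; have := HC1 D aD.
    move: sD; rewrite /av_before ler_pdivlMr ?(padm_gt0 aD)// => sD sC.
    rewrite mulrAC ler_pdivrMr// [leRHS]mulrC; apply: le_trans sC; apply: le_trans sD.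
    rewrite ler_wpM2l ?(ltW s0)// rm_leb_box ?(ltW l0) ?(ltW h0)//.
    by rewrite ler_wpM2l ?exprn_ge0 ?(ltW l0)// -[leRHS]mul1r.
  move=> /(_ DD) sB.
  have Bs : rm m B <= s / (2 * C) * rm leb B.
    apply: (wm_le lf bB) => z /BA /= /ltW /le_trans; apply; apply: (le_trans aA).
    rewrite ler_pM2l// lef_pV2 ?posrE ?mulr_gt0// ler_pM2l// ler_peMr// ltW//.
  have := le_trans sB Bs; rewrite -subr_ge0 -mulrBl.
  have -> : s / (2 * C) - s / C = - (s / C / 2) by field; rewrite gt_eqF.
  rewrite mulNr oppr_ge0 pmulr_rle0 ?divr_gt0// => B0.
  by apply/le_anti; rewrite B0 rm_ge0.
Qed.

End lower_step.

(** * Integrability of a negative power *)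

Section lower_integral.
Context {R : realType} {n : nat}.
Local Notation X := (spacetime R n).
Local Notation leb := (@lebesgue R n).

Lemma measurable_wpow (w : X -> R) (d : R) : measurable_fun setT w ->
  measurable_fun setT (fun z => w z `^ d).
Proof. by move=> mw; apply: (measurableT_comp (measurable_powR _)). Qed.

Definition boxes_charged (m : {measure set X -> \bar R}) :=
  forall (x : n.-tuple R) l t h, 0 < l -> 0 < h -> 0 < rm m (box x l t h).

Lemma neg_powR_le (a b A d : R) j : 0 < a -> 0 < A -> 0 < d -> A `^ d <= 3 / 2 ->
  a / A ^+ j <= b -> (b `^ d)^-1 <= (a `^ d)^-1 * (3 / 2) ^+ j.
Proof.
move=> a0 A0 d0 dA ab; have Aj : 0 < A ^+ j by rewrite exprn_gt0.
have b0 : 0 < b by apply: lt_le_trans ab; rewrite divr_gt0.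
have : (a / A ^+ j) `^ d <= b `^ d.
  by apply: ge0_ler_powR; rewrite ?nnegrE ?(ltW d0) ?(ltW b0)// divr_ge0 ?ltW.
rewrite -(@lef_pV2 R) ?posrE ?powR_gt0 ?divr_gt0// => /le_trans; apply.
rewrite powRM ?invr_ge0 ?(ltW a0) ?(ltW Aj)// invfM ler_wpM2l ?invr_ge0 ?powR_ge0//.
have -> : ((A ^+ j)^-1 `^ d)^-1 = (A `^ d) ^+ j.
  rewrite -[(A ^+ j)^-1]powR_inv1 ?(ltW Aj)// -powRrM mulN1r powRN invrK.
  by rewrite -powR_mulrn ?(ltW A0)// powRAC powR_mulrn ?powR_ge0.
by rewrite lerXn2r ?nnegrE ?powR_ge0// divr_ge0.
Qed.

Lemma lower_integral (p Cd : R) (del : R -> R) : 1 < p -> 1 <= Cd ->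
  (forall eta, 0 < eta -> 0 < del eta) ->
  exists2 d : R, 0 < d &
    forall (w : X -> R) (mw : measurable_fun setT w) (w0 : forall z, 0 <= w z),
    let m := wm mw w0 in forward_RH p Cd del m -> boxes_charged m ->
    forall D, padm 1 p D ->
    (\int[leb]_(z in bset D) (w z `^ (- d))%:E <=
      (7 * av_before p m D `^ (- d) * rm leb (bset D))%:E)%E.
Proof.
move=> p1 Cd1 del0; have [A0 A01 HA] := lower_step (n := n) p1 Cd1 del0.
(* The ratio must be at least 2 for the levels to tend to 0, whereas [lower_step] only gives A0 >=
   1. *)
pose A := 2 * A0; have A2 : 2 <= A by rewrite /A; lra.
have A1 : 1 < A by lra.
have A0' : 0 < A by exact: lt_trans A1.
have [d d0 dA] := powR_below (ltW A1); exists d => // w mw w0 m Hm Hpos D aD.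
have avp D' : padm 1 p D' -> 0 < av_before p m D'.
  move=> aD'; have [l0 _ _ _] := aD'.
  by rewrite divr_gt0 ?(padm_gt0 aD')// Hpos ?powR_gt0.
pose G j D := [set z : X | w z < av_before p m D / A ^+ j].
have mG j D' : measurable (G j D') by exact: measurable_wlt.
have Aj j : 0 < A ^+ j by rewrite exprn_gt0.
have dG j k D' : padm 1 p D' -> (j <= k)%N -> G k D' `<=` G j D'.
  move=> /avp a0 jk z; rewrite /G /= => /lt_le_trans; apply.
  by rewrite ler_pM2l// lef_pV2 ?posrE// ler_weXn2l// ltW.
have lev := @stopping_iter R n leb (padm 1 p) (fun D => rm leb (bset D)) G locfin_lebesgue mG.
have {}lev : forall j D, padm 1 p D -> rm leb (bset D `&` G j D) <= 2^-1 ^+ j * rm leb (bset D).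
  apply: lev.
  - by move=> j D' aD'; exact: dG.
  - move=> D' _; apply: rm_le; [exact: locfin_lebesgue| |exact: bm_bset|by move=> z []].
    by case: (bmI (bm_bset D') (mG 0%N D')).
  - move=> D0 aD0; have [F [F1 F2 F3 F4]] := HA w mw w0 Hm D0 aD0 (avp _ aD0).
    have aA : av_before p m D0 / A <= av_before p m D0 / A0.
      rewrite ler_pM2l ?avp// lef_pV2 ?posrE//; last by exact: lt_le_trans A01.
      by rewrite /A ler_peMl ?(le_trans ler01 A01)// ler1n.
    exists F; split => //.
    + move=> J D' /F1[aD' aa]; split => // j z; rewrite /G /= => /lt_le_trans; apply.
      rewrite exprS invfM mulrA ler_pM2r ?invr_gt0//.
      exact: le_trans aA aa.
    + move=> B mB BD BG; apply: F4 => // z /BG; rewrite /G /= expr1 => /lt_le_trans; apply.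
      exact: aA.
have f0 z : 0 <= w z `^ (- d) by exact: powR_ge0.
have mf := measurable_wpow (- d) mw.
have a0 := avp _ aD.
rewrite -[X in (X <= _)%E]/(mass_of leb mf f0 (bset D)).
apply: (@layer_bound R n leb (mass_of leb mf f0) (bset D) (fun j => G j D)) => //.
- exact: locfin_lebesgue.
- exact: bm_bset.
- exact: powR_ge0.
- exact: rm_ge0.
- by move=> j; apply: dG.
(* In the intersection of all levels w vanishes, and there the power -d takes the default value
   0. *)
- rewrite /mass_of; apply: integral0_eq => z [_ Gz]; congr EFin.
  have -> : w z = 0; last by rewrite powR0// oppr_eq0 gt_eqF.
  apply/eqP; rewrite eq_le w0 andbT leNgt; apply/negP => wz.
  have [k [k0 Hk]] := natr_above (av_before p m D / w z).
  have := Gz k I; rewrite /G /= ltr_pdivlMr// mulrC -ltr_pdivlMr// => /lt_le_trans/(_ Hk).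
  apply/negP; rewrite -leNgt; apply: (@le_trans _ _ (2 ^+ k)).
    by rewrite -natrX ler_nat ltnW// ltn_expl.
  by rewrite lerXn2r ?nnegrE ?(ltW A0').
- move=> j E bE ED EG; rewrite /mass_of.
  have [mE _] := bE; rewrite EFinM -(rmE locfin_lebesgue bE) -integral_cst//.
  apply: (ge0_le_integral _ mE).
  + by move=> z _; rewrite lee_fin; exact: f0.
  + by apply/measurable_EFinP; exact: measurable_funTS.
  + exact: measurable_cst.
  + move=> z Ez; rewrite lee_fin !powRN.
    have wz : av_before p m D / A ^+ j <= w z.
      by rewrite leNgt; apply/negP => Gz; apply: (EG z).
    exact: (neg_powR_le a0 A0' d0 dA wz).
- by move=> j; exact: lev.
Qed.

(** Same rounding as in [adm_split], for an arbitrary initial ratio k of height to L^p; N and K are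
    independent of L. *)
Lemma adm_partition (p sg k e : R) : 0 < p -> 0 < sg -> 0 < k -> 0 < e ->
  exists N K : nat, [/\ (0 < N)%N, (0 < K)%N & forall L : R, 0 < L ->
    adm sg p (L / N%:R) (k * L `^ p / K%:R) /\ (L / N%:R) `^ p <= e * L `^ p].
Proof.
move=> p0 s0 k0 e0.
have [N [N0 HN]] := natr_powR_above (Num.max (sg / k) e^-1) p0.
have NR : 0 < N%:R :> R by rewrite ltr0n.
have Np : 0 < N%:R `^ p :> R by rewrite powR_gt0.
move: HN; rewrite ge_max => /andP[N1 N2].
have Y1 : 1 <= k * N%:R `^ p / sg by rewrite ler_pdivlMr// mul1r mulrC -ler_pdivrMr.
set Y := k * _ / _ in Y1; exists N, (Num.truncn Y).+1; split => // L L0.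
have [Y2 Y3] : Y <= (Num.truncn Y).+1%:R /\ (Num.truncn Y).+1%:R <= 2 * Y.
  split; first by apply: ltW; exact: Num.Theory.truncnS_gt.
  have : (Num.truncn Y)%:R <= Y by rewrite Num.Theory.truncn_le; lra.
  by rewrite -natr1; lra.
have r0 : 0 < L `^ p by rewrite powR_gt0.
have LN : (L / N%:R) `^ p = L `^ p / N%:R `^ p.
  by rewrite powRM ?invr_ge0 ?(ltW L0)// -powR_inv1 ?(ltW NR)// powRAC powR_inv1 ?powR_ge0.
set M : R := (Num.truncn Y).+1%:R in Y2 Y3 *; have M0 : 0 < M by rewrite ltr0n.
have kE : k = sg * Y / N%:R `^ p by rewrite /Y; field; rewrite !gt_eqF.
split; last by rewrite LN [leRHS]mulrC ler_pM2l// -[e]invrK lef_pV2 ?posrE ?invr_gt0.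
split; rewrite ?LN ?divr_gt0 ?mulr_gt0//.
- rewrite ler_pdivrMr// kE.
  have -> : sg * Y / N%:R `^ p * L `^ p = sg * (L `^ p / N%:R `^ p) * Y by field; rewrite gt_eqF.
  by rewrite ler_pM2l// mulr_gt0// divr_gt0.
- rewrite [leRHS]mulrA ler_pdivlMr// kE.
  have -> : 2 * (sg * Y / N%:R `^ p * L `^ p) = sg * (L `^ p / N%:R `^ p) * (2 * Y) by field; rewrite gt_eqF.
  by rewrite ler_pM2l// mulr_gt0// divr_gt0.
Qed.

Theorem lower_rect (p Cd : R) (del : R -> R) (g : R) : 1 < p -> 1 <= Cd ->
  (forall eta, 0 < eta -> 0 < del eta) -> 0 < g -> g < 1 ->
  exists d C : R, [/\ 0 < d, 0 < C &
    forall (w : X -> R) (mw : measurable_fun setT w) (w0 : forall z, 0 <= w z),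
    let m := wm mw w0 in forward_RH p Cd del m -> boxes_charged m ->
    forall (x : n.-tuple R) (L T : R), 0 < L ->
    (\int[leb]_(z in box x L (T + g * L `^ p) ((1 - g) * L `^ p)) (w z `^ (- d))%:E <=
      (C * (rm m (box x L (T - L `^ p) ((1 - g) * L `^ p)) / (L ^+ n * L `^ p)) `^ (- d) *
       (L ^+ n * L `^ p))%:E)%E].
Proof.
move=> p1 Cd1 del0 g0 g1; have p0 : 0 < p by exact: lt_trans p1.
have [d d0 HI] := lower_integral p1 Cd1 del0.
have k0 : 0 < 1 - g by rewrite subr_gt0.
(* The box before a cell of the future part starts two radii, at most (2/3) g L^p, before that cell,
   and so after T, with the whole lag separating it from the past part. *)
have e0 : 0 < g / 3 by rewrite divr_gt0.
have [N [K [N0 K0 HNK]]] := adm_partition p0 ltr01 k0 e0.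
have NR : 0 < N%:R :> R by rewrite ltr0n.
have Np : 0 < N%:R `^ p :> R by rewrite powR_gt0.
(* The entries are the requirements of [spread]: total duration at most 3 L^p, gap g L^p, and a
   target of side L/N and height (L/N)^p. *)
pose th : R := Num.min 3^-1 (Num.min g (Num.min N%:R^-1 (N%:R `^ p)^-1)).
have [th01 th3 thg thN thp] : [/\ 0 < th <= 1, 3 * th <= 1, th <= g, th <= N%:R^-1 & th <= (N%:R `^ p)^-1].
  rewrite /th !lt_min !ge_min !invr_gt0 g0 NR Np ltr0n/= !lexx ?orbT; split => //.
    by apply/orP; left; rewrite invf_le1// ler1n.
  by rewrite -ler_pdivlMl// mulr1 ge_min lexx.
clearbody th; have [th0 th1] := andP th01.
have [C C0 HC] := spread (n := n) p1 Cd1 del0 th01.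
pose kap : R := C / (N%:R ^+ n * N%:R `^ p).
have kap0 : 0 < kap by rewrite divr_gt0 ?mulr_gt0 ?exprn_gt0.
exists d, (#|{: @idx n N K}|%:R * (7 * kap `^ d)); split => //.
  rewrite !mulr_gt0 ?powR_gt0// ltr0n; apply/card_gt0P.
  by exists ([ffun=> Ordinal N0], Ordinal K0).
move=> w mw w0 m Hm Hpos x L T L0; set v := L ^+ n * L `^ p.
have r0 : 0 < L `^ p by rewrite powR_gt0.
have v0 : 0 < v by rewrite mulr_gt0 ?exprn_gt0.
have h0 : 0 < (1 - g) * L `^ p by rewrite mulr_gt0.
have f0 z : 0 <= w z `^ (- d) by exact: powR_ge0.
have mf := measurable_wpow (- d) mw.
rewrite -[X in (X <= _)%E]/(mass_of leb mf f0 (box x L (T + g * L `^ p) ((1 - g) * L `^ p))).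
set a := rm m _ / v; have a0 : 0 < a by rewrite divr_gt0// Hpos.
have -> : #|{: @idx n N K}|%:R * (7 * kap `^ d) * a `^ (- d) * v =
  #|{: @idx n N K}|%:R * (7 * (a / kap) `^ (- d) * v).
  rewrite (powRM _ (ltW a0)) ?invr_ge0 ?(ltW kap0)// -[kap^-1]powR_inv1 ?(ltW kap0)//.
  rewrite -powRrM mulN1r opprK; set u : R := #|{: @idx n N K}|%:R.
  by set b := a `^ _; set c := kap `^ _; clearbody u b c; clear; ring.
apply: box_split_le => // y s Hy s1 s2.
have [aD rl] := HNK L L0.
have l0 : 0 < L / N%:R by rewrite divr_gt0.
have hK0 : 0 < (1 - g) * L `^ p / K%:R by rewrite divr_gt0// ltr0n.
pose D : pbox R n := (y, L / N%:R, s, (1 - g) * L `^ p / K%:R).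
apply: (le_trans (HI w mw w0 Hm Hpos D aD)); rewrite lee_fin.
have LN : (L / N%:R) `^ p = L `^ p / N%:R `^ p.
  by rewrite powRM ?invr_ge0 ?(ltW L0)// -powR_inv1 ?(ltW NR)// powRAC powR_inv1 ?powR_ge0.
have lv : (L / N%:R) ^+ n * (L / N%:R) `^ p = v / (N%:R ^+ n * N%:R `^ p).
  by rewrite LN expr_div_n /v; field; rewrite !gt_eqF// exprn_gt0.
have aD' : a / kap <= av_before p m D.
  have Hs : rm m (box x L (T - L `^ p) ((1 - g) * L `^ p)) <= C * rm m (before p D).
    apply: HC; rewrite -?[bl D]/(L / N%:R) -?[bt D]/s //.
    - by move=> i; have := Hy i; move: l0; clear; lra.
    - by rewrite mulrC ler_pM2l.
    - have gL : 0 < g * L `^ p by rewrite mulr_gt0.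
      have : th * L `^ p <= g * L `^ p by rewrite ler_pM2r.
      by move: s1 rl gL; clear; lra.
    - by rewrite LN mulrC ler_pM2l.
    - have : 3 * L `^ p <= L `^ p / th by rewrite ler_pdivlMr// mulrAC ler_piMl// ltW.
      have : 0 < (L / N%:R) `^ p by rewrite powR_gt0.
      by move: s2 hK0 r0; clear; lra.
  rewrite /av_before -[bl D]/(L / N%:R) lv /a /kap.
  set Q : R := N%:R ^+ n * N%:R `^ p; have Q0 : 0 < Q by rewrite mulr_gt0 ?exprn_gt0.
  have -> : rm m (before p D) / (v / Q) = C * rm m (before p D) * (Q / (v * C)).
    by field; rewrite !gt_eqF.
  have -> : rm m (box x L (T - L `^ p) ((1 - g) * L `^ p)) / v / (C / Q) =
    rm m (box x L (T - L `^ p) ((1 - g) * L `^ p)) * (Q / (v * C)) by field; rewrite !gt_eqF.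
  apply: ler_wpM2r Hs; apply: divr_ge0; first exact: ltW.
  by apply: mulr_ge0; exact: ltW.
have Dv : rm leb (bset D) <= v.
  rewrite rm_leb_box ?(ltW l0) ?(ltW hK0)//.
  have N1 : 1 <= N%:R :> R by rewrite ler1n.
  have K1 : 1 <= K%:R :> R by rewrite ler1n.
  apply: ler_pM; rewrite ?exprn_ge0 ?(ltW l0) ?(ltW hK0)//.
    by rewrite lerXn2r ?nnegrE ?(ltW l0) ?(ltW L0)// ler_pdivrMr// ler_peMr ?(ltW L0).
  rewrite ler_pdivrMr ?(lt_le_trans ltr01 K1)// mulrC ler_pM2l//.
  by apply: le_trans K1; rewrite gerBl ltW.
have aDp : 0 < av_before p m D by apply: (lt_le_trans _ aD'); exact: divr_gt0.
apply: ler_pM => //; rewrite ?rm_ge0 ?mulr_ge0 ?powR_ge0//.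
have ak0 : 0 < a / kap by exact: divr_gt0.
rewrite ler_pM2l// !powRN lef_pV2 ?posrE; [|exact: powR_gt0|exact: powR_gt0].
by apply: ge0_ler_powR; rewrite ?nnegrE ?(ltW d0) ?(ltW aDp)// divr_ge0 ?(ltW a0) ?(ltW kap0).
Qed.

End lower_integral.

(** * From Muckenhoupt to reverse Hoelder *)

Section upper_levels.
Context {R : realType} {n : nat}.
Local Notation X := (spacetime R n).
Local Notation leb := (@lebesgue R n).

(* The threshold 4 leaves room for the factor 2 of [adm] and for a set filling half of a box. *)
Definition backward_A (p g C : R) (m : {measure set X -> \bar R}) :=
  locfin m /\ forall (x : n.-tuple R) L t E, 0 < L -> measurable E ->
    E `<=` box x L (t + (1 + g) * L `^ p) ((1 - g) * L `^ p) ->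
    rm leb (box x L t ((1 - g) * L `^ p)) <= 4 * rm leb E ->
    rm m (box x L t ((1 - g) * L `^ p)) <= C * rm m E.

Lemma leb_bset (D : pbox R n) : 0 < bl D -> 0 < bh D -> rm leb (bset D) = bl D ^+ n * bh D.
Proof. by move=> l0 h0; rewrite rm_leb_box ?ltW. Qed.

Lemma backward_half (p g C : R) (m : {measure set X -> \bar R}) (D : pbox R n) E :
  backward_A p g C m -> padm (1 - g) p D -> measurable E ->
  E `<=` bset (tshift p (1 + g) D) -> rm leb (bset D) <= 2 * rm leb E ->
  rm m (bset D) <= C * rm m E.
Proof.
move=> [lf H] [l0 h0 hr rh] mE ED DE.
have r0 : 0 < bl D `^ p by rewrite powR_gt0.
have s0 : 0 < (1 - g) * bl D `^ p by exact: lt_le_trans hr.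
apply: (@le_trans _ _ (rm m (box (bx D) (bl D) (bt D) ((1 - g) * bl D `^ p)))).
  apply: rm_le => //; [exact: measurable_box|exact: bm_box|].
  by move=> z [z1 z2]; split => //; move: z2 hr; clear; lra.
apply: H => //.
  move=> z /ED [z1]; rewrite /tshift /bt /bh/= => z2; split => //.
  by move: z2 hr; rewrite /bt /bh; clear; lra.
rewrite leb_bset// in DE; rewrite rm_leb_box ?(ltW l0) ?(ltW s0)//.
have := ler_wpM2l (exprn_ge0 n (ltW l0)) rh.
by move: DE; set u := bl D ^+ n; set h := bh D; set r := bl D `^ p; clearbody u h r; clear; lra.
Qed.

Lemma tshiftD (p c e : R) (D : pbox R n) : tshift p c (tshift p e D) = tshift p (e + c) D.
Proof. by rewrite /tshift /bt/= mulrDl addrA. Qed.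

Definition after (p g : R) (D : pbox R n) : set X := bset (tshift p (1 + g) D).

Definition av_after (p g : R) (m : {measure set X -> \bar R}) (D : pbox R n) : R :=
  rm m (after p g D) / rm leb (bset D).

Lemma leb_bset_gt0 sg p (D : pbox R n) : padm sg p D -> 0 < rm leb (bset D).
Proof. by move=> [l0 h0 _ _]; rewrite leb_bset// mulr_gt0 ?exprn_gt0. Qed.

Lemma backward_after (p g C : R) (m : {measure set X -> \bar R}) (D : pbox R n) :
  backward_A p g C m -> padm (1 - g) p D -> rm m (bset D) <= C * rm m (after p g D).
Proof.
move=> Hm aD; apply: (backward_half Hm aD) => //; first by case: (bm_bset (tshift p (1 + g) D)).
have [l0 h0 _ _] := aD; rewrite leb_bset// [leRHS]mulrC -[rm leb (after p g D)]/(rm leb (bset (tshift p (1 + g) D))) leb_bset//.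
rewrite -[bl (tshift p (1 + g) D)]/(bl D) -[bh (tshift p (1 + g) D)]/(bh D).
by rewrite ler_peMr ?mulr_ge0 ?exprn_ge0 ?ltW// ltr1n.
Qed.

(** The enlarged box is covered by [D] and its translate by [e]. The later box of the translate
    sticks out of [after p g D]; the part [E] inside is at least half of it, as 2e <= h, and this
    suffices for the A condition. *)
Lemma backward_enlarged (p g C e : R) (m : {measure set X -> \bar R}) (D : pbox R n) :
  backward_A p g C m -> padm (1 - g) p D -> 0 < C -> 0 <= e -> 2 * e <= bh D ->
  rm m (box (bx D) (bl D) (bt D) (bh D + e)) <= 2 * C * rm m (after p g D).
Proof.
move=> Hm aD C0 e0 eh; have [lf _] := Hm; have [l0 h0 hr rh] := aD.
pose D2 : pbox R n := (bx D, bl D, bt D + e, bh D).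
have aD2 : padm (1 - g) p D2 by [].
pose E := box (bx D) (bl D) (bt D + e + (1 + g) * bl D `^ p) (bh D - e).
have S1 : box (bx D) (bl D) (bt D) (bh D + e) `<=` bset D `|` bset D2.
  move=> z [z1 /andP[z2 z3]]; have [z4|z4] := ltP z.2 (bt D + bh D).
    by left; split => //; rewrite z2.
  right; split => //; rewrite /D2 /bt /bh/= -/(bt D) -/(bh D).
  by move: z3 z4 eh e0 h0; clear; lra.
have bU : bm (bset D `|` bset D2) by apply: bmU; exact: bm_bset.
apply: (le_trans (rm_le lf (measurable_box _ _ _ _) bU S1)).
apply: (le_trans (rmU_le lf (bm_bset D) (bm_bset D2))).
have H1 := backward_after Hm aD.
have H2 : rm m (bset D2) <= C * rm m E.
  apply: (backward_half Hm aD2); first exact: measurable_box.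
    move=> z [z1 z2]; split => //; rewrite /tshift /D2 /bt /bh /bl/= -/(bt D) -/(bl D) -/(bh D).
    by move: z2 e0; clear; lra.
  rewrite leb_bset// -[bl D2]/(bl D) -[bh D2]/(bh D) rm_leb_box ?(ltW l0)//; last first.
    by move: eh h0; clear; lra.
  rewrite mulrCA ler_wpM2l ?exprn_ge0 ?(ltW l0)//.
  by move: eh; clear; lra.
have H3 : rm m E <= rm m (after p g D).
  apply: rm_le => //; [exact: measurable_box|exact: bm_bset|].
  move=> z [z1 z2]; split => //; rewrite /tshift /bt /bh /bl/= -/(bt D) -/(bl D) -/(bh D).
  by move: z2 e0; clear; lra.
have H4 := ler_wpM2l (ltW C0) H3.
by move: H1 H2 H4; clear; lra.
Qed.

(** If w <= beta s on more than half of the twice shifted box, the A condition bounds the mass of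
    [after p g D] by C beta s |D| <= s |D|, against the stopping rule. The 80 is 20 from the star, 2
    from the half and 2 from [adm]. *)
Lemma upper_density (p g C s beta : R) (D : pbox R n)
    (w : X -> R) (mw : measurable_fun setT w) (w0 : forall z, 0 <= w z) :
  let m := wm mw w0 in backward_A p g C m -> padm (1 - g) p D -> g < 1 ->
  0 < C -> 0 < beta -> C * beta <= 1 -> 0 < s -> s < av_after p g m D ->
  rm leb (bset (star p D)) <=
    80 / (1 - g) * rm leb (bset (tshift p (2 * (1 + g)) D) `&` [set z | beta * s < w z]).
Proof.
move=> m Hm aD g1 C0 b0 Cb s0; have [lf _] := Hm; have [l0 h0 hr rh] := aD.
have v0 := leb_bset_gt0 aD; have sg0 : 0 < 1 - g by rewrite subr_gt0.
rewrite /av_after ltr_pdivlMr// => sD.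
set H := [set z | _]; have mH : measurable H by exact: measurable_wgt.
have E2 : 2 * (1 + g) = (1 + g) + (1 + g) by ring.
set P2 := bset (tshift p (2 * (1 + g)) D); have bP : bm P2 by exact: bm_bset.
have P2E : rm leb P2 = rm leb (bset D) by rewrite /P2 !leb_bset.
have half : rm leb P2 <= 2 * rm leb (P2 `&` H).
  have := rmD locfin_lebesgue bP mH; set E := P2 `\` H => EE.
  rewrite leNgt; apply/negP => lt.
  have bE : bm E by exact: bmD.
  have H1 : rm m (after p g D) <= C * rm m E.
    apply: (@backward_half p g C m (tshift p (1 + g) D) E Hm).
    - exact: aD.
    - by case: bE.
    - by rewrite tshiftD -E2; move=> z [].
    - rewrite leb_bset// -[_ * bh _]/(bl D ^+ n * bh D) -leb_bset// -P2E.
      by move: EE lt; clear; lra.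
  have H2 : rm m E <= beta * s * rm leb E.
    by apply: (wm_le lf bE) => z [_ /negP]; rewrite -leNgt.
  have H3 : rm leb E <= rm leb (bset D).
    rewrite -P2E; apply: rm_le => //; [exact: locfin_lebesgue|by case: bE|by move=> z []].
  have H4 : rm m E <= beta * s * rm leb (bset D).
    by apply: (le_trans H2); rewrite ler_wpM2l// mulr_ge0 ?ltW.
  have : C * (beta * s * rm leb (bset D)) <= s * rm leb (bset D).
    by rewrite !mulrA -mulrA ler_piMl// mulr_ge0 ?ltW.
  have := le_trans H1 (ler_wpM2l (ltW C0) H4); move: sD.
  by set a := rm m _; set b := C * _; set c := s * _; clear; lra.
rewrite rm_leb_box ?(ltW l0)//; last by rewrite mulr_ge0 ?powR_ge0.
rewrite -[bl (star p D)]/(bl D) -[bh _]/(20 * bl D `^ p) mulrAC ler_pdivlMr//.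
move: half; rewrite P2E leb_bset//; have := ler_wpM2l (exprn_ge0 n (ltW l0)) rh.
set u := bl D ^+ n; set r := bl D `^ p; set h := bh D; set k := rm leb _; set g' := 1 - g.
clearbody u r h k g'; clear; lra.
Qed.

(** All shifts in use are at most 2(1+g) < 4 radii. With N^p >= 16/(1-g), a shifted child leaves its
    parent, hence D0, by at most half of the height, the range of [backward_enlarged]. *)
Lemma child_height (p g : R) (N : nat) (D D' D0 : pbox R n) : g < 1 ->
  16 / (1 - g) <= N%:R `^ p -> padm (1 - g) p D -> padm (1 - g) p D' ->
  bl D' = N%:R * bl D -> bt D0 <= bt D' -> bt D' + bh D' <= bt D0 + bh D0 ->
  4 * bl D `^ p <= bh D0 / 2.
Proof.
move=> g1 HN [l0 _ _ _] [_ _ _ rh'] ll' t1 t2.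
have sg0 : 0 < 1 - g by rewrite subr_gt0.
have r0 : 0 < bl D `^ p by rewrite powR_gt0.
rewrite ll' powRM ?(ltW l0)// in rh'; rewrite ler_pdivrMr// in HN.
have := ler_wpM2r (ltW r0) HN; move: rh' t1 t2.
by set q := N%:R `^ p; set r := bl D `^ p; clearbody q r; clear; lra.
Qed.

(** [after p g D] lies in the parent enlarged upwards by half its height, of mass at most 2C m(after
    D'); the rest of the constant is the volume ratio N^n (2 N^p). *)
Lemma upper_stopped (p g C s : R) (N : nat) (m : {measure set X -> \bar R}) (D D' : pbox R n) :
  backward_A p g C m -> 0 < g -> g < 1 -> 0 < C -> 0 <= s -> 16 / (1 - g) <= N%:R `^ p ->
  padm (1 - g) p D -> padm (1 - g) p D' -> bl D' = N%:R * bl D -> inbox D D' ->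
  ~ s < av_after p g m D' ->
  rm m (after p g D) <= 4 * C * N%:R ^+ n * N%:R `^ p * s * rm leb (bset D).
Proof.
move=> Hm g0 g1 C0 s0 HN aD aD' ll' DD' nS; have [lf _] := Hm.
have ch := child_height g1 HN aD aD' ll' (lexx _) (lexx _).
have [l0 h0 hr rh] := aD; have [l0' h0' hr' rh'] := aD'; have [D1 D2 D3] := DD'.
have r0 : 0 < bl D `^ p by rewrite powR_gt0.
have gr : g * bl D `^ p <= bl D `^ p by rewrite ler_piMl ?(ltW r0) ?(ltW g1).
have gr0 : 0 <= g * bl D `^ p by rewrite mulr_ge0 ?ltW.
apply: (@le_trans _ _ (rm m (box (bx D') (bl D') (bt D') (bh D' + bh D' / 2)))).
  apply: rm_le => //; [by case: (bm_bset (tshift p (1 + g) D))|exact: bm_box|].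
  move=> z [/D1 z1 z2]; split => //; move: z2; rewrite /tshift /bt /bh /bl/= -/(bt D) -/(bl D) -/(bh D).
  rewrite -/(bt D') -/(bh D'); move: ch gr gr0 D2 D3 r0; clear; lra.
have h2 : 0 <= bh D' / 2 by rewrite divr_ge0// ltW.
have h2' : 2 * (bh D' / 2) <= bh D' by rewrite mulrC divfK.
apply: (le_trans (backward_enlarged Hm aD' C0 h2 h2')).
have mD' : rm m (after p g D') <= s * rm leb (bset D').
  by move: nS => /negP; rewrite -leNgt /av_after ler_pdivrMr// (leb_bset_gt0 aD').
have C2 : 0 <= 2 * C by rewrite mulr_ge0// ltW.
apply: (le_trans (ler_wpM2l C2 mD')).
have q0 : 0 <= N%:R `^ p :> R by exact: powR_ge0.
have -> : 4 * C * N%:R ^+ n * N%:R `^ p * s * rm leb (bset D) =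
  2 * C * (s * (N%:R ^+ n * (2 * N%:R `^ p) * rm leb (bset D))) by ring.
have hh : bh D' <= 2 * N%:R `^ p * bh D.
  rewrite ll' powRM ?(ltW l0)// in hr'; have := ler_wpM2l q0 rh; move: hr'.
  by set q := N%:R `^ p; set r := bl D `^ p; clear; lra.
rewrite ler_wpM2l// ler_wpM2l// !leb_bset// ll' exprMn.
have -> : N%:R ^+ n * (2 * N%:R `^ p) * (bl D ^+ n * bh D) =
  N%:R ^+ n * bl D ^+ n * (2 * N%:R `^ p * bh D) by ring.
by rewrite ler_wpM2l ?mulr_ge0 ?exprn_ge0 ?(ltW l0).
Qed.

Lemma upper_sum_bound (a0 s sg C K M X Y Z V W : R) k : 0 < a0 -> 0 < sg -> 0 < C -> 0 < K -> 0 < M ->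
  1280 * (K * C * C) <= M * sg -> s = 2 ^+ k.+1 * a0 ->
  M * (2 ^+ k * X) <= 2 * (C / a0) * Y -> Y <= 2 * C * Z -> 0 <= Z -> V <= 80 / sg * X ->
  W <= K * s * V -> W <= 2^-1 * Z.
Proof.
move=> a00 s0 C0 K0 M0 HM -> H YZ Z0 VX WV; have k0 : 0 < 2 ^+ k :> R by rewrite exprn_gt0.
apply: (le_trans WV); rewrite -(ler_pM2l M0).
have ks : 0 <= K * (2 ^+ k.+1 * a0) by rewrite !mulr_ge0 ?exprn_ge0 ?(ltW K0) ?(ltW a00).
have Mks : 0 <= M * (K * (2 ^+ k.+1 * a0)) by rewrite mulr_ge0// ltW.
rewrite [leLHS]mulrA; apply: (le_trans (ler_wpM2l Mks VX)).
have -> : M * (K * (2 ^+ k.+1 * a0)) * (80 / sg * X) = 160 * K * a0 / sg * (M * (2 ^+ k * X)).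
  by rewrite exprS; field; rewrite gt_eqF.
have c0 : 0 <= 160 * K * a0 / sg by rewrite divr_ge0 ?mulr_ge0 ?(ltW K0) ?(ltW a00) ?(ltW s0).
have c1 : 0 <= C / a0 by rewrite divr_ge0 ?(ltW C0) ?(ltW a00).
have H2 : 2 * (C / a0) * Y <= 2 * (C / a0) * (2 * C * Z) by rewrite ler_wpM2l// mulr_ge0.
apply: (le_trans (ler_wpM2l c0 (le_trans H H2))).
have -> : 160 * K * a0 / sg * (2 * (C / a0) * (2 * C * Z)) = 2^-1 * Z * (1280 * (K * C * C) / sg).
  by field; rewrite !gt_eqF.
by rewrite [leRHS]mulrC ler_wpM2l ?mulr_ge0// ler_pdivrMr.
Qed.

Lemma upper_step (p g C : R) : 1 < p -> 0 < g -> g < 1 -> 1 <= C ->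
  exists2 A : R, 2 <= A &
    forall (w : X -> R) (mw : measurable_fun setT w) (w0 : forall z, 0 <= w z),
    let m := wm mw w0 in backward_A p g C m ->
    forall D0, padm (1 - g) p D0 -> 0 < av_after p g m D0 ->
    exists F : nat -> seq (pbox R n),
    [/\ forall J D, D \in F J -> padm (1 - g) p D /\ av_after p g m D <= A * av_after p g m D0,
        forall J D, D \in F J -> D \in F J.+1,
        forall J, \sum_(D <- F J) rm m (after p g D) <= 2^-1 * rm m (after p g D0)
      & forall B, measurable B -> B `<=` bset D0 -> B `<=` [set z | A * av_after p g m D0 < w z] ->
          (forall J D z, D \in F J -> B z -> ~ bset D z) -> rm m B = 0].
Proof.
move=> p1 g0 g1 C1; have C0 : 0 < C by exact: lt_le_trans C1.
have p0 : 0 < p by exact: lt_trans p1.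
have sg0 : 0 < 1 - g by rewrite subr_gt0.
have sg1 : 1 - g <= 1 by rewrite gerBl ltW.
have [N [N0 HN]] := natr_powR_above (16 / (1 - g)) p0.
have N1 : (1 < N)%N.
  rewrite ltn_neqAle N0 andbT; apply/eqP => N1; move: HN; rewrite -N1 powR1 ler_pdivrMr// mul1r.
  by move: sg1; clear; lra.
have NR : 0 < N%:R :> R by rewrite ltr0n.
have Nn : 1 <= N%:R ^+ n :> R by rewrite exprn_ege1// ler1n.
have Np : 1 <= N%:R `^ p :> R.
  by rewrite -[leLHS](powRr0 N%:R) ler_powR ?ler1n// ltW.
have [K KE] : exists K : R, K = 4 * C * N%:R ^+ n * N%:R `^ p by eexists.
have K4 : 4 * C <= K.
  rewrite KE -mulrA -[leLHS]mulr1 ler_pM2l ?mulr_gt0//.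
  by rewrite -[leLHS]mulr1 ler_pM.
have K0 : 0 < K by apply: lt_le_trans K4; rewrite mulr_gt0.
have [M [M0 HM]] := natr_above (1280 * (K * C * C) / (1 - g)).
rewrite ler_pdivrMr// in HM.
have MR : 0 < M%:R :> R by rewrite ltr0n.
have M2 : 1 <= 2 ^+ M :> R by rewrite exprn_ege1// ler1n.
have M20 : 0 < 2 ^+ M :> R by rewrite exprn_gt0.
exists (2 ^+ M * K).
  by rewrite -[leLHS]mul1r ler_pM//; move: K4 C1; clear; lra.
move=> w mw w0 m Hm D0 aD0 a0p; have [lf _] := Hm.
set a0 := av_after p g m D0 in a0p *.
have b0 : 0 < C^-1 by rewrite invr_gt0.
have Cb : C * C^-1 <= 1 by rewrite divff// gt_eqF.
pose H k := [set z : X | C^-1 * (2 ^+ k.+1 * a0) < w z].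
have mH k : measurable (H k) by exact: measurable_wgt.
have dH k : H k.+1 `<=` H k.
  move=> z; rewrite /H /=; apply: le_lt_trans.
  by rewrite ler_pM2l// ler_pM2r// ler_eXn2l// ltr1n.
pose Om : set X := box (bx D0) (bl D0) (bt D0) (bh D0 + bh D0 / 2).
have bO : bm Om by exact: bm_box.
have [l00 h00 hr0 rh0] := aD0; have r00 : 0 < bl D0 `^ p by rewrite powR_gt0.
have c0 : 0 <= C / a0 by rewrite divr_ge0// ltW.
have Hc k E : bm E -> E `<=` Om -> E `<=` H k -> 2 ^+ k * rm leb E <= C / a0 * rm m E.
  move=> bE _ EH.
  have := @wm_ge _ _ _ mw w0 lf (C^-1 * (2 ^+ k.+1 * a0)) _ bE (fun z Ez => ltW (EH z Ez)).
  move=> /(ler_wpM2l c0); apply: le_trans.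
  have -> : C / a0 * (C^-1 * (2 ^+ k.+1 * a0) * rm leb E) = 2 * (2 ^+ k * rm leb E).
    by rewrite exprS; field; rewrite !gt_eqF.
  by rewrite ler_peMl ?mulr_ge0 ?exprn_ge0 ?rm_ge0// ler1n.
have [k kM Hk] := @good_level R n leb m locfin_lebesgue lf H _ mH dH M Om M0 bO c0 Hc.
have kk : 2 ^+ k.+1 <= 2 ^+ M :> R by rewrite ler_eXn2l// ltr1n.
have k0 : 0 < 2 ^+ k.+1 :> R by rewrite exprn_gt0.
have [s sE] : exists s, s = 2 ^+ k.+1 * a0 by eexists.
have s0 : 0 < s by rewrite sE mulr_gt0.
have sA : K * s <= 2 ^+ M * K * a0.
  rewrite sE mulrCA -[leRHS]mulrA; apply: ler_wpM2r => //.
  by rewrite mulr_ge0 ?(ltW K0) ?(ltW a0p).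
pose S D := s < av_after p g m D.
have nS0 : ~ S D0.
  rewrite /S -/a0 sE ltNge => /negP; apply; rewrite ler_peMl ?(ltW a0p)//.
  by rewrite exprn_ege1// ler1n.
have [F [F1 F2 F3 F4]] := @stopping_boxes R n (1 - g) p N D0 S sg0 sg1 (ltW p1) N1 aD0 nS0.
exists F; split => //.
- move=> J D /F1[aD SD DD0 [D' [aD' ll' nS' DD' _]]]; split => //.
  have := upper_stopped Hm g0 g1 C0 (ltW s0) HN aD aD' ll' DD' nS'; rewrite -KE => /le_trans Q.
  rewrite /av_after ler_pdivrMr ?(leb_bset_gt0 aD)//; apply: Q.
  by rewrite ler_wpM2r ?rm_ge0.
- move=> J.
  have kap0 : 0 <= 80 / (1 - g) by rewrite divr_ge0 ?(ltW sg0).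
  have c4 : `|2 * (1 + g)| <= 4 by rewrite ger0_norm; move: g0 g1; clear; lra.
  have VX := F3 (80 / (1 - g)) (2 * (1 + g)) (mrestr leb (mH k)) Om
    (locfin_mrestr (mH k) locfin_lebesgue) kap0 c4 bO _ J.
  have h2 : 0 <= bh D0 / 2 by rewrite divr_ge0// ltW.
  have h2' : 2 * (bh D0 / 2) <= bh D0 by rewrite mulrC divfK.
  have OZ := backward_enlarged Hm aD0 C0 h2 h2'.
  apply: (upper_sum_bound a0p sg0 C0 K0 MR HM sE Hk OZ (rm_ge0 _ _) (VX _)).
    move=> D [aD SD DD0 [D' [aD' ll' nS' DD' [D'0 D'1 D'2]]]]; split.
      by rewrite rm_mrestr /H -sE; exact: (upper_density Hm aD g1 C0 b0 Cb s0 SD).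
    have [D1 D2 D3] := DD0; have ch := child_height g1 HN aD aD' ll' D'1 D'2.
    have [l0 h0 _ _] := aD; have r0 : 0 < bl D `^ p by rewrite powR_gt0.
    have gr : g * bl D `^ p <= bl D `^ p by rewrite ler_piMl ?(ltW r0) ?(ltW g1).
    have gr0 : 0 <= g * bl D `^ p by rewrite mulr_ge0 ?ltW.
    move=> z [/D1 z1 z2]; split => //; move: z2; rewrite /tshift /bt /bh /bl/= -/(bt D) -/(bl D) -/(bh D).
    by rewrite -/(bt D0) -/(bh D0); move: ch gr gr0 D2 D3; clear; lra.
  rewrite mulr_sumr [leLHS]big_seq [leRHS]big_seq; apply: ler_sum => D.
  move=> /F1[aD SD DD0 [D' [aD' ll' nS' DD' _]]]; rewrite KE.
  exact: upper_stopped Hm g0 g1 C0 (ltW s0) HN aD aD' ll' DD' nS'.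
- move=> B mB BD BA BF.
  (* On [B] the unstopped cells give m <= C s times Lebesgue measure, while w > 2 C s there; so [B]
     is null. *)
  have sC0 : 0 <= C * s by rewrite mulr_ge0 ?ltW.
  have bB : bm B by exact: bmS (bm_bset D0) BD.
  have aac : ac (mscale (NngNum sC0) leb).
    by move=> Y mY Y0; rewrite /mscale -[RHS](mule0 (C * s)%:E); congr (_ * _)%E.
  have := F4 m (mscale (NngNum sC0) leb) lf (locfin_mscale _ locfin_lebesgue) aac _ B mB BD BF.
  rewrite rm_mscale//=; last exact: locfin_lebesgue.
  have DD D : padm (1 - g) p D -> inbox D D0 -> ~ S D ->
      rm m (bset D) <= rm (mscale (NngNum sC0) leb) (bset D).
    move=> aD DD0 /negP; rewrite /S -leNgt => sD.
    rewrite rm_mscale//=; [|exact: locfin_lebesgue|exact: bm_bset].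
    apply: (le_trans (backward_after Hm aD)); rewrite -mulrA ler_wpM2l ?(ltW C0)//.
    by move: sD; rewrite /av_after ler_pdivrMr// (leb_bset_gt0 aD).
  move=> /(_ DD) sB.
  have Bs : 2 * (C * s) * rm leb B <= rm m B.
    apply: (wm_ge lf bB) => z /BA /= /ltW; apply: le_trans; apply: (le_trans _ sA).
    rewrite mulrA ler_wpM2r ?(ltW s0)//; move: K4 C0; clear; lra.
  have B0 : rm leb B = 0.
    apply/le_anti; rewrite rm_ge0 andbT -(pmulr_rle0 _ (mulr_gt0 C0 s0)).
    by move: (le_trans Bs sB); set u := C * s; clear; lra.
  by apply/le_anti; rewrite rm_ge0 andbT (le_trans sB)// B0 mulr0.
Qed.

End upper_levels.

(** * Integrability of a power above 1 *)

Section upper_integral.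
Context {R : realType} {n : nat}.
Local Notation X := (spacetime R n).
Local Notation leb := (@lebesgue R n).

Lemma ge0_integral_le_scale (f g : X -> R) (c : R) (E : set X) :
  measurable_fun setT f -> (forall z, 0 <= f z) -> measurable_fun setT g -> (forall z, 0 <= g z) ->
  measurable E -> 0 <= c -> (forall z, E z -> f z <= c * g z) ->
  (\int[leb]_(z in E) (f z)%:E <= c%:E * \int[leb]_(z in E) (g z)%:E)%E.
Proof.
move=> mf f0 mg g0 mE c0 H.
rewrite -ge0_integralZl; last 4 first.
- exact: mE.
- by apply/measurable_EFinP; exact: measurable_funTS.
- by move=> z _; rewrite lee_fin; exact: g0.
- by rewrite lee_fin.
apply: (ge0_le_integral _ mE).
- by move=> z _; rewrite lee_fin; exact: f0.
- by apply/measurable_EFinP; exact: measurable_funTS.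
- by apply/measurable_EFinP; apply: measurable_funTS; exact: measurable_funM.
- by move=> z Ez; rewrite -EFinM lee_fin; exact: H.
Qed.

Lemma integral_le_wm (w f : X -> R) (mw : measurable_fun setT w) (w0 : forall z, 0 <= w z)
    (c : R) (E : set X) : locfin (wm mw w0) -> measurable_fun setT f -> (forall z, 0 <= f z) ->
  bm E -> 0 <= c -> (forall z, E z -> f z <= c * w z) ->
  (\int[leb]_(z in E) (f z)%:E <= (c * rm (wm mw w0) E)%:E)%E.
Proof.
move=> lf mf f0 bE c0 H; have [mE _] := bE; rewrite EFinM -(rmE lf bE).
exact: ge0_integral_le_scale.
Qed.

(** [layer_bound] is applied with m in place of Lebesgue measure: w^(1+d) is w^d against the density
    of m, and w^d is at most (A^j a(D))^d off level j. *)
Lemma upper_integral (p g C : R) : 1 < p -> 0 < g -> g < 1 -> 1 <= C ->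
  exists2 d : R, 0 < d &
    forall (w : X -> R) (mw : measurable_fun setT w) (w0 : forall z, 0 <= w z),
    let m := wm mw w0 in backward_A p g C m -> boxes_charged m ->
    forall D, padm (1 - g) p D ->
    (\int[leb]_(z in bset D) (w z `^ (1 + d))%:E <=
      (7 * av_after p g m D `^ d * (C * rm m (after p g D)))%:E)%E.
Proof.
move=> p1 g0 g1 C1; have [A A2 HA] := upper_step (n := n) p1 g0 g1 C1.
have C0 : 0 < C by exact: lt_le_trans C1.
have A1 : 1 <= A by apply: le_trans A2; rewrite ler1n.
have A0 : 0 < A by exact: lt_le_trans A1.
have [d d0 dA] := powR_below A1; exists d => // w mw w0 m Hm Hpos D aD.
have [lf _] := Hm.
have avp D' : padm (1 - g) p D' -> 0 < av_after p g m D'.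
  move=> aD'; have [l0 h0 _ _] := aD'.
  by rewrite divr_gt0 ?(leb_bset_gt0 aD')// Hpos.
pose G j D := [set z : X | A ^+ j * av_after p g m D < w z].
have mG j D' : measurable (G j D') by exact: measurable_wgt.
have Aj j : 0 < A ^+ j by rewrite exprn_gt0.
have dG j k D' : padm (1 - g) p D' -> (j <= k)%N -> G k D' `<=` G j D'.
  move=> /avp a0 jk z; rewrite /G /=; apply: le_lt_trans.
  by rewrite ler_pM2r// ler_weXn2l.
have lev := @stopping_iter R n m (padm (1 - g) p) (fun D => C * rm m (after p g D)) G lf mG.
have {}lev : forall j D, padm (1 - g) p D -> rm m (bset D `&` G j D) <= 2^-1 ^+ j * (C * rm m (after p g D)).
  apply: lev.
  - by move=> j D' aD'; exact: dG.
  - move=> D' aD'; apply: le_trans (backward_after Hm aD').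
    apply: rm_le => //; [|exact: bm_bset].
    by case: (bmI (bm_bset D') (mG 0%N D')).
  - move=> D0 aD0; have [F [F1 F2 F3 F4]] := HA w mw w0 Hm D0 aD0 (avp _ aD0).
    exists F; split => //.
    + move=> J D' /F1[aD' aa]; split => // j z; rewrite /G /=; apply: le_lt_trans.
      by rewrite exprSr -mulrA ler_pM2l.
    + by move=> J; rewrite -mulr_sumr mulrCA ler_pM2l.
have f0 z : 0 <= w z `^ (1 + d) by exact: powR_ge0.
have mf := measurable_wpow (1 + d) mw.
have a0 := avp _ aD.
rewrite -[X in (X <= _)%E]/(mass_of leb mf f0 (bset D)).
have Q0 : 0 <= C * rm m (after p g D) by rewrite mulr_ge0 ?rm_ge0 ?(ltW C0).
apply: (@layer_bound R n m (mass_of leb mf f0) (bset D) (fun j => G j D)) => //.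
- exact: bm_bset.
- exact: powR_ge0.
- by move=> j; apply: dG.
- rewrite (_ : _ `&` _ = set0) ?measure0// -subset0 => z [_ Gz].
  have [k [k0 Hk]] := natr_above (w z / av_after p g m D).
  have := Gz k I; rewrite /G /= -ltr_pdivlMr// => /lt_le_trans/(_ Hk).
  apply/negP; rewrite -leNgt; apply: (@le_trans _ _ (2 ^+ k)).
    by rewrite -natrX ler_nat ltnW// ltn_expl.
  by rewrite lerXn2r ?nnegrE ?(ltW A0).
- move=> j E bE ED EG; rewrite /mass_of.
  apply: (integral_le_wm lf mf f0 bE); first by rewrite mulr_ge0 ?powR_ge0// exprn_ge0// divr_ge0.
  + move=> z Ez.
    have wz : w z <= A ^+ j * av_after p g m D.
      by rewrite leNgt; apply/negP => Gz; apply: (EG z).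
    have [w00|w0'] := eqVneq (w z) 0.
      by rewrite w00 powR0 ?mulr0// gt_eqF// addr_gt0.
    rewrite powRD ?w0' ?implybT// powRr1// mulrC ler_wpM2r//.
    apply: (@le_trans _ _ ((A ^+ j * av_after p g m D) `^ d)).
      apply: ge0_ler_powR => //; rewrite ?nnegrE ?(ltW d0)//.
      by apply: mulr_ge0; apply: ltW.
    rewrite powRM ?(ltW a0) ?(ltW (Aj j))// mulrC ler_wpM2l ?powR_ge0//.
    rewrite -powR_mulrn ?(ltW A0)// powRAC powR_mulrn ?powR_ge0//.
    by rewrite lerXn2r ?nnegrE ?powR_ge0// divr_ge0.
- exact: backward_after.
- by move=> j; exact: lev.
Qed.

Lemma chain_after (p g C : R) (m : {measure set X -> \bar R}) (D : pbox R n) j :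
  backward_A p g C m -> padm (1 - g) p D -> 0 <= C ->
  rm m (after p g D) <= C ^+ j * rm m (bset (tshift p ((1 + g) * j.+1%:R) D)).
Proof.
move=> Hm aD C0; elim: j => [|j IH]; first by rewrite expr0 mul1r mulr1.
apply: (le_trans IH); rewrite exprSr -mulrA ler_wpM2l ?exprn_ge0//.
have := backward_after Hm (aD : padm (1 - g) p (tshift p ((1 + g) * j.+1%:R) D)).
rewrite /after tshiftD (_ : _ * j.+1%:R + _ = (1 + g) * j.+2%:R)//.
by rewrite -[j.+2%:R]natr1; ring.
Qed.

(** Jumps of (1+g) r, r being the radius of the cell, first pass T with an overshoot of at most 2r,
    one more jump adds at most 2r and the height at most r. The total 5r fits in L^p, which is the
    origin of 1/5; at most N^p + 1 jumps pass T. *)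
Lemma rect_reach (p g C L T s : R) (N K J : nat) (x y : n.-tuple R) (m : {measure set X -> \bar R}) :
  let D : pbox R n := (y, L / N%:R, s, L `^ p / K%:R) in
  backward_A p g C m -> padm (1 - g) p D -> 0 < g -> g < 1 -> 0 < L `^ p -> 0 < N%:R `^ p :> R ->
  (forall k, tnth x k <= tnth y k /\ tnth y k + L / N%:R <= tnth x k + L) ->
  T - L `^ p <= s -> s + L `^ p / K%:R <= T - L `^ p + L `^ p ->
  (L / N%:R) `^ p <= 5^-1 * L `^ p -> N%:R `^ p + 1 <= J%:R :> R ->
  (L / N%:R) `^ p = L `^ p / N%:R `^ p -> 1 <= C ->
  rm m (after p g D) <= C ^+ J * rm m (box x L T (L `^ p)).
Proof.
move=> D Hm aD g0 g1 r0 Np Hy s1 s2 rl HJ LN C1; have [lf _] := Hm.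
have [l0 h0 hr rh] := aD; rewrite -[bh D]/(L `^ p / K%:R) -[bl D]/(L / N%:R) in l0 h0 hr rh.
have r0' : 0 < (L / N%:R) `^ p by rewrite powR_gt0.
have eta0 : 0 < (1 + g) * (L / N%:R) `^ p by rewrite mulr_gt0// addr_gt0.
have sT : s <= T by move: h0 s2; clear; lra.
have [j [j1 j2 j3]] := landing eta0 sT.
have jJ : (j <= J)%N.
  rewrite -(ler_nat R); apply: (le_trans j3); apply: le_trans HJ; rewrite lerD2r.
  rewrite ler_pdivrMr// LN mulrCA [N%:R `^ p * _]mulrC divfK ?gt_eqF//.
  have : 0 <= g * L `^ p by rewrite mulr_ge0 ?(ltW g0) ?(ltW r0).
  by move: s1; clear; lra.
apply: (le_trans (chain_after j Hm aD (le_trans ler01 C1))).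
apply: ler_pM; rewrite ?rm_ge0 ?exprn_ge0 ?(le_trans ler01 C1)//; first by rewrite ler_weXn2l.
apply: rm_le => //; [by case: (bm_bset (tshift p ((1 + g) * j.+1%:R) D))|exact: bm_box|].
move=> z [z1 z2]; split => [i|].
  have := z1 i; have := Hy i; rewrite -[bl _]/(L / N%:R) -[bx _]/y.
  by clear; lra.
move: z2; rewrite /tshift /bt /bh /bl/= -natr1 => z2.
have gr : g * (L / N%:R) `^ p <= (L / N%:R) `^ p by rewrite ler_piMl ?(ltW r0') ?(ltW g1).
move: z2 j1 j2 hr gr rl r0' eta0; set r := (L / N%:R) `^ p; set q := L `^ p; set h := q / K%:R; set k : R := j%:R.
clearbody r q h k; clear; lra.
Qed.

Theorem upper_rect (p g C : R) : 1 < p -> 0 < g -> g < 1 -> 1 <= C ->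
  exists d B : R, [/\ 0 < d, 0 < B &
    forall (w : X -> R) (mw : measurable_fun setT w) (w0 : forall z, 0 <= w z),
    let m := wm mw w0 in backward_A p g C m -> boxes_charged m ->
    forall (x : n.-tuple R) (L T : R), 0 < L ->
    (\int[leb]_(z in box x L (T - L `^ p) (L `^ p)) (w z `^ (1 + d))%:E <=
      (B * (rm m (box x L T (L `^ p)) / (L ^+ n * L `^ p)) `^ (1 + d) *
       (L ^+ n * L `^ p))%:E)%E].
Proof.
move=> p1 g0 g1 C1; have p0 : 0 < p by exact: lt_trans p1.
have C0 : 0 < C by exact: lt_le_trans C1.
have [d d0 HI] := upper_integral p1 g0 g1 C1.
have sg0 : 0 < 1 - g by rewrite subr_gt0.
have e0 : 0 < 5^-1 :> R by rewrite invr_gt0.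
have [N [K [N0 K0 HNK]]] := adm_partition p0 sg0 ltr01 e0.
have NR : 0 < N%:R :> R by rewrite ltr0n.
have Np : 0 < N%:R `^ p :> R by rewrite powR_gt0.
have [J [J0 HJ]] := natr_above (N%:R `^ p + 1 : R).
have [kap kapE] : exists k : R, k = (1 - g) / 2 / (N%:R ^+ n * N%:R `^ p) by eexists.
have kap0 : 0 < kap by rewrite kapE !divr_gt0 ?mulr_gt0 ?exprn_gt0.
pose B0 : R := 7 * C * (C ^+ J) `^ (1 + d) / kap `^ d.
have B00 : 0 < B0 by rewrite /B0 divr_gt0 ?mulr_gt0 ?powR_gt0 ?exprn_gt0.
exists d, (#|{: @idx n N K}|%:R * B0); split => //.
  apply: mulr_gt0 => //; rewrite ltr0n; apply/card_gt0P.
  by exists ([ffun=> Ordinal N0], Ordinal K0).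
move=> w mw w0 m Hm Hpos x L T L0; set v := L ^+ n * L `^ p.
have r0 : 0 < L `^ p by rewrite powR_gt0.
have v0 : 0 < v by rewrite mulr_gt0 ?exprn_gt0.
have f0 z : 0 <= w z `^ (1 + d) by exact: powR_ge0.
have mf := measurable_wpow (1 + d) mw.
rewrite -[X in (X <= _)%E]/(mass_of leb mf f0 (box x L (T - L `^ p) (L `^ p))).
rewrite -mulrA -mulrA; apply: box_split_le => // y s Hy s1 s2.
have [aD rl] := HNK L L0; rewrite mul1r in aD.
have l0 : 0 < L / N%:R by rewrite divr_gt0.
have hK0 : 0 < L `^ p / K%:R by rewrite divr_gt0// ltr0n.
pose D : pbox R n := (y, L / N%:R, s, L `^ p / K%:R).
apply: (le_trans (HI w mw w0 Hm Hpos D aD)); rewrite lee_fin.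
have LN : (L / N%:R) `^ p = L `^ p / N%:R `^ p.
  by rewrite powRM ?invr_ge0 ?(ltW L0)// -powR_inv1 ?(ltW NR)// powRAC powR_inv1 ?powR_ge0.
have [_ hK1 hK2 rh] := aD.
have vk : v * kap <= rm leb (bset D).
  rewrite leb_bset// -[bl D]/(L / N%:R) -[bh D]/(L `^ p / K%:R).
  have -> : v * kap = (L / N%:R) ^+ n * ((1 - g) * (L / N%:R) `^ p / 2).
    rewrite LN expr_div_n /v kapE; field; rewrite !gt_eqF// ?exprn_gt0//.
  rewrite ler_wpM2l ?exprn_ge0 ?(ltW l0)//.
  by move: rh; set a := _ * _ `^ p; set b := _ / K%:R; clear; lra.
have Hup := rect_reach Hm aD g0 g1 r0 Np Hy s1 s2 rl HJ LN C1.
set mP := rm m (after p g D) in Hup *; set a := rm m _ / v.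
have mRE : rm m (box x L T (L `^ p)) = a * v by rewrite /a divfK// gt_eqF.
have a0 : 0 <= a by rewrite divr_ge0 ?rm_ge0 ?(ltW v0).
rewrite mRE in Hup; clearbody a; have G0 : 0 <= C ^+ J by rewrite exprn_ge0 ?(ltW C0).
have vk0 : 0 < v * kap by rewrite mulr_gt0.
have ava : av_after p g m D <= C ^+ J * a / kap.
  have V0 : 0 < rm leb (bset D) := @leb_bset_gt0 R n (1 - g) p D aD.
  apply: (@le_trans _ _ (C ^+ J * (a * v) / rm leb (bset D))).
    by rewrite ler_pM2r ?invr_gt0.
  rewrite ler_pdivrMr//.
  have -> : C ^+ J * a / kap * rm leb (bset D) = C ^+ J * (a * (rm leb (bset D) / kap)).
    by set V := rm leb _; ring.
  by rewrite ler_wpM2l// ler_wpM2l// ler_pdivlMr.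
have F1 : av_after p g m D `^ d <= (C ^+ J * a / kap) `^ d.
  apply: ge0_ler_powR; rewrite ?nnegrE ?(ltW d0)//.
    by rewrite divr_ge0 ?rm_ge0.
  by apply: divr_ge0; [exact: mulr_ge0|exact: ltW].
have -> : B0 * (a `^ (1 + d) * v) = 7 * (C ^+ J * a / kap) `^ d * (C * (C ^+ J * (a * v))).
  have [->|an0] := eqVneq a 0.
    by rewrite !(mul0r, mulr0) powR0 ?gt_eqF ?addr_gt0// mul0r mulr0.
  have Gn0 : C ^+ J != 0 by rewrite expf_neq0// gt_eqF.
  rewrite /B0 !powRD ?an0 ?Gn0 ?implybT// !powRr1// (powRM _ (mulr_ge0 G0 a0)) ?invr_ge0 ?(ltW kap0)//.
  rewrite powRM// -[kap^-1]powR_inv1 ?(ltW kap0)// -powRrM mulN1r powRN.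
  by set x1 := _ `^ d; set x2 := _ `^ d; set x3 := _ `^ d; ring.
apply: ler_pM; rewrite ?mulr_ge0 ?powR_ge0 ?rm_ge0 ?(ltW C0)//.
  by rewrite ler_pM2l.
by rewrite ler_pM2l.
Qed.

End upper_integral.

(** * The constants of the two classes *)

Section constants.
Context {R : realType} {n : nat}.
Local Notation X := (spacetime R n).
Local Notation leb := (@lebesgue R n).
Implicit Types (z : X) (L p g : R).

Definition corner z L : n.-tuple R := [tuple tnth z.1 i - L / 2 | i < n].

Definition rect_center (x : n.-tuple R) (T L : R) : X := ([tuple tnth x i + L / 2 | i < n], T).

Lemma rect_centerK (x : n.-tuple R) T L : corner (rect_center x T L) L = x.
Proof. by apply: eq_from_tnth => i; rewrite !tnth_mktuple addrK. Qed.

Lemma rect_minusE p g z L :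
  rect_minus p g z L = box (corner z L) L (z.2 - L `^ p) ((1 - g) * L `^ p).
Proof.
by apply/seteqP; split => y [H1 H2]; (split => [i|]; [have := H1 i; rewrite tnth_mktuple; lra|
  move: H2; rewrite /= in_itv/=; lra]).
Qed.

Lemma rect_plusE p g z L :
  rect_plus p g z L = box (corner z L) L (z.2 + g * L `^ p) ((1 - g) * L `^ p).
Proof.
by apply/seteqP; split => y [H1 H2]; (split => [i|]; [have := H1 i; rewrite tnth_mktuple; lra|
  move: H2; rewrite /= in_itv/=; lra]).
Qed.

Lemma avg_box (x : n.-tuple R) (L t h : R) (f : X -> \bar R) : 0 < L -> 0 < h ->
  avg (box x L t h) f = (((L ^+ n * h)^-1)%:E * \int[leb]_(z in box x L t h) f z)%E.
Proof.
move=> L0 h0; rewrite /avg lebesgue_box ?ltW// inver gt_eqF//.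
by rewrite mulr_gt0 ?exprn_gt0.
Qed.

Lemma avg_wm (w : X -> R) (mw : measurable_fun setT w) (w0 : forall z, 0 <= w z)
  (x : n.-tuple R) (L t h : R) : locfin (wm mw w0) -> 0 < L -> 0 < h ->
  avg (box x L t h) (EFin \o w) = (rm (wm mw w0) (box x L t h) / (L ^+ n * h))%:E.
Proof.
move=> lf L0 h0; rewrite avg_box// mulrC EFinM -(rmE lf (bm_box _ _ _ _)).
by rewrite wmE muleC.
Qed.

Lemma sup_rectP (F : X -> R -> \bar R) (c : \bar R) :
  (sup_rect F <= c)%E <-> forall z L, 0 < L -> (F z L <= c)%E.
Proof.
split => [H z L L0|H].
  by apply: le_trans H; apply: ereal_sup_ubound; exists z => //; exists L.
by apply: ge_ereal_sup => _ [z _ [L L0 <-]]; exact: H.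
Qed.

(* The shape of a tail estimate: w is split at a large multiple of its average on the later box. *)
Lemma forward_from_tail (p : R) (Ct : R -> R) : (forall e, 0 < e -> 0 < Ct e) ->
  exists Cd : R, exists del : R -> R, [/\ 1 <= Cd, forall eta, 0 < eta -> 0 < del eta &
    forall m : {measure set X -> \bar R}, locfin m ->
    (forall (x : n.-tuple R) L t E e, 0 < L -> 0 < e -> measurable E -> E `<=` pb p x L t ->
      rm m E <= rm m (pb p x L (t + L `^ p)) * (e + Ct e * (rm leb E / rm leb (pb p x L t)))) ->
    forward_RH p Cd del m].
Proof.
move=> C0; exists (1 + Ct 1), (fun e => e / 2 / Ct (e / 2)).
have C1 := C0 1 ltr01; split => [|e e0|m lf H]; first by rewrite lerDl ltW.
  by rewrite divr_gt0 ?C0// divr_gt0.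
have V0 x L t : 0 < L -> 0 < rm leb (pb p x L t).
  by move=> L0; rewrite lebpb// mulr_gt0 ?exprn_gt0 ?powR_gt0.
split => // [y l t l0|e y l t E e0 l0 mE EP Ele].
  have := H y l t (pb p y l t) 1 l0 ltr01 (measurable_box _ _ _ _) (fun _ => id).
  by rewrite divff ?gt_eqF ?V0// mulr1 mulrC.
have e2 : 0 < e / 2 by rewrite divr_gt0.
apply: (le_trans (H _ _ _ _ _ l0 e2 mE EP)); rewrite mulrC ler_wpM2r ?rm_ge0//.
have : rm leb E / rm leb (pb p y l t) <= e / 2 / Ct (e / 2) by rewrite ler_pdivrMr ?V0.
move=> /(ler_wpM2l (ltW (C0 _ e2))); rewrite [X in _ <= X -> _]mulrC divfK ?gt_eqF ?C0//.
by set a := _ * _; clear; lra.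
Qed.

End constants.

Section reverse_hoelder.
Context {R : realType} {n : nat}.
Local Notation X := (spacetime R n).
Local Notation leb := (@lebesgue R n).

Lemma weight_boxes_charged (w : X -> R) (mw : measurable_fun setT w) (w0 : forall z, 0 <= w z) :
  weight w -> boxes_charged (wm mw w0).
Proof. by move=> Hw x l t h l0 h0; exact: wm_gt0. Qed.

Lemma RH_const_pb (p : R) (q : \bar R) (k : R) (w : X -> R) (mw : measurable_fun setT w)
    (w0 : forall z, 0 <= w z) (x : n.-tuple R) (L t : R) :
  weight w -> (RH_const p 0 q w <= k%:E)%E -> 0 < L ->
  ((match q with
     | s%:E => avg (pb p x L t) (fun y => (w y `^ s)%:E) `^ s^-1
     | _ => ess_sup_on (pb p x L t) (EFin \o w)
     end) <= (k * (rm (wm mw w0) (pb p x L (t + L `^ p)) / (L ^+ n * L `^ p)))%:E)%E.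
Proof.
move=> Hw /sup_rectP/(_ (rect_center x (t + L `^ p) L) L) + L0 => /(_ L0).
have r0 : 0 < L `^ p by rewrite powR_gt0.
rewrite rect_minusE rect_plusE rect_centerK /= mul0r addr0 subr0 mul1r addrK.
rewrite (avg_wm x _ (locfin_wm mw w0 Hw) L0 r0).
rewrite -/(pb p x L t) -/(pb p x L (t + L `^ p)).
set a := rm _ _ / _; have a0 : 0 < a.
  by rewrite divr_gt0 ?mulr_gt0 ?exprn_gt0// weight_boxes_charged.
rewrite inver gt_eqF// EFinM.
by case: q => [s| |]; rewrite lee_pdivrMr.
Qed.

(** Chebyshev: where w > T one has w <= T^(1-s) w^s. *)
Lemma wm_tail (w : X -> R) (mw : measurable_fun setT w) (w0 : forall z, 0 <= w z)
    (s I T : R) (B E : set X) : locfin (wm mw w0) -> 1 < s -> 0 < T -> bm B -> measurable E -> E `<=` B ->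
  (\int[leb]_(z in B) (w z `^ s)%:E <= I%:E)%E ->
  rm (wm mw w0) E <= T * rm leb E + T `^ (1 - s) * I.
Proof.
move=> lf s1 T0 bB mE EB HI; have bE := bmS mE bB EB; have [mB _] := bB.
have mws : measurable_fun setT (fun z => w z `^ s) by exact: measurable_wpow.
have ws0 z : 0 <= w z `^ s by exact: powR_ge0.
have mT := measurable_wgt mw T; set H := [set z | _] in mT.
have bEH : bm (E `&` H) by exact: bmI.
have [mEH _] := bEH.
have EE : E = (E `\` H) `|` (E `&` H) by rewrite setUC setUIDK.
have I1 : rm (wm mw w0) (E `\` H) <= T * rm leb E.
  apply: (@le_trans _ _ (T * rm leb (E `\` H))).
    by apply: (wm_le lf (bmD bE mT)) => z [_ /negP]; rewrite -leNgt.
  rewrite ler_pM2l//; apply: rm_le => //; [exact: locfin_lebesgue|by case: (bmD bE mT)].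
have Ts0 : 0 <= T `^ (1 - s) by exact: powR_ge0.
have I2 : rm (wm mw w0) (E `&` H) <= T `^ (1 - s) * I.
  rewrite -lee_fin -(rmE lf bEH) wmE EFinM.
  apply: (@le_trans _ _ ((T `^ (1 - s))%:E * \int[leb]_(z in E `&` H) (w z `^ s)%:E)%E).
    apply: ge0_integral_le_scale => // z [_ Tw].
    have wp : 0 < w z by exact: lt_trans Tw.
    have E1 : w z = w z `^ (1 - s) * w z `^ s.
      by rewrite -powRD ?subrK ?powRr1 ?w0// gt_eqF ?implybT.
    rewrite [leLHS]E1 ler_wpM2r// -opprB !powRN lef_pV2 ?posrE ?powR_gt0//.
    by apply: ge0_ler_powR; rewrite ?nnegrE ?subr_ge0 ?ltW.
  apply: lee_wpmul2l; first by rewrite lee_fin.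
  apply: (le_trans _ HI); rewrite -[leLHS]/(mass_of leb mws ws0 (E `&` H)) -[leRHS]/(mass_of leb mws ws0 B).
  by apply: le_measure; rewrite ?inE// => z [/EB].
rewrite [in leLHS]EE; apply: (le_trans (rmU_le lf (bmD bE mT) bEH)); exact: lerD.
Qed.

Lemma wm_le_ae (w : X -> R) (mw : measurable_fun setT w) (w0 : forall z, 0 <= w z)
    (T : R) (E : set X) : locfin (wm mw w0) -> bm E -> 0 <= T ->
  leb.-negligible (E `&` [set z | T < w z]) -> rm (wm mw w0) E <= T * rm leb E.
Proof.
move=> lf bE T0 nE; have mT := measurable_wgt mw T; set H := [set z | _] in mT nE.
have bEH : bm (E `&` H) by exact: bmI.
have [mEH _] := bEH.
have z0 : rm (wm mw w0) (E `&` H) = 0.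
  rewrite /rm (ac_wm mw w0 mEH)//; apply/eqP; rewrite eq_le measure_ge0 andbT.
  have [N [mN N0 HN]] := nE; rewrite -N0; apply: le_measure; rewrite ?inE//.
have EE : E = (E `\` H) `|` (E `&` H) by rewrite setUC setUIDK.
rewrite [in leLHS]EE; apply: (le_trans (rmU_le lf (bmD bE mT) bEH)); rewrite z0 addr0.
apply: (@le_trans _ _ (T * rm leb (E `\` H))).
  by apply: (wm_le lf (bmD bE mT)) => z [_ /negP]; rewrite -leNgt.
rewrite ler_wpM2l//; apply: rm_le => //; [exact: locfin_lebesgue|by case: (bmD bE mT)].
Qed.

Lemma avg_root_le (x : n.-tuple R) (L t h s b : R) (f : X -> R) :
  0 < L -> 0 < h -> 0 < s -> 0 <= b -> (forall z, 0 <= f z) ->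
  (avg (box x L t h) (fun y => (f y)%:E) `^ s^-1 <= b%:E)%E ->
  (\int[leb]_(z in box x L t h) (f z)%:E <= (b `^ s * (L ^+ n * h))%:E)%E.
Proof.
move=> L0 h0 s0 b0 f0; have V0 : 0 < L ^+ n * h by rewrite mulr_gt0 ?exprn_gt0.
have I0 : (0 <= \int[leb]_(z in box x L t h) (f z)%:E)%E.
  by apply: integral_ge0 => z _; rewrite lee_fin.
rewrite avg_box//; set I := (\int[_]_(_ in _) _)%E in I0 *.
have A0 : (0 <= ((L ^+ n * h)^-1)%:E * I)%E by rewrite mule_ge0// lee_fin invr_ge0 ltW.
move=> H; have : (((L ^+ n * h)^-1)%:E * I <= (b `^ s)%:E)%E.
  have -> : (((L ^+ n * h)^-1)%:E * I = ((((L ^+ n * h)^-1)%:E * I) `^ s^-1) `^ s)%E.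
    by rewrite -poweRrM mulVf ?gt_eqF// poweRe1.
  rewrite -poweR_EFin; apply: gt0_ler_poweR (ltW s0) _ _ _ _ H.
  - by rewrite in_itv/= leey andbT poweR_ge0.
  - by rewrite in_itv/= leey andbT lee_fin.
by rewrite lee_pdivrMl// EFinM muleC.
Qed.

Lemma RH_forward (p : R) (q c : \bar R) : (1 < q)%E ->
  exists Cd : R, exists del : R -> R, [/\ 1 <= Cd, forall eta, 0 < eta -> 0 < del eta &
    forall (w : X -> R) (mw : measurable_fun setT w) (w0 : forall z, 0 <= w z),
      RH_class p 0 q w -> RH_const p 0 q w = c -> forward_RH p Cd del (wm mw w0)].
Proof.
(* [c] is fixed before any weight and may be infinite; membership in the class later makes it less
   than +oo, and [k] is then a positive real bound. *)
move=> q1; pose k : R := Num.max 1 (fine c).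
have k1 : 1 <= k by rewrite le_max lexx.
have k0 : 0 < k by exact: lt_le_trans k1.
have ck : (c < +oo -> c <= k%:E)%E.
  by case: c @k k1 k0 => [r||]//= _ _; rewrite ?leNye// lee_fin le_max lexx orbT.
case: q q1 => [s| |] //; rewrite ?lte_fin => q1; last first.
  have [Cd [del [Cd1 del0 HF]]] := @forward_from_tail R n p (fun=> k) (fun _ _ => k0).
  exists Cd, del; split => // w mw w0 [Hw wc] cE; rewrite cE in wc; have lf := locfin_wm mw w0 Hw.
  apply: HF => // x L t E e L0 e0 mE EP.
  have := RH_const_pb mw w0 x t Hw (_ : (RH_const p 0 +oo w <= k%:E)%E) L0.
  rewrite cE => /(_ (ck wc)) /ess_supP H.
  have V0 : 0 < rm leb (pb p x L t) by rewrite lebpb// mulr_gt0 ?exprn_gt0 ?powR_gt0.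
  move: H; rewrite -(lebpb p x t L0); set V := rm leb _ in V0 *; set mR := rm _ (pb p x L (t + L `^ p)).
  move=> H; have a0 : 0 <= mR / V by rewrite divr_ge0 ?rm_ge0 ?(ltW V0).
  have bE : bm E by exact: bmS (bm_box _ _ _ _) EP.
  have : rm (wm mw w0) E <= k * (mR / V) * rm leb E.
    apply: wm_le_ae => //; first by rewrite mulr_ge0 ?(ltW k0).
    apply: (negligibleS _ H) => z [Ez /= kw]; rewrite /patch mem_set; last exact: EP.
    by move=> /=; rewrite lee_fin leNgt kw.
  move=> /le_trans; apply.
  have -> : k * (mR / V) * rm leb E = mR * (k * (rm leb E / V)) by ring.
  by rewrite ler_wpM2l ?rm_ge0// lerDr ltW.
have [Cd [del [Cd1 del0 HF]]] := @forward_from_tail R n p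
  (fun e => k * (k / e) `^ (s - 1)^-1) (fun e e0 => mulr_gt0 k0 (powR_gt0 _ (divr_gt0 k0 e0))).
exists Cd, del; split => // w mw w0 [Hw wc] cE; rewrite cE in wc; have lf := locfin_wm mw w0 Hw.
apply: HF => // x L t E e L0 e0 mE EP.
have := RH_const_pb mw w0 x t Hw (_ : (RH_const p 0 s%:E w <= k%:E)%E) L0.
rewrite cE => /(_ (ck wc)).
have r0 : 0 < L `^ p by rewrite powR_gt0.
have V0 : 0 < rm leb (pb p x L t) by rewrite lebpb// mulr_gt0 ?exprn_gt0.
rewrite -(lebpb p x t L0); set V := rm leb _ in V0 *; set mR := rm _ (pb p x L (t + L `^ p)).
have mR0 : 0 < mR by exact: weight_boxes_charged.
have a0 : 0 < mR / V by rewrite divr_gt0.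
have ka0 : 0 < k * (mR / V) by rewrite mulr_gt0.
have s0 : 0 < s by exact: lt_trans q1.
move=> H; have I := avg_root_le L0 r0 s0 (ltW ka0) (fun z => powR_ge0 (w z) s) H.
rewrite -(lebpb p x t L0) -/V in I.
(* Chosen so that lam^(1-s) = e / k: splitting w at lam k times its later average makes the tail
   term exactly e times the later mass. *)
set lam := (k / e) `^ _; have lam0 : 0 < lam by rewrite powR_gt0// divr_gt0.
have T0 : 0 < lam * (k * (mR / V)) by rewrite mulr_gt0.
apply: (le_trans (wm_tail lf q1 T0 (bm_box _ _ _ _) mE EP I)).
rewrite le_eqVlt; apply/orP; left; apply/eqP.
have lamE : lam `^ (1 - s) = e / k.
  rewrite /lam -powRrM (_ : (s - 1)^-1 * (1 - s) = - 1); last by field; rewrite subr_eq0 gt_eqF.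
  by rewrite powR_inv1 ?divr_ge0 ?(ltW k0) ?(ltW e0)// invf_div.
rewrite powRM ?(ltW lam0) ?(ltW ka0)// lamE.
have -> : e / k * (k * (mR / V)) `^ (1 - s) * ((k * (mR / V)) `^ s * V) = mR * e.
  rewrite -mulrA [X in _ * X]mulrA -powRD ?subrK; last by rewrite gt_eqF// implybT.
  by rewrite powRr1 ?(ltW ka0)//; field; rewrite !gt_eqF.
by rewrite /lam; ring.
Qed.

End reverse_hoelder.

Section a_weights.
Context {R : realType} {n : nat}.
Local Notation X := (spacetime R n).
Local Notation leb := (@lebesgue R n).

(** Covers r = 1 and r > 1 together: a level [i] comparable with the past average, with w >= i off
    an eighth of the future box. A set filling a quarter of that box keeps an eighth where w >=
    i. *)
Lemma backward_from_level (p g K : R) (w : X -> R) (mw : measurable_fun setT w)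
    (w0 : forall z, 0 <= w z) : locfin (wm mw w0) -> 0 <= K -> g < 1 ->
  (forall (x : n.-tuple R) L t, 0 < L -> exists i : R, [/\ 0 <= i,
     rm (wm mw w0) (box x L t ((1 - g) * L `^ p)) <= K * i * (L ^+ n * ((1 - g) * L `^ p)) &
     rm leb (box x L (t + (1 + g) * L `^ p) ((1 - g) * L `^ p) `&` [set z | w z < i]) <=
       (L ^+ n * ((1 - g) * L `^ p)) / 8]) ->
  backward_A p g (8 * K) (wm mw w0).
Proof.
move=> lf K0 g1 H; split => // x L t E L0 mE EF.
have sg0 : 0 < 1 - g by rewrite subr_gt0.
have h0 : 0 < (1 - g) * L `^ p by rewrite mulr_gt0 ?powR_gt0.
rewrite rm_leb_box ?(ltW L0) ?(ltW h0)//; have [i [i0 H1 H2]] := H x L t L0.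
set V := L ^+ n * _ in H1 H2 *; move=> EV.
have bE : bm E by exact: bmS (bm_box _ _ _ _) EF.
have mH : measurable [set z | w z < i] by exact: measurable_wlt.
set Hi := [set z | _] in mH H2.
have e1 : rm leb (E `&` Hi) <= V / 8.
  apply: le_trans H2; apply: rm_le; [exact: locfin_lebesgue|by case: (bmI bE mH)| |].
    by apply: bmI => //; exact: bm_box.
  by move=> z [/EF].
have e2 : i * rm leb (E `\` Hi) <= rm (wm mw w0) (E `\` Hi).
  by apply: (wm_ge lf (bmD bE mH)) => z [_ /negP]; rewrite -leNgt.
have e3 : rm (wm mw w0) (E `\` Hi) <= rm (wm mw w0) E.
  by apply: rm_le => //; case: (bmD bE mH).
have e4 := rmD locfin_lebesgue bE mH; rewrite e4 in e2.
have e5 : i * (V / 8) <= i * (rm leb E - rm leb (E `&` Hi)).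
  by rewrite ler_wpM2l//; move: EV e1; clear; lra.
have := ler_wpM2l K0 (le_trans e5 (le_trans e2 e3)).
move: H1; have -> : K * i * V = 8 * (K * (i * (V / 8))) by field.
by set a := rm _ _; set b := K * _; clear; lra.
Qed.

Lemma A_const_box (p g r k : R) (w : X -> R) (mw : measurable_fun setT w)
    (w0 : forall z, 0 <= w z) (x : n.-tuple R) (L t : R) : g < 1 ->
  weight w -> (A_const p g r w <= k%:E)%E -> 0 < L ->
  ((rm (wm mw w0) (box x L t ((1 - g) * L `^ p)) / (L ^+ n * ((1 - g) * L `^ p)))%:E *
    (if r == 1%R then (ess_inf_on (box x L (t + (1 + g) * L `^ p) ((1 - g) * L `^ p)) (EFin \o w))^-1
     else avg (box x L (t + (1 + g) * L `^ p) ((1 - g) * L `^ p)) (fun y => (w y `^ (1 - r)^-1)%:E) `^ (r - 1)) <= k%:E)%E.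
Proof.
move=> g1 Hw /sup_rectP/(_ (rect_center x (t + L `^ p) L) L) + L0 => /(_ L0).
have h0 : 0 < (1 - g) * L `^ p by rewrite mulr_gt0 ?powR_gt0// subr_gt0.
rewrite rect_minusE rect_plusE rect_centerK /= addrK.
rewrite (avg_wm x _ (locfin_wm mw w0 Hw) L0 h0).
by rewrite (_ : t + L `^ p + g * L `^ p = t + (1 + g) * L `^ p)//; ring.
Qed.

Lemma rm_negligible (E : set X) : measurable E -> leb.-negligible E -> rm leb E = 0.
Proof.
move=> mE [N [mN N0 HN]]; rewrite /rm; suff -> : leb E = 0%E by [].
by apply/eqP; rewrite eq_le measure_ge0 andbT -N0; apply: le_measure; rewrite ?inE.
Qed.

Lemma ess_inf_level (w : X -> R) (w0 : forall z, 0 <= w z) (mw : measurable_fun setT w)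
    (a k : R) (x : n.-tuple R) (L t h : R) : 0 < a -> 0 < L -> 0 < h ->
  (a%:E * (ess_inf_on (box x L t h) (EFin \o w))^-1 <= k%:E)%E ->
  exists i : R, [/\ 0 <= i, a <= k * i & rm leb (box x L t h `&` [set z | w z < i]) = 0].
Proof.
move=> a0 L0 h0; set F := box x L t h.
have mF : measurable F by exact: measurable_box.
have FN : ~ leb.-negligible F.
  move=> nF; have := rm_negligible mF nF; rewrite /F rm_leb_box ?ltW//.
  by apply/eqP; rewrite gt_eqF// mulr_gt0 ?exprn_gt0.
have := @ess_inf_le _ _ _ leb (patch (cst +oo%E) F (EFin \o w)).
have : (0 <= ess_inf_on F (EFin \o w))%E.
  apply/ess_infP; apply: nearW => z; rewrite /patch; case: ifPn => _ /=; last exact: leey.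
  by rewrite lee_fin.
rewrite -/(ess_inf_on F (EFin \o w)).
case: (ess_inf_on F _) => [i| |]// i0 Hi H; last first.
  exfalso; apply: FN; apply: (negligibleS _ Hi) => z Fz /=.
  by rewrite /patch mem_set//= leye_eq.
(* The inverse of 0 is +oo, so a finite product with a > 0 excludes the value 0. *)
have [iz|inz] := eqVneq i 0.
  by move: H; rewrite iz inver eqxx gt0_muley ?lte_fin// leye_eq.
have ip : 0 < i by rewrite lt_neqAle eq_sym inz.
exists i; split; first exact: ltW.
  by move: H; rewrite inver (negbTE inz) -EFinM lee_fin ler_pdivrMr.
apply: rm_negligible; first by apply: measurableI => //; exact: measurable_wlt.
apply: (negligibleS _ Hi) => z [Fz /= wi].
by rewrite /patch mem_set//= lee_fin leNgt wi.
Qed.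

(* Chebyshev applied to w^(1/(1-r)) at 8 times its average. *)
Lemma dual_level (w : X -> R) (mw : measurable_fun setT w) (w0 : forall z, 0 <= w z)
    (a k r : R) (x : n.-tuple R) (L t h : R) : {ae leb, forall z, 0 < w z} -> 1 < r ->
  0 < a -> 0 < L -> 0 < h ->
  (a%:E * (avg (box x L t h) (fun y => (w y `^ (1 - r)^-1)%:E) `^ (r - 1)) <= k%:E)%E ->
  exists i : R, [/\ 0 <= i, a <= k * 8 `^ (r - 1) * i &
    rm leb (box x L t h `&` [set z | w z < i]) <= L ^+ n * h / 8].
Proof.
move=> wpos r1 a0 L0 h0; set F := box x L t h; set s := (1 - r)^-1.
have V0 : 0 < L ^+ n * h by rewrite mulr_gt0 ?exprn_gt0.
have bF : bm F by exact: bm_box.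
have mF : measurable F by case: bF.
have mws := measurable_wpow s mw.
have ws0 z : 0 <= w z `^ s by exact: powR_ge0.
have wspos : {ae leb, forall z, 0 < w z `^ s}.
  by apply: filterS wpos => z; exact: powR_gt0.
have := integral_box_gt0 x t mws ws0 wspos L0 h0.
rewrite avg_box// -/F; set I := (\int[_]_(_ in _) _)%E.
have r10 : 0 < r - 1 by rewrite subr_gt0.
case IE : I => [b| |]// b0; last first.
  by rewrite gt0_muley ?lte_fin ?invr_gt0// poweRyr ?gt_eqF// gt0_muley ?lte_fin// leye_eq.
rewrite lte_fin in b0; rewrite -[(_%:E * b%:E)%E]EFinM poweR_EFin -EFinM lee_fin => H.
have [b' bE] : exists b', b' = (L ^+ n * h)^-1 * b by eexists.
rewrite -bE in H; have ib0 : 0 < b' by rewrite bE mulr_gt0 ?invr_gt0.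
(* For w > 0, w < i means w^(1/(1-r)) > 8 b', as the exponent is negative. *)
exists ((8 * b') `^ (1 - r)); split; first exact: powR_ge0.
- have b'r : 0 < b' `^ (r - 1) by rewrite powR_gt0.
  move: H; rewrite -ler_pdivlMr// => /le_trans; apply.
  have -> : 1 - r = - (r - 1) by ring.
  rewrite powRN powRM ?(ltW ib0)//.
  rewrite le_eqVlt; apply/orP; left; apply/eqP; field.
  by rewrite !gt_eqF ?powR_gt0.
- have mi : measurable [set z | w z < (8 * b') `^ (1 - r)] by exact: measurable_wlt.
  set Hi := [set z | _] in mi *.
  have mH : measurable [set z | 8 * b' < w z `^ s] by exact: measurable_wgt.
  set H8 := [set z | _] in mH.
  have bU : bm (F `&` H8) by exact: bmI.
  have bFi : bm (F `&` Hi) by exact: bmI.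
  have mD : measurable ((F `&` Hi) `\` H8) by case: (bmD bFi mH).
  have mU : measurable (F `&` H8) by case: bU.
  (* The equivalence fails where w = 0, the power there being 0 by default; positivity almost
     everywhere removes this set. *)
  have Z0 : rm leb ((F `&` Hi) `\` H8) = 0.
    apply: rm_negligible => //; apply: (negligibleS _ wpos) => z [[_ wi] nH] wp.
    apply: nH; rewrite /H8 /=.
    have -> : 8 * b' = ((8 * b') `^ (1 - r)) `^ s.
      by rewrite -powRrM mulfV ?powRr1 ?mulr_ge0 ?(ltW ib0)// subr_eq0 lt_eqF.
    have -> : s = - (r - 1)^-1 by rewrite /s -invrN opprB.
    rewrite !powRN ltf_pV2 ?posrE ?powR_gt0 ?mulr_gt0//.
    by apply: gt0_ltr_powR; rewrite ?invr_gt0 ?nnegrE ?powR_ge0 ?w0.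
  have H88 : 8 * b' * rm leb (F `&` H8) <= b.
    rewrite -lee_fin EFinM -(rmE locfin_lebesgue bU) -integral_cst//.
    apply: (@le_trans _ _ (1%:E * \int[leb]_(z in F `&` H8) (w z `^ s)%:E)%E).
      apply: (@ge0_integral_le_scale _ _ (fun=> 8 * b')) => //.
      - by move=> z; rewrite mulr_ge0 ?(ltW ib0).
      - by move=> z [_ /ltW]; rewrite mul1r.
    rewrite mul1e -IE -[leLHS]/(mass_of leb mws ws0 (F `&` H8)) -[leRHS]/(mass_of leb mws ws0 F).
    by apply: le_measure; rewrite ?inE.
  have EE : F `&` Hi `<=` ((F `&` Hi) `\` H8) `|` (F `&` H8).
    by move=> z [Fz Hz]; have [?|?] := pselect (H8 z); [right|left].
  have mFi : measurable (F `&` Hi) by case: bFi.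
  apply: (le_trans (rm_le locfin_lebesgue mFi (bmU (bmD bFi mH) bU) EE)).
  apply: (le_trans (rmU_le locfin_lebesgue (bmD bFi mH) bU)); rewrite Z0 add0r.
  rewrite -(ler_pM2l (mulr_gt0 (ltr0n R 8) ib0)); apply: (le_trans H88).
  rewrite le_eqVlt; apply/orP; left; apply/eqP; rewrite bE; set V := _ * h in V0 *.
  by field; rewrite gt_eqF.
Qed.

Lemma A_backward (p g r : R) (c : \bar R) : g < 1 -> 1 <= r ->
  exists2 C : R, 1 <= C &
    forall (w : X -> R) (mw : measurable_fun setT w) (w0 : forall z, 0 <= w z),
      A_class p g r w -> A_const p g r w = c -> backward_A p g C (wm mw w0).
Proof.
move=> g1 r1; pose k : R := Num.max 1 (fine c).
have k1 : 1 <= k by rewrite le_max lexx.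
have k0 : 0 < k by exact: lt_le_trans k1.
have ck : (c < +oo -> c <= k%:E)%E.
  by case: c @k k1 k0 => [b||]//= _ _; rewrite ?leNye// lee_fin le_max lexx orbT.
have e1 : 1 <= 8 `^ (r - 1) :> R.
  by rewrite -[leLHS](powRr0 8) ler_powR ?ler1n// subr_ge0.
have K1 : 1 <= k * 8 `^ (r - 1) by rewrite -[leLHS]mulr1 ler_pM.
have K0 : 0 <= k * 8 `^ (r - 1) by exact: le_trans K1.
exists (8 * (k * 8 `^ (r - 1))); first by rewrite -[leLHS]mulr1 ler_pM// ler1n.
move=> w mw w0 [Hw wc] cE; rewrite cE in wc; have lf := locfin_wm mw w0 Hw.
apply: backward_from_level => // x L t L0.
have h0 : 0 < (1 - g) * L `^ p by rewrite mulr_gt0 ?powR_gt0// subr_gt0.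
have V0 : 0 < L ^+ n * ((1 - g) * L `^ p) by rewrite mulr_gt0 ?exprn_gt0.
have := @A_const_box p g r k w mw w0 x L t g1 Hw _ L0; rewrite cE => /(_ (ck wc)).
set m := rm _ _; have m0 : 0 < m by exact: weight_boxes_charged.
have a0 : 0 < m / (L ^+ n * ((1 - g) * L `^ p)) by rewrite divr_gt0.
case: eqP => [->|/eqP rn] H.
  have [i [i0 H1 H2]] := ess_inf_level w0 mw a0 L0 h0 H; exists i; split => //.
    by rewrite subrr powRr0 mulr1 -ler_pdivrMr.
  by rewrite H2 divr_ge0// ltW.
have rgt1 : 1 < r by rewrite lt_neqAle eq_sym rn.
have [_ _ _ wpos] := Hw.
have [i [i0 H1 H2]] := dual_level mw w0 wpos rgt1 a0 L0 h0 H; exists i; split => //.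
by rewrite -ler_pdivrMr.
Qed.

Lemma upper_RH (p g C : R) : 1 < p -> 0 < g -> g < 1 -> 1 <= C ->
  exists2 q : R, 1 < q &
    forall (w : X -> R) (mw : measurable_fun setT w) (w0 : forall z, 0 <= w z),
      weight w -> backward_A p g C (wm mw w0) -> RH_class p 0 q%:E w.
Proof.
move=> p1 g0 g1 C1; have [d [B [d0 B0 HB]]] := upper_rect (n := n) p1 g0 g1 C1.
exists (1 + d); first by rewrite ltrDl.
move=> w mw w0 Hw Hm; split => //; have lf := locfin_wm mw w0 Hw.
apply: (@le_lt_trans _ _ (B `^ (1 + d)^-1)%:E); last exact: ltry.
apply/sup_rectP => z L L0.
have r0 : 0 < L `^ p by rewrite powR_gt0.
have V0 : 0 < L ^+ n * L `^ p by rewrite mulr_gt0 ?exprn_gt0.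
rewrite rect_minusE rect_plusE mul0r addr0 subr0 mul1r (avg_wm _ _ lf L0 r0) avg_box//.
have := HB w mw w0 Hm (weight_boxes_charged mw w0 Hw) (corner z L) L z.2 L0.
set a := rm _ _ / _; set I := (\int[_]_(_ in _) _)%E => HI.
have a0 : 0 < a by rewrite divr_gt0// weight_boxes_charged.
have q0 : 0 < 1 + d by rewrite addr_gt0.
have I0 : (0 <= I)%E by apply: integral_ge0 => y _; rewrite lee_fin powR_ge0.
rewrite inver gt_eqF// lee_pdivrMr// -EFinM.
have -> : B `^ (1 + d)^-1 * a = (B * a `^ (1 + d)) `^ (1 + d)^-1.
  by rewrite powRM ?powR_ge0 ?(ltW B0)// -powRrM mulfV ?gt_eqF// powRr1// ltW.
rewrite -poweR_EFin; apply: gt0_ler_poweR.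
- by rewrite invr_ge0 ltW.
- by rewrite in_itv/= leey andbT mule_ge0// lee_fin invr_ge0 ltW.
- by rewrite in_itv/= leey andbT lee_fin mulr_ge0 ?powR_ge0// ltW.
- by rewrite lee_pdivrMl// -EFinM mulrC.
Qed.

Lemma lower_A (p Cd g : R) (del : R -> R) : 1 < p -> 1 <= Cd ->
  (forall eta, 0 < eta -> 0 < del eta) -> 0 < g -> g < 1 ->
  exists2 r : R, 1 <= r &
    forall (w : X -> R) (mw : measurable_fun setT w) (w0 : forall z, 0 <= w z),
      weight w -> forward_RH p Cd del (wm mw w0) -> A_class p g r w.
Proof.
move=> p1 Cd1 del0 g0 g1; have [d [C [d0 C0 HC]]] := lower_rect (n := n) p1 Cd1 del0 g0 g1.
have sg0 : 0 < 1 - g by rewrite subr_gt0.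
(* With this r, 1/(1-r) = -d and r - 1 = 1/d. *)
exists (1 + d^-1); first by rewrite lerDl invr_ge0 ltW.
move=> w mw w0 Hw Hm; split => //; have lf := locfin_wm mw w0 Hw.
apply: (@le_lt_trans _ _ ((C / (1 - g)) `^ d^-1 / (1 - g))%:E); last exact: ltry.
apply/sup_rectP => z L L0.
have r0 : 0 < L `^ p by rewrite powR_gt0.
have h0 : 0 < (1 - g) * L `^ p by rewrite mulr_gt0.
have V0 : 0 < L ^+ n * L `^ p by rewrite mulr_gt0 ?exprn_gt0.
rewrite rect_minusE rect_plusE (avg_wm _ _ lf L0 h0) avg_box//.
have := HC w mw w0 Hm (weight_boxes_charged mw w0 Hw) (corner z L) L z.2 L0.
have -> : 1 + d^-1 == 1 = false by rewrite -subr_eq0 addrC addKr invr_eq0 gt_eqF.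
have -> : (1 - (1 + d^-1))^-1 = - d by rewrite opprD addNKr invrN invrK.
have -> : 1 + d^-1 - 1 = d^-1 by rewrite addrC addKr.
set m := rm _ _; set I := (\int[_]_(_ in _) _)%E => HI.
have m0 : 0 < m by exact: weight_boxes_charged.
have I0 : (0 <= I)%E by apply: integral_ge0 => y _; rewrite lee_fin powR_ge0.
set V := L ^+ n * L `^ p in V0 HI.
have VE : L ^+ n * ((1 - g) * L `^ p) = (1 - g) * V by rewrite /V; ring.
rewrite VE; have a0 : 0 < m / V by rewrite divr_gt0.
set a := m / V in a0 HI.
have -> : m / ((1 - g) * V) = a / (1 - g) by rewrite /a; field; rewrite !gt_eqF.
have gV0 : 0 < (1 - g) * V by rewrite mulr_gt0.
have A1 : ((((1 - g) * V)^-1)%:E * I <= (C / (1 - g) * a `^ (- d))%:E)%E.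
  rewrite lee_pdivrMl// -EFinM; apply: (le_trans HI); rewrite lee_fin.
  by rewrite le_eqVlt; apply/orP; left; apply/eqP; field; rewrite !gt_eqF.
have C1 : 0 <= C / (1 - g) by rewrite divr_ge0 ?ltW.
have A2 : (((((1 - g) * V)^-1)%:E * I) `^ d^-1 <= ((C / (1 - g)) `^ d^-1 * a^-1)%:E)%E.
  have -> : (C / (1 - g)) `^ d^-1 * a^-1 = (C / (1 - g) * a `^ (- d)) `^ d^-1.
    rewrite [RHS](powRM _ C1 (powR_ge0 _ _)) -powRrM mulNr mulfV ?gt_eqF//.
    by rewrite powR_inv1 ?(ltW a0).
  rewrite -poweR_EFin; apply: gt0_ler_poweR => //.
  - by rewrite invr_ge0 ltW.
  - by rewrite in_itv/= leey andbT mule_ge0// lee_fin invr_ge0 ltW.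
  - by rewrite in_itv/= leey andbT lee_fin mulr_ge0 ?powR_ge0.
apply: (@le_trans _ _ ((a / (1 - g))%:E * ((C / (1 - g)) `^ d^-1 * a^-1)%:E)%E).
  by apply: lee_wpmul2l => //; rewrite lee_fin divr_ge0 ?(ltW a0) ?(ltW sg0).
rewrite -EFinM lee_fin le_eqVlt; apply/orP; left; apply/eqP; clearbody a.
by field; rewrite !gt_eqF.
Qed.

End a_weights.

(** Dependence on the data is expressed by the order of quantifiers: the exponent is chosen from the
    constant [c] before the weight. The equality of the unions follows by taking for [c] the
    constant of the given weight. *)
Theorem theorem1p1 (R : realType) (n : nat) (p gamma : R) :
  (0 < n)%N -> 1 < p -> 0 < gamma -> gamma < 1 ->
  [/\ \bigcup_(q in [set q : \bar R | (1 < q)%E]) @RH_class R n p 0 q =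
      \bigcup_(r in [set r : R | 1 <= r]) @A_class R n p gamma r,
      forall (r : R) (c : \bar R), 1 <= r ->
        exists2 q : \bar R, (1 < q)%E &
          forall w : spacetime R n -> R,
            A_class p gamma r w -> A_const p gamma r w = c ->
            RH_class p 0 q w
    & forall (q : \bar R) (c : \bar R), (1 < q)%E ->
        exists2 r : R, 1 <= r &
          forall w : spacetime R n -> R,
            RH_class p 0 q w -> RH_const p 0 q w = c ->
            A_class p gamma r w].
Proof.
move=> _ p1 g0 g1.
have AtoRH (r : R) (c : \bar R) : 1 <= r -> exists2 q : \bar R, (1 < q)%E &
    forall w : spacetime R n -> R, A_class p gamma r w -> A_const p gamma r w = c -> RH_class p 0 q w.
  move=> r1; have [C C1 HC] := A_backward (n := n) p c g1 r1.
  have [q q1 Hq] := upper_RH (n := n) p1 g0 g1 C1; exists q%:E; first by rewrite lte_fin.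
  move=> w wA wc.
  have [[mw w0 _ _] _] := wA; apply: (Hq w mw w0); [by case: wA|exact: HC wA wc].
have RHtoA (q c : \bar R) : (1 < q)%E -> exists2 r : R, 1 <= r &
    forall w : spacetime R n -> R, RH_class p 0 q w -> RH_const p 0 q w = c -> A_class p gamma r w.
  move=> q1; have [Cd [del [Cd1 del0 HC]]] := RH_forward (n := n) p c q1.
  have [r r1 Hr] := lower_A (n := n) p1 Cd1 del0 g0 g1; exists r; first exact: r1.
  move=> w wR wc.
  have [[mw w0 _ _] _] := wR; apply: (Hr w mw w0); [by case: wR|exact: HC wR wc].
split => //; apply/seteqP; split => w [q /= q1 wq].
- by have [r r1 Hr] := RHtoA q (RH_const p 0 q w) q1; exists r; [exact: r1|exact: Hr wq erefl].
- by have [s s1 Hs] := AtoRH q (A_const p gamma q w) q1; exists s; [exact: s1|exact: Hs wq erefl].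
Qed.
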